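(* Let $\nu\ge1$ be an integer and $c_\nu:=2\nu\binom{2\nu-1}{\nu-1}$. For each $g\in\{0,1,2,3,4,5\}$ and $j\in\{1,2,3\}$, $\mathcal N_g(2\nu,j)=c_\nu^{\,j}Q_{g,j}(\nu)$, where $Q_{0,1}=1$, $Q_{0,2}=2\nu$, $Q_{0,3}=3\nu(3\nu-1)$, $Q_{1,1}=\frac1{12}\prod_{i=0}^2(\nu-i)$, $Q_{1,2}=\frac13(3\nu^2-6\nu+2)\prod_{i=0}^1(\nu-i)$, $Q_{1,3}=\frac34(17\nu^3-39\nu^2+24\nu-4)\prod_{i=0}^1(\nu-i)$, $Q_{2,1}=\frac{5\nu-7}{1440}\prod_{i=0}^4(\nu-i)$, $Q_{2,2}=\frac1{360}(2\nu-3)(49\nu^3-201\nu^2+220\nu-56)\prod_{i=0}^2(\nu-i)$, $Q_{2,3}=\frac1{160}(3\nu-5)(539\nu^4-1788\nu^3+2005\nu^2-856\nu+112)\prod_{i=0}^2(\nu-i)$, $Q_{3,1}=\frac1{362880}(35\nu^2-147\nu+124)\prod_{i=0}^6(\nu-i)$, $Q_{3,2}=\frac1{45360}(2\nu-5)(1181\nu^5-9883\nu^4+29848\nu^3-40538\nu^2+23976\nu-4464)\prod_{i=0}^3(\nu-i)$, $Q_{3,3}=\frac1{4480}(3\nu-7)(8621\nu^7-78417\nu^6+288943\nu^5-555499\nu^4+594372\nu^3-346452\nu^2+98272\nu-9920)\prod_{i=0}^2(\nu-i)$, $Q_{4,1}=\frac1{87091200}(175\nu^3-1470\nu^2+3509\nu-2286)\prod_{i=0}^8(\nu-i)$,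 $Q_{4,2}=\frac1{10886400}(21015\nu^6-248463\nu^5+1108499\nu^4-2386617\nu^3+2597902\nu^2-1313808\nu+219456)(2\nu-5)(2\nu-7)\prod_{i=0}^4(\nu-i)$, $Q_{4,3}=\frac1{1075200}(2805887\nu^{10}-46719825\nu^9+338126378\nu^8-1396332194\nu^7+3628412663\nu^6-6163425041\nu^5+6874078128\nu^4-4909790588\nu^3+2108489904\nu^2-476570112\nu+40965120)\prod_{i=0}^3(\nu-i)$, $Q_{5,1}=\frac1{11496038400}(385\nu^4-5390\nu^3+24959\nu^2-44242\nu+24528)\prod_{i=0}^{10}(\nu-i)$, $Q_{5,2}=\frac1{718502400}(2\nu-7)(2\nu-9)(168155\nu^8-3106577\nu^7+23488479\nu^6-94884829\nu^5+223426562\nu^4-312172674\nu^3+249503444\nu^2-101165280\nu+14716800)\prod_{i=0}^5(\nu-i)$, $Q_{5,3}=\frac1{141926400}(3\nu-11)(46360603\nu^{11}-880543553\nu^{10}+7377406270\nu^9-35895463278\nu^8+112326954267\nu^7-236357283609\nu^6+339283640108\nu^5-329560955560\nu^4+209749893152\nu^3-81769381200\nu^2+17052537600\nu-1373568000)\prod_{i=0}^4(\nu-i)$.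
   Context: Labelled graphs: take $j$ vertices labelled $1,\dots,j$, each carrying $2\nu$ half-edges labelled $1,\dots,2\nu$ in counterclockwise cyclic order, together with two additional distinguishable univalent vertices (''legs''), each carrying one half-edge. A 2-legged $2\nu$-valent labelled graph is a perfect matching of all these half-edges (matched pairs form edges). With the prescribed cyclic orders it is a ribbon graph, i.e. a graph embedded in a compact oriented surface whose complement is a disjoint union of open cells; its genus is the minimal genus of a compact Riemann surface on which it embeds in this way. $\mathcal N_g(2\nu,j)$ is the number of such labelled graphs that are connected and have minimal genus exactly $g$. *)

(* Defs.v *)
(* The numerators of the rational coefficients are computed in the binary
   integers Z of Stdlib: coefficients of this size are not usable as literals
   of ring_scope, which are unary. *)
From HB Require Import structures.
From Stdlib Require Import ZArith.
From mathcomp Require Import all_boot all_order all_algebra all_fingroup.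
From mathcomp Require Import zify ssrZ.

Set Implicit Arguments.
Unset Strict Implicit.
Unset Printing Implicit Defensive.

Import GRing.Theory Num.Theory.

Delimit Scope Z_scope with coq_Z.

(* [inl v] is the v-th 2nu-valent vertex, [inr l] is the l-th leg. *)
Definition vertex (j : nat) : finType := ('I_j + 'I_2)%type.

(* [inl (v, k)] is the k-th half-edge of the v-th 2nu-valent vertex, the labels
   increasing counterclockwise; [inr l] is the half-edge of the l-th leg. *)
Definition half_edge (nu j : nat) : finType :=
  ('I_j * 'I_(2 * nu) + 'I_2)%type.

Definition vertex_of (nu j : nat) (h : half_edge nu j) : vertex j :=
  match h with inl (v, _) => inl v | inr l => inr l end.

(* [ordS] is the successor modulo 2nu. *)
Definition rotate (nu j : nat) (h : half_edge nu j) : half_edge nu j :=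
  match h with inl (v, k) => inl (v, ordS k) | inr l => inr l end.

Lemma rotate_inj (nu j : nat) : injective (@rotate nu j).
Proof.
move=> [[v k]|l] [[v' k']|l'] //= [-> eq_k].
have /(bij_inj (@ordS_bij _)) -> // : ordS k = ordS k' by apply: val_inj.
Qed.

Definition rotation (nu j : nat) : {perm half_edge nu j} :=
  perm (@rotate_inj nu j).

(* A perfect matching, as the permutation exchanging matched half-edges. *)
Definition is_matching (nu j : nat) (m : {perm half_edge nu j}) : bool :=
  [forall h, (m h != h) && (m (m h) == h)].

Definition adjacent (nu j : nat) (m : {perm half_edge nu j}) : rel (vertex j) :=
  fun u v => [exists h, (vertex_of h == u) && (vertex_of (m h) == v)].

Definition is_connected (nu j : nat) (m : {perm half_edge nu j}) : bool :=
  [forall u, forall v, connect (adjacent m) u v].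

(* [h |-> rotation (m h)]: its orbits are the boundaries of the open cells
   (faces) of the surface obtained from the ribbon graph by gluing discs. *)
Definition face_perm (nu j : nat) (m : {perm half_edge nu j}) :
    {perm half_edge nu j} :=
  (m * rotation nu j)%g.

(* Euler's formula #V - #E + #F = 2 - 2g, without subtraction; the orbits of a
   matching are the edges. With the cyclic orders prescribed, a connected ribbon
   graph determines the surface, so that its genus is this g. *)
Definition has_genus (nu j g : nat) (m : {perm half_edge nu j}) : bool :=
  (#|vertex j| + #|porbits (face_perm m)| + 2 * g == #|porbits m| + 2)%N.

Definition num_graphs (g nu j : nat) : nat :=
  #|[set m : {perm half_edge nu j} |
      [&& is_matching m, is_connected m & has_genus g m]]|.

Definition c (nu : nat) : nat := (2 * nu * 'C(2 * nu - 1, nu - 1))%N.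

(* Locked, since reducing a large [int_of_Z z] is intractable. *)
HB.lock Definition ratZ (z : Z) : rat := (int_of_Z z)%:~R%R.
Canonical ratZ_unlockable := Unlockable ratZ.unlock.

Arguments ratZ z%_coq_Z.

(* The product of the nu - i for i from 0 to k, with k included. *)
Definition falling (nu k : nat) : rat :=
  (\prod_(0 <= i < k.+1) (nu%:R - i%:R))%R.

Definition Q_poly (g j nu : nat) : rat :=
  let v := Z.of_nat nu in
  let P := falling nu in
  match g, j with
  | 0%N, 1%N => (ratZ 1)%R
  | 0%N, 2%N => (ratZ (2 * v))%R
  | 0%N, 3%N => (ratZ (3 * v * (3 * v - 1)))%R
  | 1%N, 1%N => (1 / ratZ 12 * P 2%N)%R
  | 1%N, 2%N => (1 / ratZ 3 * ratZ (3 * v^2 - 6 * v + 2) * P 1%N)%R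
  | 1%N, 3%N => (ratZ 3 / ratZ 4
      * ratZ (17 * v^3 - 39 * v^2 + 24 * v - 4) * P 1%N)%R
  | 2%N, 1%N => (1 / ratZ 1440 * ratZ (5 * v - 7) * P 4%N)%R
  | 2%N, 2%N => (1 / ratZ 360
      * ratZ ((2 * v - 3) * (49 * v^3 - 201 * v^2 + 220 * v - 56)) * P 2%N)%R
  | 2%N, 3%N => (1 / ratZ 160
      * ratZ ((3 * v - 5) * (539 * v^4 - 1788 * v^3 + 2005 * v^2 - 856 * v
          + 112)) * P 2%N)%R
  | 3%N, 1%N => (1 / ratZ 362880 * ratZ (35 * v^2 - 147 * v + 124) * P 6%N)%R
  | 3%N, 2%N => (1 / ratZ 45360
      * ratZ ((2 * v - 5) * (1181 * v^5 - 9883 * v^4 + 29848 * v^3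
          - 40538 * v^2 + 23976 * v - 4464)) * P 3%N)%R
  | 3%N, 3%N => (1 / ratZ 4480
      * ratZ ((3 * v - 7) * (8621 * v^7 - 78417 * v^6 + 288943 * v^5
          - 555499 * v^4 + 594372 * v^3 - 346452 * v^2 + 98272 * v
          - 9920)) * P 2%N)%R
  | 4%N, 1%N => (1 / ratZ 87091200
      * ratZ (175 * v^3 - 1470 * v^2 + 3509 * v - 2286) * P 8%N)%R
  | 4%N, 2%N => (1 / ratZ 10886400
      * ratZ ((21015 * v^6 - 248463 * v^5 + 1108499 * v^4 - 2386617 * v^3
          + 2597902 * v^2 - 1313808 * v
          + 219456) * (2 * v - 5) * (2 * v - 7)) * P 4%N)%R
  | 4%N, 3%N => (1 / ratZ 1075200
      * ratZ (2805887 * v^10 - 46719825 * v^9 + 338126378 * v^8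
          - 1396332194 * v^7 + 3628412663 * v^6 - 6163425041 * v^5
          + 6874078128 * v^4 - 4909790588 * v^3 + 2108489904 * v^2
          - 476570112 * v + 40965120) * P 3%N)%R
  | 5%N, 1%N => (1 / ratZ 11496038400
      * ratZ (385 * v^4 - 5390 * v^3 + 24959 * v^2 - 44242 * v
          + 24528) * P 10%N)%R
  | 5%N, 2%N => (1 / ratZ 718502400
      * ratZ ((2 * v - 7) * (2 * v - 9) * (168155 * v^8 - 3106577 * v^7
          + 23488479 * v^6 - 94884829 * v^5 + 223426562 * v^4
          - 312172674 * v^3 + 249503444 * v^2 - 101165280 * v
          + 14716800)) * P 5%N)%R
  | 5%N, 3%N => (1 / ratZ 141926400
      * ratZ ((3 * v - 11) * (46360603 * v^11 - 880543553 * v^10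
          + 7377406270 * v^9 - 35895463278 * v^8 + 112326954267 * v^7
          - 236357283609 * v^6 + 339283640108 * v^5 - 329560955560 * v^4
          + 209749893152 * v^3 - 81769381200 * v^2 + 17052537600 * v
          - 1373568000)) * P 4%N)%R
  | _, _ => 0%R
  end.

(* Main.v *)
Require Import Defs.
From HB Require Import structures.
From Stdlib Require Import ZArith.
From mathcomp Require Import all_boot all_order all_algebra.
From mathcomp Require Import all_fingroup qpoly zify ssrZ ring lra.
From mathcomp Require Import ssrcomplements mpoly.

(* Colouring the faces of a ribbon graph with N colours turns the count of
   N^(number of faces) over all matchings into a Wick expansion, i.e. the moments
   of traces of an N x N Hermitian Gaussian matrix M; splitting off the component
   of the first leg leaves, for the connected two-legged graphs with weight t^j / j!,
   the ratio <(tr M)^2 exp(t tr M^(2 nu))> / <exp(t tr M^(2 nu))>.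

   All series in t are truncated: t is a nilpotent element of a ring.  The Gaussian
   correlators satisfy the loop (Schwinger-Dyson) equations, whose solution is unique
   up to a scalar.  Another solution is given by products of power sums integrated
   against the squared Vandermonde determinant and a product of one-variable
   functionals, which are the moments of the Jacobi operator L whose recurrence
   coefficients x_n solve the Freud equation x_n = n + 2 nu t (L^(2 nu - 1))_(n-1,n).
   For the latter solution the ratio above is x_N, by orthogonality.

   Hence the connected graphs with j vertices, counted with N^(number of faces), sum
   to j! [t^j] x_N, a polynomial in N, and the genus g part is its coefficient of
   N^(j (nu - 1) + 1 - 2 g).  An induction on lattice paths, diagonalized by the
   Newton basis, shows that this coefficient is c_nu^j times a polynomial in nu of
   degree less than 4 g + j <= 23.  It thus suffices to compare both sides for
   nu = 1, ..., 23, which is done by a computation in Z. *)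

Set Implicit Arguments.
Unset Strict Implicit.
Unset Printing Implicit Defensive.

Import GRing.Theory Num.Theory.

(** * Jacobi operators and the Freud equation *)

(** The weight exp(t tr M^(2 nu)) has no convergent integral, so nothing is defined by integration:
    the one-variable moments are [jacobi_pow x i 0 0], and integration by parts becomes a commutator
    identity ([mom_stein]). Proportional solutions of the loop equations give the ratio only after
    cancelling the normalization of the Vandermonde side. It is a nonzero rational number modulo t,
    which is why the ring comes with a morphism from [rat]. The factor c_nu^j counts lattice paths:
    each power of t brings one entry of L^(2 nu - 1), whose C(2 nu - 1, nu) paths times 2 nu give
    [c nu]. After division by the number of paths, Pascal's recursion becomes a difference equation,
    and solving it costs one degree. A step at height h costs at most one degree for each index of
    leading coefficient that it uses up if it carries the first term of x_n; solving doubles this.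
    The k-th leading coefficient for a vertices thus has degree at most 2 k + a - 1 in nu, and genus
    g means k = 2 g. *)

Section Jacobi.
Local Open Scope ring_scope.
Variables (R : comNzRingType) (x : nat -> R).

(* The entry (n, m) of L^k, where L has the entries L_(n,n-1) = 1 and
   L_(n,n+1) = x_(n+1). *)
Fixpoint jacobi_pow (k n m : nat) : R :=
  if k is k'.+1 then
    (if n is n'.+1 then jacobi_pow k' n' m else 0) + x n.+1 * jacobi_pow k' n.+1 m
  else (n == m)%:R.

Lemma jacobi_powS k n m : jacobi_pow k.+1 n m =
  (if n is n'.+1 then jacobi_pow k n' m else 0) + x n.+1 * jacobi_pow k n.+1 m.
Proof. by []. Qed.

(** The definition peels off the first step of a path; this is the last-step form, L^(k+1) = L^k
    L. *)
Lemma jacobi_powSr k n m : jacobi_pow k.+1 n m =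
  (if m is m'.+1 then jacobi_pow k n m' * x m else 0) + jacobi_pow k n m.+1.
Proof.
elim: k n m => [|k IHk] n m.
  case: m => [|m] /=; first by case: n => [|n] /=; rewrite ?mulr0 ?add0r ?addr0.
  rewrite !eqSS; have -> : (n == m)%:R * x m.+1 = x n.+1 * (n == m)%:R.
    by case: eqVneq => [->|_]; rewrite ?mul1r ?mulr1 ?mul0r ?mulr0.
  by rewrite addrC; case: n => [|n] /=; rewrite ?addr0.
rewrite jacobi_powS (IHk n.+1).
case: n => [|n]; first by case: m => [|m]; rewrite !jacobi_powS; ring.
rewrite IHk; case: m => [|m]; rewrite !jacobi_powS; ring.
Qed.

Lemma jacobi_pow_parity k n m : odd (n + m + k) -> jacobi_pow k n m = 0.
Proof.
elim: k n m => [|k IHk] n m /=.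
  by case: (eqVneq n m) => [->|//]; rewrite addn0 addnn odd_double.
move=> onm; rewrite IHk; last by move: onm; rewrite !addSn addnS /=.
rewrite mulr0 addr0; case: n onm => [//|n] onm; apply: IHk.
by move: onm; rewrite !addSn addnS /= negbK.
Qed.

Lemma jacobi_pow_lo k n m : (k + m < n)%N -> jacobi_pow k n m = 0.
Proof.
elim: k n m => [|k IHk] n m lt_n /=; first by rewrite gtn_eqF.
rewrite IHk; last by lia.
by rewrite mulr0 addr0; case: n lt_n => [//|n] lt_n; apply: IHk; lia.
Qed.

Lemma jacobi_pow_diag k : jacobi_pow k k 0 = 1.
Proof. by elim: k => [|k IHk]; rewrite ?eqxx // jacobi_powS IHk jacobi_pow_lo ?mulr0 ?addr0 //; lia. Qed.

Lemma jacobi_pow_hi k n m : (k + n < m)%N -> jacobi_pow k n m = 0.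
Proof.
elim: k n m => [|k IHk] n m lt_n /=; first by rewrite ltn_eqF.
rewrite IHk; last by lia.
by rewrite mulr0 addr0; case: n lt_n => [//|n] lt_n; apply: IHk; lia.
Qed.

Lemma jacobi_powD a b n m K : (b + m < K)%N ->
  jacobi_pow (a + b) n m = \sum_(k < K) jacobi_pow a n k * jacobi_pow b k m.
Proof.
elim: a n => [|a IHa] n ltK.
  have [ltnK|leKn] := ltnP n K.
    rewrite (bigD1 (Ordinal ltnK)) //= eqxx mul1r big1 ?addr0 // => i ne_i.
    by rewrite (negbTE (_ : n != i)) ?mul0r // eq_sym.
  rewrite jacobi_pow_lo; last by lia.
  rewrite big1 // => i _; rewrite /= gtn_eqF ?mul0r //.
  exact: leq_trans (ltn_ord i) leKn.
rewrite addSn jacobi_powS (IHa n.+1) //.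
under [RHS]eq_bigr => k _ do rewrite jacobi_powS mulrDl -mulrA.
rewrite big_split -mulr_sumr /=; congr (_ + _).
by case: n => [|n]; [rewrite big1 // => i _; rewrite mul0r | rewrite IHa].
Qed.

(** * Integration by parts for the moments of L *)

Section Stein.
Variables (r : nat) (u : R).
Hypothesis odd_r : odd r.
Hypothesis freud : forall n, x n.+1 - u * jacobi_pow r n n.+1 = n.+1%:R.

(* [Wp] is the strictly upper triangular part of W = L - u L^r.  W commutes with L, is
   zero on the diagonal and has the entries n + 1 just above it, so Wp L - L Wp = 1. *)
Let W n m := jacobi_pow 1 n m - u * jacobi_pow r n m.

Lemma W_comm n k :
  (if k is k'.+1 then W n k' * x k else 0) + W n k.+1 =
  (if n is n'.+1 then W n' k else 0) + x n.+1 * W n.+1 k.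
Proof.
have comm a := etrans (esym (jacobi_powSr a n k)) (jacobi_powS a n k).
move: (comm 1%N) (comm r); rewrite /W {comm}.
move: (jacobi_pow 1) (jacobi_pow r) => L1 L2.
have lin a b c d e f : a = b -> c = d -> e - f = (a - b) - u * (c - d) -> e = f.
  by move=> -> -> /eqP; rewrite !subrr mulr0 subrr subr_eq0 => /eqP.
by case: k => [|k]; case: n => [|n] e1 e2; apply: (lin _ _ _ _ _ _ e1 e2); ring.
Qed.

Let Wp n k := if (n < k)%N then W n k else 0.

Lemma Wp0 n k : (k <= n)%N -> Wp n k = 0.
Proof. by rewrite /Wp ltnNge => ->. Qed.

Lemma W_diag n : W n n = 0.
Proof. by rewrite /W !jacobi_pow_parity ?mulr0 ?subrr // addnn oddD odd_double ?odd_r. Qed.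

Lemma W_super n : W n n.+1 = n.+1%:R.
Proof.
by rewrite -freud /W jacobi_powSr /= eqxx mul1r [n == _]ltn_eqF ?addr0 // ltnW.
Qed.

Lemma Wp_comm n k :
  (if k is k'.+1 then Wp n k' * x k else 0) + Wp n k.+1 =
  (if n is n'.+1 then Wp n' k else 0) + x n.+1 * Wp n.+1 k + (n == k)%:R.
Proof.
have [ltnk|ltkn|<-] := ltngtP n k; rewrite ?addr0.
- have := W_comm n k; rewrite /Wp ltnS ltnW // => E.
  have -> : (if k is k'.+1 then (if (n < k')%N then W n k' else 0) * x k else 0)
    = (if k is k'.+1 then W n k' * x k else 0).
    case: k ltnk {E} => [//|k]; rewrite ltnS leq_eqVlt => /predU1P[<-|->] //.
    by rewrite W_diag ltnn.
  rewrite E; congr (_ + _ * _).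
    by case: n ltnk {E} => [//|n] ltnk; rewrite ltnW.
  by case: ltngtP => // [lt|<-]; [lia | rewrite W_diag].
- rewrite !Wp0 ?mulr0 ?addr0; try lia.
  case: k ltkn => [|k] ltkn; case: n ltkn => [|n] ltkn //; rewrite ?Wp0 ?mul0r //; lia.
- rewrite (Wp0 (leqnSn n)) mulr0 addr0 /Wp ltnSn W_super.
  case: n => [|n]; first by rewrite !add0r.
  by rewrite ltnSn W_super ltnNge leqnSn mul0r add0r -natr1.
Qed.

(** [Wp] acts as differentiation: [Wp, L] = 1 gives Wp L^i - L^i Wp = i L^(i-1), and L^i Wp drops
    out because the first column of the strictly upper triangular [Wp] is zero. Any [K] above i
    bounds the sum, as L^i has no entry (k, 0) with k > i. *)
Lemma jacobi_pow_deriv i n K : (i < K)%N ->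
  i%:R * jacobi_pow i.-1 n 0 = \sum_(k < K) Wp n k * jacobi_pow i k 0.
Proof.
elim: i n K => [|i IHi] n [//|K] ltiK.
  rewrite mul0r big1 // => -[[|k] ltk] _ /=; first by rewrite /Wp ltn0 mul0r.
  by rewrite mulr0.
rewrite ltnS in ltiK.
pose s1 := \sum_(k < K) Wp n k.+1 * jacobi_pow i k 0.
pose s2 := \sum_(k < K) (if nat_of_ord k is k'.+1 then Wp n k' * x k else 0) * jacobi_pow i k 0.
transitivity (s1 + s2).
  rewrite -big_split /=; under eq_bigr => k _ do rewrite -mulrDl addrC Wp_comm.
  under eq_bigr => k _ do rewrite !mulrDl -mulrA.
  rewrite !big_split /= -mulr_sumr -IHi //.
  have -> : \sum_(k < K) (n == k)%:R * jacobi_pow i k 0 = jacobi_pow i n 0.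
    by rewrite -(@jacobi_powD 0 i n 0) ?addn0.
  rewrite -natr1 mulrDl mul1r; congr (_ + _).
  case: n {s1 s2} => [|n].
    rewrite big1 ?add0r => [|k _]; last by rewrite mul0r.
    case: i ltiK IHi => [|i] ltiK IHi; first by rewrite !mul0r mulr0.
    by rewrite jacobi_powS add0r; ring.
  rewrite -IHi //; case: i ltiK IHi => [|i] ltiK IHi; first by rewrite !mul0r mulr0 addr0.
  by rewrite [in LHS]/= -/jacobi_pow; ring.
under [RHS]eq_bigr => k _ do rewrite jacobi_powS mulrDr.
rewrite big_split /=; congr (_ + _).
  by rewrite big_ord_recl mulr0 add0r.
rewrite big_ord_recr /= (@jacobi_pow_lo i) ?mulr0 ?addr0; last by lia.
rewrite /s2; case: (K) ltiK => [//|K'] ltiK.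
rewrite big_ord_recl mul0r add0r [RHS]big_ord_recr /= (@jacobi_pow_lo i) ?mulr0 ?addr0; last by lia.
by apply: eq_bigr => k _; rewrite mulrA.
Qed.

(** Integration by parts for the formal weight exp(- y^2 / 2 + u y^(r+1) / (r+1)). In row 0, [Wp]
    agrees with W = L - u L^r, so the entry (0, 0) of W L^i is also that of i L^(i-1). *)
Lemma mom_stein i :
  jacobi_pow i.+1 0 0 = i%:R * jacobi_pow i.-1 0 0 + u * jacobi_pow (r + i) 0 0.
Proof.
apply/eqP; rewrite -subr_eq; apply/eqP; rewrite (@jacobi_pow_deriv i 0 i.+1) //.
rewrite -add1n !(@jacobi_powD _ i _ _ i.+1) ?addn0 // mulr_sumr -sumrB.
apply: eq_bigr => -[[|k] ltk] _; rewrite mulrA -mulrBl.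
  by rewrite -/(W 0 0) W_diag /Wp.
by [].
Qed.

End Stein.

(* The entry (n, 0) of f(L); [bracket 0] is the functional for which the monic
   polynomials [opoly] are orthogonal. *)
Definition bracket (n : nat) (f : {poly R}) : R :=
  \sum_(i < size f) f`_i * jacobi_pow i n 0.

Lemma bracketE n (f : {poly R}) K : (size f <= K)%N ->
  bracket n f = \sum_(i < K) f`_i * jacobi_pow i n 0.
Proof.
move=> leK; rewrite /bracket (big_ord_widen _ (fun i => f`_i * jacobi_pow i n 0) leK).
rewrite big_mkcond; apply: eq_bigr => i _; case: ltnP => // le_i.
by rewrite nth_default ?mul0r.
Qed.

Lemma bracket_is_linear n : linear (bracket n : {poly R} -> R^o).
Proof.
move=> a f g; set K := maxn (size (a *: f + g)) (maxn (size f) (size g)).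
rewrite !(@bracketE n _ K); [|by rewrite /K; lia..].
rewrite scaler_sumr -big_split /=; apply: eq_bigr => i _.
by rewrite coefD coefZ mulrDl -mulrA.
Qed.
HB.instance Definition _ n := GRing.isLinear.Build R {poly R} R^o _ _ (bracket_is_linear n).

Lemma bracketX n (f : {poly R}) : bracket n ('X * f) =
  (if n is n'.+1 then bracket n' f else 0) + x n.+1 * bracket n.+1 f.
Proof.
have szXf : (size ('X * f)%R <= (size f).+1)%N.
  by rewrite (leq_trans (size_polyMleq _ _)) // size_polyX.
rewrite (bracketE n szXf) big_ord_recl coefXM mul0r add0r.
under eq_bigr => i _ do rewrite coefXM /= mulrDr.
rewrite big_split /= /bracket mulr_sumr; congr (_ + _).
  by case: n => [|n] //; rewrite big1 // => i _; rewrite mulr0.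
by apply: eq_bigr => i _; rewrite mulrCA.
Qed.

Fixpoint opoly (n : nat) : {poly R} :=
  match n with
  | 0 => 1
  | n'.+1 => match n' with
             | 0 => 'X
             | n''.+1 => 'X * opoly n' - x n' *: opoly n''
             end
  end.

Lemma opolySS n : opoly n.+2 = 'X * opoly n.+1 - x n.+1 *: opoly n.
Proof. by []. Qed.

Lemma opoly_monic_size n : (opoly n \is monic) && (size (opoly n) == n.+1).
Proof.
elim/ltn_ind: n => -[|[|n]] IHn; first by rewrite /= monic1 size_poly1.
  by rewrite /= monicX size_polyX.
have /andP[mn1 /eqP sn1] := IHn n.+1 (ltnSn _).
have /andP[_ /eqP sn] := IHn n (leqW (leqnn _)).
have sX : size ('X * opoly n.+1) = n.+3.
  by rewrite mulrC size_mulX ?sn1 // monic_neq0.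
have lt_s : (size (- (x n.+1 *: opoly n)) < size ('X * opoly n.+1)%R)%N.
  by rewrite size_polyN sX (leq_ltn_trans (size_scale_leq _ _)) // sn.
rewrite opolySS size_polyDl // sX eqxx andbT monicE lead_coefDl //.
by rewrite -monicE monicMr ?monicX.
Qed.

Lemma opoly_monic n : opoly n \is monic.
Proof. by have /andP[] := opoly_monic_size n. Qed.

Lemma size_opoly n : size (opoly n) = n.+1.
Proof. by have /andP[_ /eqP] := opoly_monic_size n. Qed.

Definition hnorm n := \prod_(i < n) x i.+1.

(** The first row of p(L), for p = [opoly n], is [hnorm n] times the n-th unit row, by the
    three-term recurrence. Orthogonality is then the vanishing of [bracket n] in degrees below n. *)
Lemma bracket_opolyM n (f : {poly R}) : bracket 0 (opoly n * f) = hnorm n * bracket n f.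
Proof.
elim/ltn_ind: n f => -[|[|n]] IHn f; rewrite /hnorm.
- by rewrite big_ord0 !mul1r.
- by rewrite /= bracketX big_ord1 add0r.
have IH1 := IHn n.+1 (ltnSn _); have IH0 := IHn n (leqW (leqnn _)).
rewrite opolySS; move: (opoly n.+1) (opoly n) IH1 IH0 => p q IH1 IH0.
rewrite mulrBl -scalerAl linearB linearZ /= (mulrC 'X) -mulrA IH1 IH0 bracketX.
rewrite /hnorm !big_ord_recr /=.
have -> (a b : R) : a *: (b : R^o) = a * b by [].
ring.
Qed.

Lemma bracket_opoly_diag n : bracket n (opoly n) = 1.
Proof.
rewrite /bracket size_opoly big_ord_recr big1 /= => [|i _].
  rewrite jacobi_pow_diag mulr1 add0r.
  by have /monicP := opoly_monic n; rewrite /lead_coef size_opoly.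
by rewrite jacobi_pow_lo ?mulr0 // addn0.
Qed.

Lemma opoly_orthogonal n m :
  bracket 0 (opoly n * opoly m) = if n == m then hnorm n else 0.
Proof.
case: eqVneq => [->|]; first by rewrite bracket_opolyM bracket_opoly_diag mulr1.
wlog ltmn : n m / (m < n)%N => [hw|_].
  rewrite neq_ltn => /orP[] lt; last by rewrite hw // gtn_eqF.
  by rewrite mulrC hw // gtn_eqF.
rewrite bracket_opolyM /bracket big1 ?mulr0 // => i _.
rewrite jacobi_pow_lo ?mulr0 // addn0 (leq_trans (ltn_ord i)) // size_opoly //.
Qed.

End Jacobi.

Arguments opoly {R} x n : simpl never.

(** * The squared Vandermonde functional *)

Section ProductFunctional.
Local Open Scope ring_scope.
Variables (R : comNzRingType) (N : nat) (mom : nat -> R).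

(* The functional on polynomials in N variables that sends each monomial to the
   product of the moments of its exponents. *)
Definition Lam (p : {mpoly R[N]}) : R :=
  \sum_(m <- msupp p) p@_m * \prod_i mom (m i).

Lemma LamwE k p : (msize p <= k)%N ->
  Lam p = \sum_(m : 'X_{1..N < k}) p@_m * \prod_i mom (m i).
Proof.
move=> le_pk; set I : subFinType _ := 'X_{1..N < k}.
rewrite /Lam (big_mksub I) ?msupp_uniq //=; first last.
  by move=> y /msize_mdeg_lt /leq_trans; apply.
by rewrite big_rmcond //= => j /memN_msupp_eq0 ->; rewrite mul0r.
Qed.

Lemma Lam_is_linear : linear (Lam : {mpoly R[N]} -> R^o).
Proof.
move=> a f g; set K := maxn (msize (a *: f + g)) (maxn (msize f) (msize g)).
rewrite !(@LamwE K); [|by rewrite /K; lia..].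
rewrite scaler_sumr -big_split /=; apply: eq_bigr => i _.
by rewrite mcoeffD mcoeffZ mulrDl -mulrA.
Qed.
HB.instance Definition _ := GRing.isLinear.Build R {mpoly R[N]} R^o _ _ Lam_is_linear.

Lemma LamZ a p : Lam (a *: p) = a * Lam p.
Proof. exact: (linearZ_LR Lam). Qed.

Lemma Lam_sum (I : Type) (l : seq I) (P : pred I) F :
  Lam (\sum_(i <- l | P i) F i) = \sum_(i <- l | P i) Lam (F i).
Proof. exact: (raddf_sum (Lam : {mpoly R[N]} -> R^o)). Qed.

Lemma LamMn p n : Lam (p *+ n) = Lam p *+ n.
Proof. exact: (raddfMn (Lam : {mpoly R[N]} -> R^o)). Qed.

Lemma LamX m : Lam 'X_[m] = \prod_i mom (m i).
Proof. by rewrite /Lam msuppX big_seq1 mcoeffX eqxx mul1r. Qed.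

Definition ev (q : {poly R}) (i : 'I_N) : {mpoly R[N]} :=
  (map_poly (@mpolyC N R) q).['X_i].

Definition phi (q : {poly R}) : R := \sum_(k < size q) q`_k * mom k.

Lemma Lam_ev (q : 'I_N -> {poly R}) : Lam (\prod_i ev (q i) i) = \prod_i phi (q i).
Proof.
pose K := \max_i size (q i).
have leK i : (size (q i) <= K)%N by apply: leq_bigmax.
have -> : \prod_i ev (q i) i = \prod_i \sum_(k < K) ((q i)`_k *: 'X_i ^+ k).
  apply: eq_bigr => i _; rewrite /ev (@horner_coef_wide _ K); last first.
    exact: leq_trans (size_poly _ _) (leK i).
  by apply: eq_bigr => k _; rewrite coef_map /= mul_mpolyC.
have -> : \prod_i phi (q i) = \prod_i \sum_(k < K) ((q i)`_k * mom k).
  apply: eq_bigr => i _; rewrite /phi.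
  rewrite (big_ord_widen _ (fun k => (q i)`_k * mom k) (leK i)) big_mkcond.
  by apply: eq_bigr => k _; case: ltnP => // le_k; rewrite nth_default ?mul0r.
rewrite !bigA_distr_bigA linear_sum; apply: eq_bigr => f _.
rewrite scaler_prod /= LamZ big_split /=; congr (_ * _).
have -> : \prod_i 'X_i ^+ f i = 'X_[[multinom (f i : nat) | i < N]] :> {mpoly R[N]}.
  by rewrite mpolyXE_id; apply: eq_bigr => i _; rewrite mnmE.
by rewrite LamX; apply: eq_bigr => i _; rewrite mnmE.
Qed.

Definition power_sum (a : nat) : {mpoly R[N]} := \sum_i 'X_i ^+ a.
Definition vdm : {mpoly R[N]} := \prod_(i < N) \prod_(j < N | (i < j)%N) ('X_j - 'X_i).

Definition vdm_corr (s : seq nat) : R := Lam (vdm ^+ 2 * \prod_(b <- s) power_sum b).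

Lemma vdm_corr0 s : vdm_corr (0%N :: s) = N%:R * vdm_corr s.
Proof.
have ps0 : power_sum 0 = N%:R.
  by rewrite /power_sum -[N in N%:R]card_ord -sumr_const; apply: eq_bigr => i _; rewrite expr0.
by rewrite /vdm_corr big_cons ps0 mulrCA [in LHS]mulr_natl LamMn mulr_natl.
Qed.

(** The vector field with components x_i^a, whose action on the integrand generates the loop
    equations. *)
Definition delta a (p : {mpoly R[N]}) := \sum_i 'X_i ^+ a * p^`M(i).

Lemma deltaM a p q : delta a (p * q) = delta a p * q + p * delta a q.
Proof.
rewrite /delta mulr_suml mulr_sumr -big_split /=; apply: eq_bigr => i _.
by rewrite mderivM; ring.
Qed.

Lemma delta1 a : delta a 1 = 0.
Proof.
by rewrite /delta big1 // => i _; rewrite -(@mpolyC1 N R) mderivC mulr0.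
Qed.

Lemma deltaB a p q : delta a (p - q) = delta a p - delta a q.
Proof.
by rewrite /delta -sumrB; apply: eq_bigr => i _; rewrite mderivB mulrBr.
Qed.

Lemma mderivXn i j b :
  ('X_j ^+ b : {mpoly R[N]})^`M(i) = if i == j then b%:R * 'X_i ^+ b.-1 else 0.
Proof.
rewrite mpolyXn mderivX mulmnE mnm1E; case: eqVneq => [<-|ne].
  rewrite mul1n; case: b => [|b]; first by rewrite scale0r mul0r.
  by rewrite mulmS addmC addmK -mpolyXn -mul_mpolyC mpolyC_nat.
by rewrite mul0n scale0r.
Qed.

Lemma deltaXn a b j : delta a ('X_j ^+ b) = b%:R * 'X_j ^+ (a + b).-1.
Proof.
rewrite /delta (bigD1 j) //= mderivXn eqxx big1 ?addr0 => [|i ne].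
  rewrite mulrCA -exprD; case: b => [|b]; first by rewrite !mul0r.
  by rewrite addnS.
by rewrite mderivXn (negbTE ne) mulr0.
Qed.

Lemma delta_sum a (I : Type) (s : seq I) F :
  delta a (\sum_(i <- s) F i) = \sum_(i <- s) delta a (F i).
Proof.
rewrite /delta exchange_big; apply: eq_bigr => i _ /=.
by rewrite linear_sum mulr_sumr.
Qed.

Lemma delta_power_sum a b : delta a (power_sum b) = b%:R * power_sum (a + b).-1.
Proof.
by rewrite delta_sum mulr_sumr; apply: eq_bigr => i _; rewrite deltaXn.
Qed.

Lemma delta_prod_power_sum a s : delta a (\prod_(b <- s) power_sum b) =
  \sum_(k < size s) (nth 0%N s k)%:R *
     \prod_(b <- (a + nth 0%N s k).-1 :: take k s ++ drop k.+1 s) power_sum b.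
Proof.
elim: s => [|b s IHs]; first by rewrite big_nil delta1 big_ord0.
rewrite big_cons deltaM delta_power_sum IHs big_ord_recl /= drop0 big_cons.
rewrite mulrA; congr (_ + _); rewrite mulr_sumr; apply: eq_bigr => k _.
by rewrite !big_cons; ring.
Qed.

(** The sum of (x_j^a - x_i^a) / (x_j - x_i) over i < j, written as a polynomial: the logarithmic
    derivative of [vdm] along [delta a]. *)
Definition vdm_ratio a : {mpoly R[N]} :=
  \sum_(i < N) \sum_(j < N | (i < j)%N) \sum_(b < a) 'X_j ^+ (a.-1 - b) * 'X_i ^+ b.

Lemma delta_vdm a : delta a vdm = vdm * vdm_ratio a.
Proof.
pose P (p g : {mpoly R[N]}) := delta a p = p * g.
have P1 : P 1 0 by rewrite /P delta1 mulr0.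
have PM p g q h : P p g -> P q h -> P (p * q) (g + h).
  by rewrite /P => Pp Pq; rewrite deltaM Pp Pq; ring.
apply: (big_ind2 P) => // i _; apply: (big_ind2 P) => // j _.
rewrite /P deltaB.
have deltaX k : delta a 'X_k = 'X_k ^+ a.
  by rewrite -['X_k in LHS]expr1 deltaXn mul1r addn1.
by rewrite !deltaX subrXX.
Qed.

(** The right side is the sum of the geometric sums [G i j] over all ordered pairs. As [G] is
    symmetric, the two halves off the diagonal are equal, and [G i i] is a x_i^(a-1). *)
Lemma vdm_ratio_double a :
  vdm_ratio a *+ 2 + a%:R * power_sum a.-1 = \sum_(b < a) power_sum b * power_sum (a.-1 - b).
Proof.
pose G (i j : 'I_N) : {mpoly R[N]} := \sum_(b < a) 'X_j ^+ (a.-1 - b) * 'X_i ^+ b.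
have GC i j : G i j = G j i.
  rewrite /G [RHS](reindex_inj rev_ord_inj) /=; apply: eq_bigr => b _.
  rewrite mulrC; congr ('X_i ^+ _ * 'X_j ^+ _); have := ltn_ord b; lia.
have -> : \sum_(b < a) power_sum b * power_sum (a.-1 - b) = \sum_i \sum_j G i j.
  rewrite /G; under [RHS]eq_bigr do rewrite exchange_big /=.
  rewrite [RHS]exchange_big /=; apply: eq_bigr => b _.
  rewrite /power_sum mulr_suml; apply: eq_bigr => i _; rewrite mulr_sumr.
  by apply: eq_bigr => j _; rewrite mulrC.
have -> : a%:R * power_sum a.-1 = \sum_i G i i.
  rewrite mulr_sumr; apply: eq_bigr => i _; rewrite /G.
  under eq_bigr => b _.
    rewrite -exprD (_ : (a.-1 - b + b)%N = a.-1); last by have := ltn_ord b; lia.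
    over.
  by rewrite sumr_const card_ord mulr_natl.
have -> : \sum_i \sum_j G i j = \sum_(i < N) (\sum_(j < N | (i < j)%N) G i j
    + \sum_(j < N | (j < i)%N) G i j + G i i).
  apply: eq_bigr => i _; rewrite (bigID (fun j : 'I_N => (i < j)%N)) /= -addrA.
  congr (_ + _); rewrite addrC (bigD1 i) ?ltnn //=; congr (_ + _).
  by apply: eq_bigl => j; rewrite -val_eqE /=; lia.
rewrite !big_split /=; congr (_ + _); rewrite mulr2n; congr (_ + _).
rewrite /vdm_ratio -/(G _ _).
rewrite [RHS](exchange_big_dep xpredT) //=; apply: eq_bigr => i _.
by apply: eq_bigr => j _; apply: GC.
Qed.

Variables (u : R) (r : nat).
Hypothesis stein : forall i, mom i.+1 = i%:R * mom i.-1 + u * mom (r + i)%N.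

(** Integration by parts in one variable: by linearity it suffices to treat monomials, where it is
    [stein] for the exponent of x_i. *)
Lemma Lam_stein i (p : {mpoly R[N]}) :
  Lam ('X_i * p) = Lam p^`M(i) + u * Lam ('X_i ^+ r * p).
Proof.
elim/mpolyind: p => [|c m p _ _ IHp].
  by rewrite !mulr0 mderiv0 linear0 mulr0 addr0.
rewrite mderivD !mulrDr !linearD /= IHp mulrDr addrACA; congr (_ + _) => {IHp p}.
rewrite -!scalerAr mderivZ !LamZ [u * _]mulrCA -mulrDr; congr (_ * _).
rewrite mderivX LamZ mpolyXn -!mpolyXD !LamX.
have D (F : 'I_N -> R) : \prod_j F j = F i * \prod_(j | j != i) F j.
  exact: bigD1.
rewrite !D !(mnmDE, mnmBE, mulmnE, mnm1E) eqxx mul1n add1n subn1 stein.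
rewrite mulrDl !mulrA; congr (_ * _ + _ * _); apply: eq_bigr => j ne;
  by rewrite !(mnmDE, mnmBE, mulmnE, mnm1E) eq_sym (negbTE ne) ?mul0n ?subn0.
Qed.

(** [Lam_stein] is applied to x_i^a F and summed over i. The square of [vdm] doubles [vdm_ratio],
    and the derivative of x_i^a supplies the diagonal part missing in [vdm_ratio_double]; this gives
    the splitting terms. The derivatives of the other power sums give the joining terms. *)
Lemma vdm_corr_loop a s : vdm_corr (a.+1 :: s) =
  \sum_(b < a) vdm_corr (nat_of_ord b :: (a.-1 - b)%N :: s)
  + \sum_(k < size s) (nth 0%N s k)%:R *
      vdm_corr ((a + nth 0%N s k).-1 :: take k s ++ drop k.+1 s)
  + u * vdm_corr ((r + a)%N :: s).
Proof.
rewrite /vdm_corr; set P := \prod_(b <- s) power_sum b; set F := vdm ^+ 2 * P.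
have -> : vdm ^+ 2 * (\prod_(b <- a.+1 :: s) power_sum b) = \sum_i 'X_i * ('X_i ^+ a * F).
  rewrite big_cons mulrCA -/F mulr_suml; apply: eq_bigr => i _.
  by rewrite mulrA exprS.
rewrite linear_sum /=; under eq_bigr => i _ do rewrite Lam_stein.
rewrite big_split /= -mulr_sumr -!(linear_sum Lam) /=; congr (_ + _ * _); last first.
  rewrite big_cons mulrCA -/F mulr_suml; congr (Lam _); apply: eq_bigr => i _.
  by rewrite exprD mulrA.
have -> : \sum_(i < N) ('X_i ^+ a * F)^`M(i) =
    vdm ^+ 2 * (\sum_(b < a) power_sum b * power_sum (a.-1 - b) * P) + vdm ^+ 2 * delta a P.
  have -> : \sum_(i < N) ('X_i ^+ a * F)^`M(i) = a%:R * power_sum a.-1 * F + delta a F.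
    rewrite mulr_sumr mulr_suml -big_split; apply: eq_bigr => i _ /=.
    by rewrite mderivM mderivXn eqxx.
  rewrite -mulr_suml -vdm_ratio_double /F expr2 !deltaM !delta_vdm.
  rewrite mulr2n; ring.
rewrite linearD /= mulr_sumr linear_sum delta_prod_power_sum mulr_sumr !linear_sum /=.
congr (_ + _); apply: eq_bigr => k _.
  by rewrite !big_cons !mulrA.
rewrite mulrCA [in LHS]mulr_natl LamMn mulr_natl; congr (_ *+ _).
Qed.

End ProductFunctional.

(** * Determinants of orthogonal polynomials *)

Section Determinant.
Local Open Scope ring_scope.
Variables (R : comNzRingType) (N : nat) (x : nat -> R).

Let mom i := jacobi_pow x i 0 0.

Definition evmx (f : nat -> {poly R}) : 'M[{mpoly R[N]}]_N :=
  \matrix_(i, j) ev (f i) j.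

Lemma phi_bracket (q : {poly R}) : phi mom q = bracket x 0 q.
Proof. by []. Qed.

Lemma evD q1 q2 (j : 'I_N) : ev (q1 + q2 : {poly R}) j = ev q1 j + ev q2 j.
Proof. by rewrite /ev rmorphD hornerD. Qed.

Lemma evZ a q (j : 'I_N) : ev (a *: q : {poly R}) j = a%:MP * ev q j.
Proof. by rewrite /ev map_polyZ hornerZ. Qed.

Lemma evM q1 q2 (j : 'I_N) : ev (q1 * q2 : {poly R}) j = ev q1 j * ev q2 j.
Proof. by rewrite /ev rmorphM hornerM. Qed.

Lemma evX (j : 'I_N) : ev 'X j = 'X_j :> {mpoly R[N]}.
Proof. by rewrite /ev map_polyX hornerX. Qed.

(** The passage from the powers of the variable to monic polynomials of the same degrees is
    unitriangular. *)
Lemma vdm_opoly : vdm R N = \det (evmx (opoly x)).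
Proof.
pose a : 'rV[{mpoly R[N]}]_N := \row_j 'X_j.
pose T : 'M[{mpoly R[N]}]_N := \matrix_(i, k) ((opoly x i)`_k)%:MP.
have -> : evmx (opoly x) = T *m Vandermonde N a.
  apply/matrixP => i j; rewrite !mxE /ev (@horner_coef_wide _ N); last first.
    by apply: leq_trans (size_poly _ _) _; rewrite size_opoly.
  by apply: eq_bigr => k _; rewrite coef_map !mxE.
rewrite det_mulmx det_trig; last first.
  apply/is_trig_mxP => i j ltij; rewrite mxE nth_default ?mpolyC0 //.
  by rewrite size_opoly.
rewrite big1 ?mul1r => [|i _]; last first.
  rewrite mxE; have /monicP := opoly_monic x i; rewrite /lead_coef size_opoly /=.
  by move=> ->; rewrite mpolyC1.
rewrite det_Vandermonde; apply: eq_bigr => i _; apply: eq_bigr => j _.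
by rewrite !mxE.
Qed.

(** The functional factors over the variables, so among the pairs of permutations in the two
    expanded determinants orthogonality kills the unequal ones; the N! equal pairs give the same
    product. *)
Lemma Lam_det_sq f H :
  (forall i j : nat, (i < N)%N -> (j < N)%N ->
     bracket x 0 (f i * f j) = if i == j then H i else 0) ->
  Lam mom (\det (evmx f) ^+ 2) = N`!%:R * \prod_(i < N) H i.
Proof.
(* After transposition the products run over the variables, as [Lam_ev] requires. *)
move=> orth; rewrite -det_tr expr2 /determinant mulr_suml Lam_sum /=.
transitivity (\sum_(s : 'S_N) \prod_(i < N) H i); last first.
  by rewrite sumr_const card_Sn mulr_natl.
apply: eq_bigr => s _; rewrite mulr_sumr Lam_sum (bigD1 s) //=.
rewrite [X in _ + X]big1 ?addr0 => [|s' ne_s].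
  have -> : (-1) ^+ s * (\prod_i (evmx f)^T i (s i)) *
      ((-1) ^+ s * (\prod_i (evmx f)^T i (s i))) =
      \prod_i ev (f (s i) * f (s i)) i.
    rewrite mulrACA -expr2 sqrr_sign mul1r -big_split; apply: eq_bigr => i _.
    by rewrite !mxE /= evM.
  rewrite Lam_ev [RHS](reindex_inj (@perm_inj _ s)); apply: eq_bigr => i _.
  by rewrite phi_bracket orth ?ltn_ord // eqxx.
have -> : (-1) ^+ s * (\prod_i (evmx f)^T i (s i)) *
    ((-1) ^+ s' * (\prod_i (evmx f)^T i (s' i))) =
    ((-1) ^+ s * (-1) ^+ s') *: \prod_i ev (f (s i) * f (s' i)) i.
  rewrite mulrACA -mul_mpolyC; congr (_ * _).
    by rewrite rmorphM !rmorphXn /= !mpolyCN mpolyC1.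
  rewrite -big_split; apply: eq_bigr => i _.
  by rewrite !mxE /= evM.
rewrite LamZ Lam_ev.
have [i ne_i] : exists i, s i != s' i.
  apply/existsP; apply: contraR ne_s; rewrite negb_exists => /forallP eq_s.
  by apply/eqP/permP => i; apply/esym/eqP; have := eq_s i; rewrite negbK.
by rewrite (bigD1 i) //= phi_bracket orth ?ltn_ord // ifN // mul0r mulr0.
Qed.

End Determinant.

(** * The coefficient x_N as a ratio of correlators *)

Section TodaIdentity.
Local Open Scope ring_scope.
Variables (R : comNzRingType) (N' : nat) (x : nat -> R).
Local Notation N := N'.+1.

Let f i : {poly R} := if i == N' then opoly x N else opoly x i.

(** The power sum multiplies each row in turn by the variables. The recurrence turns row i into
    p_(i+1) + x_i p_(i-1), and every determinant so obtained has two equal rows, except the one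
    whose last row becomes p_N. *)
Lemma power_sum1_vdm : power_sum R N 1 * vdm R N = \det (evmx N f).
Proof.
rewrite (vdm_opoly _ x).
pose M (i : 'I_N) : 'M[{mpoly R[N]}]_N :=
  \matrix_(k, j) (if k == i then 'X_j * ev (opoly x k) j else ev (opoly x k) j).
have -> : power_sum R N 1 * \det (evmx N (opoly x)) = \sum_i \det (M i).
  rewrite /determinant mulr_sumr exchange_big; apply: eq_bigr => s _ /=.
  rewrite mulrCA -mulr_sumr; congr (_ * _); rewrite /power_sum.
  (* In the term of the permutation s the power sum is reordered by s, so that its i-th summand
     joins the factor of row i. *)
  rewrite (reindex_inj (@perm_inj _ s)) mulr_suml; apply: eq_bigr => i _ /=.
  rewrite expr1 (bigD1 i) //= [RHS](bigD1 i) //= !mxE eqxx mulrA.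
  congr (_ * _); apply: eq_bigr => k ne; by rewrite !mxE (negbTE ne).
have zero (g : nat -> {poly R}) (i k : 'I_N) : i != k -> g i = g k -> \det (evmx N g) = 0.
  move=> ne eq_g; apply: (determinant_alternate ne) => j; by rewrite !mxE eq_g.
have split (i : 'I_N) :
  \det (M i) = \det (evmx N (fun k => if k == i then opoly x k.+1 else opoly x k)).
  case: i => -[|i] lti.
    congr (\det _); apply/matrixP => k j; rewrite !mxE -val_eqE /=.
    by case: (nat_of_ord k) => [|k'] //=; rewrite -evX -evM mulr1.
  pose g1 k := if k == i.+1 then opoly x k.+1 else opoly x k.
  pose g2 k := if k == i.+1 then opoly x k.-1 else opoly x k.
  rewrite -/g1 (@determinant_multilinear _ _ _ (evmx N g1) (evmx N g2)
    (Ordinal lti) 1 (x i.+1)%:MP).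
  - rewrite mul1r (zero g2 (Ordinal lti) (Ordinal (ltnW lti))) ?mulr0 ?addr0 //.
      by rewrite -val_eqE /= gtn_eqF.
    by rewrite /g2 /= eqxx ltn_eqF.
  - apply/rowP => j; rewrite !mxE eqxx /g1 /g2 /= eqxx /=.
    rewrite mul1r -evZ -evD -evX -evM; congr (ev _ j).
    by rewrite opolySS subrK.
  - apply/matrixP => k j; rewrite !mxE /g1 -[i.+1]/(val (Ordinal lti)) val_eqE.
    by rewrite eq_sym (negbTE (neq_lift _ _)).
  - apply/matrixP => k j; rewrite !mxE /g2 -[i.+1]/(val (Ordinal lti)) val_eqE.
    by rewrite eq_sym (negbTE (neq_lift _ _)).
under eq_bigr => i _ do rewrite split.
rewrite big_ord_recr /= big1 ?add0r => [|i _].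
  congr (\det _); apply/matrixP => k j; rewrite !mxE /f.
  by case: eqP => [->|].
have ltS : (i.+1 < N)%N by rewrite ltnS.
apply: (zero _ (widen_ord (leqnSn _) i) (Ordinal ltS)) => /=.
  by rewrite -val_eqE /= ltn_eqF.
by rewrite eqxx gtn_eqF.
Qed.

Let mom i := jacobi_pow x i 0 0.

Lemma vdm_corr_nil : vdm_corr N mom [::] = N`!%:R * \prod_(i < N) hnorm x i.
Proof.
rewrite /vdm_corr big_nil mulr1 (vdm_opoly _ x); apply: Lam_det_sq => i j _ _.
exact: opoly_orthogonal.
Qed.

(** Each of the two factors [power_sum R N 1] goes to one copy of [vdm]. The last norm [hnorm x N']
    is thereby replaced by [hnorm x N], which has the additional factor x_N. *)
Lemma vdm_corr_11 : vdm_corr N mom [:: 1; 1]%N = x N * vdm_corr N mom [::].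
Proof.
rewrite vdm_corr_nil /vdm_corr !big_cons big_nil mulr1.
have -> : vdm R N ^+ 2 * (power_sum R N 1 * power_sum R N 1) = (power_sum R N 1 * vdm R N) ^+ 2 by ring.
rewrite power_sum1_vdm.
rewrite (@Lam_det_sq _ _ _ _ (fun i => if i == N' then hnorm x N else hnorm x i)).
  rewrite !big_ord_recr /= eqxx.
  have -> : hnorm x N = hnorm x N' * x N by rewrite /hnorm big_ord_recr.
  have -> : \prod_(i < N') (if i == N' :> nat then hnorm x N' * x N else hnorm x i)
      = \prod_(i < N') hnorm x i.
    by apply: eq_bigr => i _; rewrite ltn_eqF.
  by ring.
move=> i j lti ltj; rewrite /f; case: eqP => [->|ni]; case: eqP => [->|nj];
  rewrite opoly_orthogonal ?eqxx //.
- by rewrite gtn_eqF // ifF //; apply/negbTE; rewrite eq_sym; apply/eqP.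
- rewrite ltn_eqF // ifF //; exact/negbTE/eqP.
Qed.

End TodaIdentity.

(** * Wick expansions *)

Definition rem_at (T : Type) (k : nat) (s : seq T) := take k s ++ drop k.+1 s.

Lemma size_rem_at (T : Type) k (s : seq T) : k < size s -> size (rem_at k s) = (size s).-1.
Proof. by move=> ltk; rewrite size_cat size_take size_drop ltk; lia. Qed.

Lemma map_rem_at (T U : Type) (f : T -> U) k s :
  map f (rem_at k s) = rem_at k (map f s).
Proof. by rewrite map_cat map_take map_drop. Qed.

Lemma perm_rem_at (T : eqType) x0 k (s : seq T) : k < size s ->
  perm_eq (nth x0 s k :: rem_at k s) s.
Proof.
move=> ltk; rewrite -[X in perm_eq _ X](cat_take_drop k) (drop_nth x0) //.
by rewrite -cat1s perm_catCA.
Qed.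

Lemma sum_rem_cat (T : Type) (F : T -> seq T -> nat) q0 (u v : seq T) :
  \sum_(k < size (u ++ v)) F (nth q0 (u ++ v) k) (rem_at k (u ++ v)) =
  \sum_(k < size u) F (nth q0 u k) (rem_at k u ++ v)
  + \sum_(k < size v) F (nth q0 v k) (u ++ rem_at k v).
Proof.
rewrite size_cat big_split_ord /=; congr (_ + _); apply: eq_bigr => k _.
  move: (nat_of_ord k) (ltn_ord k) => j ltj.
  have -> : nth q0 (u ++ v) j = nth q0 u j by rewrite nth_cat ltj.
  suff -> : rem_at j (u ++ v) = rem_at j u ++ v by [].
  rewrite /rem_at takel_cat ?(ltnW ltj) // drop_cat -catA.
  have [_|lt|e] := ltngtP j.+1 (size u) => //; first by rewrite ltnNge ltj in lt.
  by rewrite -e subnn drop0 e drop_size.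
have -> : nth q0 (u ++ v) (size u + k) = nth q0 v k by rewrite nth_cat ltnNge leq_addr addKn.
suff -> : rem_at (size u + k) (u ++ v) = u ++ rem_at k v by [].
by rewrite /rem_at take_cat ltnNge leq_addr addKn -addnS drop_cat ltnNge leq_addr addKn catA.
Qed.

Section Wick.
Variable I : finType.
Implicit Types (p q : I * I) (w : seq (I * I)).

Definition swap_pair p := (p.2, p.1).

Fixpoint wick_rec n w : nat :=
  match n, w with
  | _, [::] => 1
  | 0, _ :: _ => 0
  | n'.+1, p :: w' =>
      \sum_(k < size w') (nth p w' k == swap_pair p) * wick_rec n' (rem_at k w')
  end.

(* The moment of the product of the entries M_p, p in w, of a Gaussian matrix with
   E[M_(i,k) M_(k,i)] = 1. *)
Definition wick w := wick_rec (size w) w.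

Lemma wick_rec_wide n w : size w <= n -> wick_rec n w = wick w.
Proof.
rewrite /wick; have [m] := ubnP (size w); elim: m n w => // m IHm n [|p w]; first by case: n.
case: n => [//|n]; rewrite /= !ltnS => ltm len; apply: eq_bigr => k _.
congr (_ * _); have ltk := ltn_ord k; have sz := size_rem_at ltk.
by rewrite IHm ?(IHm (size w)) ?sz //; lia.
Qed.

Lemma wick_cons p w :
  wick (p :: w) = \sum_(k < size w) (nth p w k == swap_pair p) * wick (rem_at k w).
Proof.
rewrite {1}/wick /=; apply: eq_bigr => k _; congr (_ * _).
by rewrite wick_rec_wide // size_rem_at //; lia.
Qed.

Section Matchings.
Variables (H : finType) (L : H -> I * I).
Implicit Types (s : seq H) (m : {perm H}).

Definition matching_on s m :=
  [forall h, if h \in s then (m h != h) && (m (m h) == h) else m h == h].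

Definition compatible s m := [forall (h | h \in s), L (m h) == swap_pair (L h)].

Definition wick_set s := [set m | matching_on s m && compatible s m].

Lemma wick_set_perm s s' : s =i s' -> wick_set s = wick_set s'.
Proof.
move=> eq_s; apply/setP => m; rewrite !inE; congr (_ && _).
  by apply: eq_forallb => h; rewrite eq_s.
by apply: eq_forallb => h; rewrite eq_s.
Qed.

Lemma matching_onP s m :
  reflect ((forall h, h \in s -> m h != h /\ m (m h) = h) /\
           (forall h, h \notin s -> m h = h)) (matching_on s m).
Proof.
apply: (iffP forallP) => [mP|[m1 m2] h].
  split=> h hs; have := mP h; first by rewrite hs => /andP[-> /eqP].
  by rewrite (negbTE hs) => /eqP.
by case: ifPn => hs; [have [-> ->] := m1 h hs; rewrite eqxx | rewrite m2].
Qed.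

Lemma matching_on_in s m h : matching_on s m -> h \in s -> m h \in s.
Proof.
case/matching_onP => m1 m2 hs; have [ne _] := m1 h hs.
by apply: contraR ne => nhs; apply/eqP/(@perm_inj _ m)/m2.
Qed.

(** The recursion of [wick] chooses the partner h' of the first half-edge h. Composition with the
    transposition of h and h' removes this edge and is a bijection onto the matchings of the
    remaining half-edges. *)
Lemma card_wick_set s : uniq s -> #|wick_set s| = wick (map L s).
Proof.
have [n] := ubnP (size s); elim: n s => // n IHn [|h s] ltn uniq_s.
  rewrite [wick _]/= (_ : wick_set [::] = [set 1%g]) ?cards1 //.
  apply/setP => m; rewrite !inE; apply/andP/eqP => [[/matching_onP[_ m2] _]|->].
    by apply/permP => h; rewrite perm1 m2.
  by split; apply/forallP => h //=; rewrite perm1 eqxx.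
rewrite [map L _]/= wick_cons size_map.
case/andP: (uniq_s) => h_s us; rewrite ltnS /= in ltn.
rewrite -sum1_card (partition_big (fun m : {perm H} => m h) (mem s)) /=; last first.
  move=> m; rewrite inE => /andP[mm _].
  have := matching_on_in mm (mem_head h s); rewrite inE => /predU1P[eqh|//].
  by case/matching_onP: mm => /(_ h (mem_head _ _))[]; rewrite eqh eqxx.
rewrite -big_uniq // (big_nth h) big_mkord; apply: eq_bigr => k _.
have ltk := ltn_ord k; set h' := nth h s k.
have h's : h' \in s by rewrite mem_nth.
have ne_h : h' != h by apply: contraNneq h_s => <-.
rewrite (nth_map h) // -/h' -map_rem_at.
have mem_s : s =i h' :: rem_at k s.
  by move=> z; rewrite (perm_mem (perm_rem_at h ltk)).
have : uniq (h' :: rem_at k s) by rewrite (perm_uniq (perm_rem_at h ltk)).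
case/andP => h'_r ur; have h_r : h \notin rem_at k s.
  by apply: contra h_s; rewrite mem_s inE orbC => ->.
have ltr : size (rem_at k s) < n by rewrite size_rem_at //; lia.
rewrite -(IHn _ ltr ur) sum1dep_card.
have [eqL|neL] := boolP (_ == swap_pair _); last first.
  rewrite mul0n; apply: eq_card0 => m; rewrite !inE; apply/negP.
  case/andP=> /andP[_ /forall_inP/(_ h (mem_head _ _))] + /eqP mh.
  by rewrite mh (negbTE neL).
rewrite mul1n -[LHS]cardsE -[RHS](card_preimset _ (mulgI (tperm h h'))).
congr #|pred_of_set _|; apply/setP => m; rewrite !inE.
have mE z : (tperm h h' * m)%g z = m (tperm h h' z) by rewrite permM.
apply/andP/andP => [[/andP[/matching_onP[m1 m2] cm] /eqP mh]|[mm cm]].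
  have mh' : m h' = h by have [_] := m1 h (mem_head _ _); rewrite mh.
  have off z : z \in rem_at k s -> [/\ z != h, z != h' & z \in h :: s].
    move=> zr; split; first by apply: contraNneq h_r => <-.
      by apply: contraNneq h'_r => <-.
    by rewrite inE mem_s inE zr !orbT.
  have moff z : z \in rem_at k s -> (tperm h h' * m)%g z = m z.
    by case/off=> zh zh' _; rewrite mE tpermD // eq_sym.
  split.
    apply/matching_onP; split=> z zr.
      have [zh zh' zs] := off z zr; have [mz mmz] := m1 z zs.
      rewrite moff //; split=> //; rewrite mE tpermD ?mmz //; apply/negP => /eqP e.
        by move: zh'; rewrite -mh e mmz eqxx.
      by move: zh; rewrite -mh' e mmz eqxx.
    rewrite mE; case: tpermP => [->|->|/eqP zh /eqP zh'] //.
    by apply: m2; rewrite inE mem_s inE (negbTE zh) (negbTE zh') (negbTE zr).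
  apply/forall_inP => z zr; rewrite moff //; have [_ _ zs] := off z zr.
  by move/forall_inP: cm => /(_ z zs).
have [m1 m2] := matching_onP _ _ mm.
have mE' z : m z = (tperm h h' * m)%g (tperm h h' z) by rewrite mE tpermK.
have mh : m h = h' by rewrite mE' tpermL m2.
have mh' : m h' = h by rewrite mE' tpermR m2.
have moff z : z \in rem_at k s -> (tperm h h' * m)%g z = m z.
  move=> zr; rewrite mE tpermD //; first by apply: contraNneq h_r => ->.
  by apply: contraNneq h'_r => ->.
rewrite mh eqxx; split=> //; apply/andP; split.
  apply/matching_onP; split=> z.
    rewrite inE => /predU1P[->|]; first by rewrite mh mh'.
    rewrite mem_s inE => /predU1P[->|zr]; first by rewrite mh' mh eq_sym.
    have mzr := matching_on_in mm zr; have [] := m1 z zr.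
    by rewrite (moff _ mzr) (moff _ zr).
  rewrite inE mem_s inE !negb_or => /and3P[zh zh' zr].
  by rewrite mE' tpermD ?m2 // eq_sym.
apply/forall_inP => z; rewrite inE => /predU1P[->|]; first by rewrite mh.
rewrite mem_s inE => /predU1P[->|zr].
  by rewrite mh' (eqP eqL) /swap_pair; case: (L h).
by rewrite -(moff _ zr); move/forall_inP: cm; apply.
Qed.

End Matchings.
(** The recursion singles out the first letter, so the symmetry is not visible there. It comes from
    the count of matchings, which depends only on the set of positions. *)
Lemma wick_perm w w' : perm_eq w w' -> wick w = wick w'.
Proof.
rewrite perm_sym => eq_w; have /tuple_permP[t wE] : perm_eq w' (in_tuple w) by [].
have -> : w' = map (tnth (in_tuple w)) (map t (enum 'I_(size w))).
  by rewrite wE -map_comp; apply: eq_map.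
have {1}-> : w = map (tnth (in_tuple w)) (enum 'I_(size w)) by rewrite map_tnth_enum.
rewrite -!card_wick_set ?(map_inj_uniq (@perm_inj _ t)) ?enum_uniq //.
congr #|pred_of_set _|; apply: wick_set_perm => i; rewrite mem_enum inE.
by rewrite -(permKV t i) (mem_map (@perm_inj _ t)) mem_enum.
Qed.

(** The words M_(i,k) M_(k,k') ... in the expansion of the entry (i, j) of M^n. *)
Fixpoint paths n (i j : I) : seq (seq (I * I)) :=
  if n is n'.+1 then
    [seq (i, k) :: w | k <- index_enum I, w <- paths n' k j]
  else if i == j then [:: [::]] else [::].

Lemma big_pathsS n i j (G : seq (I * I) -> nat) :
  \sum_(w <- paths n.+1 i j) G w = \sum_k \sum_(w <- paths n k j) G ((i, k) :: w).
Proof. by rewrite /= big_allpairs_dep. Qed.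

Lemma big_paths0 i j (G : seq (I * I) -> nat) :
  \sum_(w <- paths 0 i j) G w = (i == j) * G [::].
Proof.
by rewrite /=; case: eqP => _; rewrite ?big_seq1 ?big_nil ?mul1n ?mul0n.
Qed.

Lemma sum_diag (F : I -> nat) i : \sum_j (i == j) * F j = F i.
Proof.
rewrite (bigD1 i) //= eqxx mul1n [X in _ + X]big1 ?addn0 // => k ne.
by rewrite eq_sym (negbTE ne).
Qed.

Lemma big_pathsD a b i j (G : seq (I * I) -> nat) :
  \sum_(w <- paths (a + b) i j) G w =
  \sum_k \sum_(w1 <- paths a i k) \sum_(w2 <- paths b k j) G (w1 ++ w2).
Proof.
elim: a i G => [|a IHa] i G.
  under [RHS]eq_bigr do rewrite big_paths0.
  by rewrite (sum_diag (fun k => \sum_(w2 <- paths b k j) G w2)).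
rewrite addSn big_pathsS; under [RHS]eq_bigr do rewrite big_pathsS.
by rewrite [RHS]exchange_big /=; apply: eq_bigr => k _; rewrite IHa.
Qed.

Lemma big_paths_split n i j q0 (y x : I) (G : seq (I * I) -> seq (I * I) -> nat) :
  \sum_(w <- paths n i j) \sum_(k < size w)
     (nth q0 w k == (y, x)) * G (take k w) (drop k.+1 w) =
  \sum_(l < n) \sum_(w1 <- paths l i y) \sum_(w2 <- paths (n.-1 - l) x j) G w1 w2.
Proof.
elim: n i G => [|n IHn] i G.
  by rewrite big_paths0 !big_ord0 muln0.
rewrite big_pathsS big_ord_recl big_paths0 subn0 /=.
under eq_bigr => k _ do under eq_bigr => w _ do rewrite big_ord_recl /= drop0.
under eq_bigr => k _ do rewrite big_split /=.
rewrite big_split /=; congr (_ + _).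
  rewrite (bigD1 x) //= [X in _ + X]big1 ?addn0 => [|k ne]; last first.
    by rewrite big1 // => w _; rewrite xpair_eqE (negbTE ne) andbF.
  by rewrite big_distrr /=; apply: eq_bigr => w _; rewrite xpair_eqE eqxx andbT.
under eq_bigr => k _ do rewrite (IHn k (fun w1 w2 => G ((i, k) :: w1) w2)).
rewrite exchange_big; apply: eq_bigr => l _; rewrite big_pathsS.
apply: eq_bigr => k _; apply: eq_bigr => w1 _; congr (\sum_(w2 <- paths _ _ _) _).
by have := ltn_ord l; rewrite /bump /=; lia.
Qed.

Definition traces a := [seq w | i <- index_enum I, w <- paths a i i].

Fixpoint words (s : seq nat) : seq (seq (I * I)) :=
  if s is a :: s' then [seq w ++ w' | w <- traces a, w' <- words s'] else [:: [::]].

Arguments words s : simpl never.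

Lemma big_traces a (G : seq (I * I) -> nat) :
  \sum_(w <- traces a) G w = \sum_i \sum_(w <- paths a i i) G w.
Proof. by rewrite big_allpairs_dep. Qed.

Lemma big_words a s (G : seq (I * I) -> nat) :
  \sum_(w <- words (a :: s)) G w =
  \sum_i \sum_(w <- paths a i i) \sum_(w' <- words s) G (w ++ w').
Proof. by rewrite /words -/words big_allpairs_dep big_traces. Qed.

(* The moment of \prod_(a <- s) tr M^a. *)
Definition wexp s := \sum_(w <- words s) wick w.

Lemma wexp0 s : wexp (0 :: s) = #|I| * wexp s.
Proof.
rewrite /wexp big_words; under eq_bigr do rewrite big_paths0 eqxx mul1n /=.
by rewrite sum_nat_const.
Qed.

(** Cyclicity of the trace: since [G] is symmetric, a trace that contains the letter (y, x) may be
    rotated so as to start just after it. All positions of the letter then give the same sum, whence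
    the factor [nth 0 s q]. *)
Lemma big_words_split s q0 (y x : I) (G : seq (I * I) -> nat) :
  (forall w w', perm_eq w w' -> G w = G w') ->
  \sum_(w <- words s) \sum_(k < size w) (nth q0 w k == (y, x)) * G (rem_at k w) =
  \sum_(q < size s) nth 0 s q * \sum_(w2 <- paths (nth 0 s q).-1 x y)
     \sum_(w <- words (rem_at q s)) G (w2 ++ w).
Proof.
elim: s G => [|b s IHs] G permG; first by rewrite /words big_seq1 !big_ord0.
rewrite big_words big_ord_recl /=.
under eq_bigr => i _ do under eq_bigr => w1 _ do under eq_bigr => w _ do
  rewrite (sum_rem_cat (fun p r => (p == (y, x)) * G r)).
under eq_bigr => i _ do under eq_bigr => w1 _ do rewrite big_split /=.
under eq_bigr => i _ do rewrite big_split /=.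
rewrite big_split /=; congr (_ + _).
  rewrite /rem_at /= drop0.
  under eq_bigr => i _ do under eq_bigr => w1 _ do rewrite exchange_big /=.
  under eq_bigr => i _ do under eq_bigr => w1 _ do under eq_bigr => k _ do
    rewrite -big_distrr /=.
  under eq_bigr => i _ do rewrite (big_paths_split b i i q0 y x
    (fun u1 u2 => \sum_(w <- words s) G ((u1 ++ u2) ++ w))).
  have mulE F : b * F = \sum_(l < b) F by rewrite sum_nat_const card_ord.
  rewrite exchange_big mulE /=; apply: eq_bigr => l _.
  have e : (b.-1 - l) + l = b.-1 by have := ltn_ord l; lia.
  rewrite -[in RHS]e big_pathsD; apply: eq_bigr => i _; rewrite exchange_big /=.
  apply: eq_bigr => u2 _; apply: eq_bigr => u1 _; apply: eq_bigr => w _.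
  by apply: permG; rewrite perm_cat2r perm_catC.
have permG1 w1 w w' : perm_eq w w' -> G (w1 ++ w) = G (w1 ++ w').
  by move=> eqw; apply: permG; rewrite perm_cat2l.
under eq_bigr => i _ do under eq_bigr => w1 _ do rewrite (IHs _ (permG1 w1)).
under eq_bigr => i _ do rewrite exchange_big /=.
rewrite exchange_big /=; apply: eq_bigr => q _.
under eq_bigr => i _ do rewrite -big_distrr /=.
rewrite -big_distrr /=; congr (_ * _).
under eq_bigr => i _ do rewrite exchange_big /=.
rewrite exchange_big /=; apply: eq_bigr => w2 _.
rewrite (big_words b (rem_at q s) (fun w => G (w2 ++ w))).
apply: eq_bigr => i _; apply: eq_bigr => w1 _; apply: eq_bigr => w _.
by apply: permG; rewrite perm_catCA.
Qed.

(** The first letter M_(i,j) is contracted with a letter (j, i). A partner in the same trace cuts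
    this trace in two; a partner in another trace joins the two traces. *)
Lemma wexp_loop a s :
  wexp (a.+1 :: s) =
  \sum_(l < a) wexp (nat_of_ord l :: (a.-1 - l) :: s)
  + \sum_(q < size s) nth 0 s q * wexp ((a + nth 0 s q).-1 :: rem_at q s).
Proof.
rewrite /wexp big_words; under eq_bigr do rewrite big_pathsS.
under eq_bigr => i _ do under eq_bigr => j _ do under eq_bigr => w _ do
  under eq_bigr => w' _ do rewrite /= wick_cons.
under eq_bigr => i _ do under eq_bigr => j _ do under eq_bigr => w _ do
  under eq_bigr => w' _ do
    rewrite (sum_rem_cat (fun p r => (p == (j, i)) * wick r)) addnC.
under eq_bigr => i _ do under eq_bigr => j _ do under eq_bigr => w _ do
  rewrite big_split /=.
under eq_bigr => i _ do under eq_bigr => j _ do rewrite big_split /=.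
under eq_bigr => i _ do rewrite big_split /=.
rewrite big_split /= addnC; congr (_ + _).
  under eq_bigr => i _ do under eq_bigr => j _ do under eq_bigr => w _ do
    rewrite exchange_big /=.
  under eq_bigr => i _ do under eq_bigr => j _ do under eq_bigr => w _ do
    under eq_bigr => k _ do rewrite -big_distrr /=.
  under eq_bigr => i _ do under eq_bigr => j _ do
    rewrite (big_paths_split a j i (i, j) j i
      (fun u1 u2 => \sum_(w' <- words s) wick ((u1 ++ u2) ++ w'))).
  rewrite exchange_big /=; under eq_bigr => j _ do rewrite exchange_big /=.
  rewrite exchange_big /=; apply: eq_bigr => l _.
  rewrite big_words; apply: eq_bigr => j _; rewrite exchange_big /=.
  apply: eq_bigr => u1 _; rewrite big_words; apply: eq_bigr => i _.
  by apply: eq_bigr => u2 _; apply: eq_bigr => w' _; rewrite catA.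
have permG w1 w w' : perm_eq w w' -> wick (w1 ++ w) = wick (w1 ++ w').
  by move=> eqw; apply: wick_perm; rewrite perm_cat2l.
under eq_bigr => i _ do under eq_bigr => j _ do under eq_bigr => w _ do
  rewrite (big_words_split _ _ _ _ (permG w)).
rewrite exchange_big /=.
under eq_bigr => j _ do under eq_bigr => i _ do rewrite exchange_big /=.
under eq_bigr => j _ do rewrite exchange_big /=.
rewrite exchange_big /=; apply: eq_bigr => q _.
under eq_bigr => j _ do under eq_bigr => i _ do rewrite -big_distrr /=.
under eq_bigr => j _ do rewrite -big_distrr /=.
rewrite -big_distrr /=; have [->|sq] := posnP (nth 0 s q); first by rewrite !mul0n.
congr (_ * _); have -> : (a + nth 0 s q).-1 = a + (nth 0 s q).-1 by lia.
rewrite big_words; apply: eq_bigr => j _; rewrite big_pathsD; apply: eq_bigr => i _.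
apply: eq_bigr => w1 _; apply: eq_bigr => w2 _; apply: eq_bigr => w _.
by rewrite catA.
Qed.

End Wick.

(** * Loop equations *)

Section LoopEquations.
Local Open Scope ring_scope.
Variables (R : comNzRingType) (N : nat) (t : R) (K r : nat).
Hypothesis t_nilp : t ^+ K.+1 = 0.
Local Notation v := r.+1.
Let u : R := v%:R * t.

(* The Schwinger-Dyson equations for F s = < \prod_(a <- s) tr M^a exp(t tr M^v) >. *)
Definition loop_solution (F : seq nat -> R) :=
  (forall s, F (0%N :: s) = N%:R * F s) /\
  (forall a s, F (a.+1 :: s) =
    \sum_(b < a) F (nat_of_ord b :: (a.-1 - b)%N :: s)
    + \sum_(k < size s) (nth 0%N s k)%:R * F ((a + nth 0%N s k).-1 :: rem_at k s)
    + u * F ((r + a)%N :: s)).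

(** All terms on the right of a loop equation are smaller, except the last, which carries a factor
    t. Vanishing therefore propagates from t^(K+1) F = 0 down to F = 0, one power of t at a time. *)
Lemma loop_solution_eq0 F s : loop_solution F -> F [::] = 0 -> F s = 0.
Proof.
case=> F0 FS Fnil.
suff H k : (k <= K.+1)%N -> forall s, t ^+ (K.+1 - k) * F s = 0.
  by have := H _ (leqnn _) s; rewrite subnn mul1r.
elim: k => [_ s'|k IHk ltk s']; first by rewrite subn0 t_nilp mul0r.
(* Cutting a trace lowers the sum of the exponents by 2 but adds one trace, so the measure is the
   sum plus the number of traces. *)
have [m] := ubnP (sumn s' + size s'); elim: m s' => // m IHm [|[|a] s'] /=.
- by rewrite Fnil mulr0.
- by move=> ltm; rewrite F0 mulrCA IHm ?mulr0 //; lia.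
move=> ltm; rewrite FS !mulrDr /u.
have -> : t ^+ (K.+1 - k.+1) * (v%:R * t * F ((r + a)%N :: s')) =
    v%:R * (t ^+ (K.+1 - k) * F ((r + a)%N :: s')).
  by rewrite [in RHS](_ : (K.+1 - k = (K.+1 - k.+1).+1)%N) ?exprS; [ring | lia].
rewrite IHk ?mulr0 ?addr0; last by lia.
rewrite !mulr_sumr !big1 ?addr0 // => i _.
  have ltk' := ltn_ord i.
  have := perm_sumn (perm_rem_at 0%N ltk'); have := size_rem_at ltk'.
  rewrite /= => e1 e2; rewrite mulrCA IHm ?mulr0 //=; lia.
by rewrite IHm //=; have := ltn_ord i; lia.
Qed.

(** The equations are linear, so the difference of the two sides is a solution, and it vanishes at
    [[::]]. *)
Lemma loop_solution_prop F G s :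
  loop_solution F -> loop_solution G -> F [::] * G s = G [::] * F s.
Proof.
move=> [F0 FS] [G0 GS]; apply/eqP; rewrite -subr_eq0; apply/eqP.
apply: (@loop_solution_eq0 (fun s => F [::] * G s - G [::] * F s)); last first.
  by rewrite mulrC subrr.
split=> [s'|a s']; first by rewrite F0 G0; ring.
have D3 (a1 b1 c1 a2 b2 c2 : R) :
  (a1 + b1 + c1) - (a2 + b2 + c2) = (a1 - a2) + (b1 - b2) + (c1 - c2) by ring.
rewrite FS GS !mulrDr D3; congr (_ + _ + _).
- by rewrite !mulr_sumr -sumrB.
- by rewrite !mulr_sumr -sumrB; apply: eq_bigr => i _; ring.
- by ring.
Qed.

(* K! / j!, so that [wick_corr] is K! times the exponential series. *)
Definition tcoef j := (K ^_ (K - j))%N.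

Lemma tcoefS j : (j < K)%N -> (j.+1 * tcoef j.+1 = tcoef j)%N.
Proof.
move=> ltj; rewrite /tcoef -[(K - j)%N]prednK ?subn_gt0 // -subnS.
by rewrite ffactnSr mulnC; congr (_ * _)%N; lia.
Qed.

Definition wick_corr (s : seq nat) : R := \sum_(j < K.+1)
  (tcoef j)%:R * t ^+ j * (wexp 'I_N (s ++ nseq j v))%:R.

(** A partner of the contracted letter inside one of the j vertices contributes j v equal terms. The
    factor j lowers the index of the exponential series, and v t is [u]; the term of [u] beyond the
    truncation carries t^(K+1) = 0. *)
Lemma wick_corr_loop : loop_solution wick_corr.
Proof.
split=> [s|a s]; rewrite /wick_corr.
  rewrite mulr_sumr; apply: eq_bigr => j _.
  by rewrite cat_cons wexp0 card_ord natrM; ring.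
have expand j : wexp 'I_N ((a.+1 :: s) ++ nseq j v) =
    (\sum_(l < a) wexp 'I_N ((nat_of_ord l :: (a.-1 - l)%N :: s) ++ nseq j v)
    + \sum_(q < size s) nth 0 s q *
        wexp 'I_N (((a + nth 0 s q).-1 :: rem_at q s) ++ nseq j v)
    + j * (v * wexp 'I_N (((r + a)%N :: s) ++ nseq j.-1 v)))%N.
  rewrite cat_cons wexp_loop -addnA; congr (_ + _)%N.
  rewrite (sum_rem_cat (fun b w => b * wexp 'I_N ((a + b).-1 :: w))%N).
  congr (_ + _)%N; have mulE F : (j * F = \sum_(k < j) F)%N by rewrite sum_nat_const card_ord.
  rewrite size_nseq mulE.
  apply: eq_bigr => k _; have ltk := ltn_ord k; rewrite nth_nseq ltk addnS addnC.
  congr (_ * wexp _ (_ :: (_ ++ _)))%N.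
  rewrite /rem_at take_nseq ?(ltnW ltk) // drop_nseq -nseqD.
  by congr nseq; lia.
under eq_bigr => j _ do rewrite expand !natrD !mulrDr.
rewrite !big_split /=; congr (_ + _ + _).
- under eq_bigr do rewrite natr_sum mulr_sumr.
  by rewrite exchange_big.
- under eq_bigr do rewrite natr_sum mulr_sumr.
  rewrite exchange_big; apply: eq_bigr => q _; rewrite mulr_sumr.
  by apply: eq_bigr => j _; rewrite natrM; ring.
rewrite big_ord_recl mul0n mulr0 add0r big_ord_recr mulrDr /=.
have -> : u * ((tcoef K)%:R * t ^+ K * (wexp 'I_N ((r + a)%N :: s ++ nseq K v))%:R) = 0.
  rewrite /u; transitivity (t ^+ K.+1 * v%:R * (tcoef K)%:R *
    (wexp 'I_N ((r + a)%N :: s ++ nseq K v))%:R); first by rewrite exprS; ring.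
  by rewrite t_nilp !mul0r.
rewrite addr0 mulr_sumr; apply: eq_bigr => j _.
rewrite /bump /= add1n -(tcoefS (ltn_ord j)) !natrM exprS /u; ring.
Qed.

End LoopEquations.

(** * Cancellation modulo a nilpotent element *)

Section Regular.
Local Open Scope ring_scope.
Variables (R : comNzRingType) (rho : {rmorphism rat -> R}) (t : R) (K : nat).
Hypothesis t_nilp : t ^+ K.+1 = 0.

Definition unitlike (y : R) := exists c z, c != 0 /\ y = rho c + t * z.

Lemma unitlikeM y1 y2 : unitlike y1 -> unitlike y2 -> unitlike (y1 * y2).
Proof.
move=> [c1 [z1 [nz1 ->]]] [c2 [z2 [nz2 ->]]].
exists (c1 * c2), (z1 * rho c2 + z2 * rho c1 + t * z1 * z2).
by rewrite mulf_neq0 // rmorphM; split=> //; ring.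
Qed.

Lemma unitlike_prod (I : Type) (s : seq I) F :
  (forall i, unitlike (F i)) -> unitlike (\prod_(i <- s) F i).
Proof.
move=> uF; elim/big_ind: _ => // [|y z]; last exact: unitlikeM.
by exists 1, 0; rewrite oner_eq0 rmorph1 mulr0 addr0.
Qed.

(** Dividing y w = 0 by the rational part of y gives w = t z' w; after K + 1 iterations the factor
    t^(K+1) = 0 appears. *)
Lemma unitlike_reg y w : unitlike y -> y * w = 0 -> w = 0.
Proof.
move=> [c [z [nz ->]]] yw.
have e : w = t * (- z * rho c^-1) * w.
  have := congr1 (fun q => rho c^-1 * q) yw.
  rewrite mulr0 mulrDl mulrDr mulrA -rmorphM mulVf // rmorph1 mul1r => /eqP.
  by rewrite addr_eq0 => /eqP {1}->; ring.
have iter k : w = (t * (- z * rho c^-1)) ^+ k * w.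
  by elim: k => [|k IHk]; rewrite ?mul1r // exprSr -mulrA -e.
by rewrite (iter K.+1) exprMn t_nilp !mul0r.
Qed.

End Regular.

Section FreudSolution.
Local Open Scope ring_scope.
Variables (R : comNzRingType) (rho : {rmorphism rat -> R}) (t : R) (K : nat).
Hypothesis t_nilp : t ^+ K.+1 = 0.
Variables (r : nat) (x : nat -> R).
Hypothesis odd_r : odd r.
Hypothesis freud : forall n,
  x n.+1 - (r.+1%:R * t) * jacobi_pow x r n n.+1 = n.+1%:R.

(** Proportionality and [vdm_corr_11] give the identity multiplied by the normalization of the
    Vandermonde side. This is N! times a product of elements x_n with constant terms n > 0, so it
    cancels. *)
Theorem two_leg_ratio N' : wick_corr N'.+1 t K r [:: 1; 1]%N = x N'.+1 * wick_corr N'.+1 t K r [::].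
Proof.
set N := N'.+1; pose Th := vdm_corr N (fun i => jacobi_pow x i 0 0).
have ThL : loop_solution N t r Th.
  split=> [s|a s]; first exact: vdm_corr0.
  exact: (@vdm_corr_loop R N (fun i => jacobi_pow x i 0 0) _ r (mom_stein odd_r freud)).
have := loop_solution_prop t_nilp [:: 1; 1]%N ThL (wick_corr_loop N r t_nilp).
rewrite /Th vdm_corr_11 => /eqP; rewrite -subr_eq0.
set T0 := vdm_corr _ _ _ => e; apply/eqP; rewrite -subr_eq0; apply/eqP.
apply: (@unitlike_reg R rho t K t_nilp T0); last by rewrite -[RHS](eqP e); ring.
have ulx n : unitlike rho t (x n.+1).
  exists n.+1%:R, (r.+1%:R * jacobi_pow x r n n.+1); rewrite pnatr_eq0 rmorph_nat.
  by split=> //; rewrite -freud; ring.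
rewrite /T0 vdm_corr_nil; apply: unitlikeM.
  exists (N`!%:R), 0; rewrite pnatr_eq0 -lt0n fact_gt0 rmorph_nat mulr0 addr0.
  by [].
by apply: unitlike_prod => i; apply: unitlike_prod => k; apply: ulx.
Qed.

End FreudSolution.

(** * Face colourings *)

Lemma card_invariant_labels (H I : finType) (p : {perm H}) (i0 : I) :
  #|[set f : {ffun H -> I} | [forall h, f (p h) == f h]]| = #|I| ^ #|porbits p|.
Proof.
(* Functions on the orbits are represented as functions on all subsets of [H] with the value [i0]
   off the orbits. *)
rewrite -(card_pffun_on i0).
pose c h := porbit p h.
pose up (g : {ffun {set H} -> I}) : {ffun H -> I} := [ffun h => g (c h)].
rewrite -(@card_in_imset _ _ up (mem (pffun_on i0 (mem (porbits p)) predT))).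
  apply: eq_card => f; rewrite !inE; apply/forallP/imsetP => [fP|[g _ ->] h].
    have fc h h' : h' \in c h -> f h' = f h.
      case/porbitP => i ->; elim: i => [|i IHi]; first by rewrite expg0 perm1.
      by rewrite expgSr permM (eqP (fP _)).
    exists [ffun B => if B \in porbits p then
                        if [pick h in B] is Some h then f h else i0 else i0].
      rewrite inE; apply/pffun_onP; split=> [|B Bp]; last by rewrite inE.
      by apply/supportP => B Bp; rewrite ffunE (negbTE Bp).
    apply/ffunP => h; rewrite !ffunE imset_f //.
    case: pickP => [h' h'c|/(_ h)]; first by rewrite (fc _ _ h'c).
    by rewrite porbit_id.
  by rewrite !ffunE /c -(porbit_perm p 1 h) expg1.
move=> g1 g2 /pffun_onP[/supportP s1 _] /pffun_onP[/supportP s2 _] eq_g.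
apply/ffunP => B; have [/imsetP[h _ ->]|nB] := boolP (B \in porbits p).
  by have /ffunP/(_ h) := eq_g; rewrite !ffunE.
by rewrite s1 // s2.
Qed.

Section Labels.
Variable I : finType.

Fixpoint chain (i : I) (w : seq I) (j : I) : seq (I * I) :=
  if w is k :: w' then (i, k) :: chain k w' j else [:: (i, j)].

(** The word of a trace read off from the labels around a vertex: (i_1, i_2), (i_2, i_3), ..., (i_n,
    i_1). *)
Definition cyc (w : seq I) := if w is i :: w' then chain i w' i else [::].

Fixpoint cycs (sh : seq nat) (w : seq I) :=
  if sh is a :: sh' then cyc (take a w) ++ cycs sh' (drop a w) else [::].

Fixpoint lists n : seq (seq I) :=
  if n is n'.+1 then [seq i :: w | i <- index_enum I, w <- lists n'] else [:: [::]].

Lemma big_listsS n (G : seq I -> nat) :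
  \sum_(w <- lists n.+1) G w = \sum_i \sum_(w <- lists n) G (i :: w).
Proof. by rewrite /= big_allpairs_dep. Qed.

Lemma big_listsD a b (G : seq I -> seq I -> nat) :
  \sum_(w <- lists (a + b)) G (take a w) (drop a w) =
  \sum_(w1 <- lists a) \sum_(w2 <- lists b) G w1 w2.
Proof.
elim: a G => [|a IHa] G.
  by rewrite big_seq1; apply: eq_bigr => w _; rewrite take0 drop0.
rewrite addSn !big_listsS; apply: eq_bigr => i _.
exact: (IHa (fun w1 w2 => G (i :: w1) w2)).
Qed.

Lemma big_lists_chain a i j (G : seq (I * I) -> nat) :
  \sum_(w <- lists a) G (chain i w j) = \sum_(w <- paths a.+1 i j) G w.
Proof.
elim: a i G => [|a IHa] i G.
  rewrite big_seq1 big_pathsS (eq_bigr (fun k => (j == k) * G [:: (i, k)])) ?sum_diag //.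
  by move=> k _; rewrite big_paths0 eq_sym.
rewrite big_listsS big_pathsS; apply: eq_bigr => k _.
exact: (IHa k (fun w => G ((i, k) :: w))).
Qed.

(** Positivity matters: an empty trace contributes the factor [#|I|], an empty list of labels only
    the factor 1. *)
Lemma big_lists_cycs sh (G : seq (I * I) -> nat) : all (leq 1) sh ->
  \sum_(w <- lists (sumn sh)) G (cycs sh w) = \sum_(w <- words I sh) G w.
Proof.
elim: sh G => [|[//|a] sh IHsh] G pos_sh; first by rewrite /words !big_seq1.
apply: etrans (big_listsD a.+1 (sumn sh) (fun w1 w2 => G (cyc w1 ++ cycs sh w2))) _.
rewrite big_words big_listsS; apply: eq_bigr => i _.
rewrite -(big_lists_chain a i i (fun w => \sum_(w' <- words I sh) G (w ++ w'))).
by apply: eq_bigr => w _; rewrite -(IHsh (fun w' => G (_ ++ w'))).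
Qed.

Variables (H : finType) (i0 : I).

Definition labels_on (s : seq H) :=
  [set f : {ffun H -> I} | [forall h, (h \in s) || (f h == i0)]].

Lemma labels_onP (s : seq H) (f : {ffun H -> I}) :
  reflect (forall h, h \notin s -> f h = i0) (f \in labels_on s).
Proof.
rewrite inE; apply: (iffP forallP) => fP h; last first.
  by case: (boolP (h \in s)) => //= /fP ->.
by move=> hs; have := fP h; rewrite (negbTE hs) => /eqP.
Qed.

Definition upd (f : {ffun H -> I}) (h : H) (i : I) : {ffun H -> I} :=
  [ffun z => if z == h then i else f z].

Lemma big_labels_on s (G : seq I -> nat) : uniq s ->
  \sum_(f in labels_on s) G (map f s) = \sum_(w <- lists (size s)) G w.
Proof.
elim: s G => [|h s IHs] G => [_|/andP[hs us]].
  rewrite [lists _]/= big_seq1 (eq_bigl (pred1 [ffun=> i0])) ?big_pred1_eq // => f.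
  apply/labels_onP/eqP => [fP|-> h _]; last by rewrite ffunE.
  by apply/ffunP => h; rewrite fP ?ffunE.
rewrite big_listsS.
rewrite (partition_big (fun f : {ffun H -> I} => f h) xpredT) //=.
apply: eq_bigr => i _; rewrite -(IHs (fun w => G (i :: w))) //.
rewrite (reindex_onto (fun f => upd f h i) (fun f => upd f h i0)) /=; last first.
  move=> f /andP[_ /eqP fh]; apply/ffunP => z; rewrite !ffunE.
  by case: eqP => // ->.
have upd_s (f : {ffun H -> I}) k : map (upd f h k) s = map f s.
  by apply/eq_in_map => z zs; rewrite ffunE; case: eqP => // e; rewrite -e zs in hs.
apply: eq_big => [f|f _]; last by rewrite upd_s ffunE eqxx.
rewrite !ffunE eqxx eqxx andbT; apply/andP/labels_onP => [[/labels_onP fP /eqP eqf] z zs|fP].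
  have /ffunP/(_ z) := eqf; rewrite !ffunE; case: eqP => [//|/eqP ne e].
  by have := fP z; rewrite ffunE (negbTE ne) inE (negbTE ne) (negbTE zs); apply.
split; first by apply/labels_onP => z; rewrite inE ffunE; case: eqP => // _ /fP.
apply/eqP/ffunP => z; rewrite !ffunE; case: eqP => [->|//].
by rewrite fP.
Qed.

Lemma map_chain (sigma : H -> H) (f : H -> I) h l z :
  path (frel sigma) h (rcons l z) ->
  chain (f h) (map f l) (f z) = [seq (f y, f (sigma y)) | y <- h :: l].
Proof.
elim: l h => [|y l IHl] h /=; first by rewrite andbT => /eqP ->.
by case/andP => /eqP -> yl; rewrite IHl.
Qed.

Lemma map_cycs (sigma : H -> H) (f : H -> I) (ls : seq (seq H)) :
  all (fcycle sigma) ls ->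
  cycs (map size ls) (map f (flatten ls)) = [seq (f y, f (sigma y)) | y <- flatten ls].
Proof.
elim: ls => //= l ls IHls /andP[cl cls].
rewrite map_cat -(size_map f) take_size_cat ?drop_size_cat // map_cat IHls //.
by congr (_ ++ _); case: l cl => //= h l cl; rewrite (map_chain f cl).
Qed.

(** The half-edge y carries the matrix entry indexed by the labels of y and of its successor
    [sigma y]; summation over the labels around a vertex produces a trace. *)
Lemma sum_labels_wick (sigma : H -> H) (ls : seq (seq H)) :
  all (fcycle sigma) ls -> uniq (flatten ls) -> all (leq 1) (map size ls) ->
  \sum_(f in labels_on (flatten ls)) wick [seq (f y, f (sigma y)) | y <- flatten ls]
    = wexp I (map size ls).
Proof.
move=> cl ul pl; rewrite /wexp -big_lists_cycs // -size_flatten.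
rewrite -(big_labels_on (fun w => wick (cycs (map size ls) w)) ul).
by apply: eq_bigr => f _; rewrite (map_cycs f cl).
Qed.

End Labels.

(** * Splitting off a connected component *)

Section Components.
Variables (H V : finType) (vx : H -> V) (sigma : {perm H}).
Hypothesis vx_sigma : forall h, vx (sigma h) = vx h.
Variables (I : finType) (i0 : I).
Implicit Types (B : {set V}) (m : {perm H}) (f : {ffun H -> I}).

Definition halves B : seq H := enum [set h | vx h \in B].

Lemma mem_halves B h : (h \in halves B) = (vx h \in B).
Proof. by rewrite mem_enum inE. Qed.

(* Matchings of the half-edges of the vertices in B, with a labelling that is constant
   along faces: [sigma \o m] preserves f. *)
Definition lmatch B : {set {perm H} * {ffun H -> I}} :=
  [set mf : {perm H} * {ffun H -> I} | matching_on (halves B) mf.1 &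
     [forall h, if vx h \in B then mf.2 (sigma h) == mf.2 (mf.1 h) else mf.2 h == i0]].

Lemma lmatchP B m f :
  reflect [/\ forall h, vx h \in B -> [/\ m h != h, m (m h) = h & vx (m h) \in B],
              forall h, vx h \notin B -> m h = h,
              forall h, vx h \in B -> f (sigma h) = f (m h) &
              forall h, vx h \notin B -> f h = i0] ((m, f) \in lmatch B).
Proof.
rewrite inE /=; apply: (iffP andP) => [[mm /forallP fP]|[m1 m2 f1 f2]].
  have /matching_onP[m1 m2] := mm; split=> h hB.
  - have [] := m1 h; rewrite ?mem_halves // => -> ->; split=> //.
    by rewrite -mem_halves (matching_on_in mm) // mem_halves.
  - by rewrite m2 // mem_halves.
  - by have := fP h; rewrite hB => /eqP.
  - by have := fP h; rewrite (negbTE hB) => /eqP.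
split; first apply/matching_onP; first (split=> h; rewrite mem_halves => hB).
- by have [] := m1 h hB.
- exact: m2.
by apply/forallP => h; case: ifPn => hB; apply/eqP; [apply: f1 | apply: f2].
Qed.

(** For fixed f, compatibility asks that f (m h) = f (sigma h) and f (sigma (m h)) = f h. As m is an
    involution, the second condition is the first one at m h. *)
Lemma card_lmatch B (s : seq H) : uniq s -> (forall h, (h \in s) = (vx h \in B)) ->
  #|lmatch B| = \sum_(f in labels_on i0 s) wick [seq (f y, f (sigma y)) | y <- s].
Proof.
move=> us sB; rewrite -sum1_card (partition_big (fun mf => mf.2) (mem (labels_on i0 s))) /=.
  apply: eq_bigr => f /labels_onP fP; rewrite -(card_wick_set (fun y => (f y, f (sigma y))) us).
  rewrite -sum1_card (reindex_onto (fun m => (m, f)) (fun mf => mf.1)) /=; last first.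
    by case=> m g /andP[_ /= /eqP ->].
  apply: eq_bigl => m; rewrite !eqxx !andbT; apply/idP/idP.
    case/lmatchP => m1 m2 f1 f2; rewrite inE; apply/andP; split.
      apply/matching_onP; split=> h; rewrite sB => hB; last exact: m2.
      by have [] := m1 h hB.
    apply/forall_inP => h; rewrite sB => hB; have [_ mm mB] := m1 h hB.
    by rewrite /swap_pair /= (f1 _ hB) (f1 _ mB) mm.
  rewrite inE => /andP[mm cm]; have /matching_onP[m1 m2] := mm; apply/lmatchP; split=> h.
  - rewrite -sB => hs; have [-> ->] := m1 h hs; split=> //.
    by rewrite -sB (matching_on_in mm).
  - by rewrite -sB; apply: m2.
  - by rewrite -sB => hs; have /forall_inP/(_ h hs)/eqP[-> _] := cm.
  - by rewrite -sB => hs; apply: fP.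
by case=> m f /lmatchP[_ _ _ f2]; apply/labels_onP => h; rewrite sB; apply: f2.
Qed.

Definition adj m : rel V := fun u v => [exists h, (vx h == u) && (vx (m h) == v)].

Definition component l m : {set V} := [set u | connect (adj m) l u].

Definition lmatchc l B := [set mf in lmatch B | component l mf.1 == B].

Lemma in_lmatchc l B mf : (mf \in lmatchc l B) = (mf \in lmatch B) && (component l mf.1 == B).
Proof. by rewrite /lmatchc in_set. Qed.

Lemma adjI m h : adj m (vx h) (vx (m h)).
Proof. by apply/existsP; exists h; rewrite !eqxx. Qed.

Lemma connect_stable m (P : pred V) u v :
  (forall h, P (vx h) -> P (vx (m h))) -> connect (adj m) u v -> P u -> P v.
Proof.
move=> stP /connectP[p]; elim: p u => [|w p IHp] u /=; first by move=> _ ->.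
case/andP=> /existsP[h /andP[/eqP <- /eqP <-]] pth ev Pu.
by apply: IHp pth ev _; apply: stP.
Qed.

Lemma component_sub l m B :
  l \in B -> (forall h, vx h \in B -> vx (m h) \in B) -> component l m \subset B.
Proof.
move=> lB st; apply/subsetP => u; rewrite inE => lu.
exact: (connect_stable (P := mem B) st lu lB).
Qed.

Definition glue B (x : ({perm H} * {ffun H -> I}) * ({perm H} * {ffun H -> I})) :=
  ((x.1.1 * x.2.1)%g, [ffun h => if vx h \in B then x.1.2 h else x.2.2 h]).

Lemma glue_perm B B' m1 f1 m2 f2 : B' \subset B ->
  (m1, f1) \in lmatch B' -> (m2, f2) \in lmatch (B :\: B') ->
  forall h, (m1 * m2)%g h = if vx h \in B' then m1 h else m2 h.
Proof.
move=> sub /lmatchP[a1 a2 _ _] /lmatchP[b1 b2 _ _] h; rewrite permM.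
case: ifPn => hB; last by rewrite a2.
by have [_ _ mB] := a1 h hB; rewrite b2 // inE mB.
Qed.

Lemma glue_lmatch B B' m1 f1 m2 f2 : B' \subset B ->
  (m1, f1) \in lmatch B' -> (m2, f2) \in lmatch (B :\: B') ->
  glue B' ((m1, f1), (m2, f2)) \in lmatch B.
Proof.
move=> sub in1 in2; have gE := glue_perm sub in1 in2.
move: in1 in2 => /lmatchP[a1 a2 a3 a4] /lmatchP[b1 b2 b3 b4].
apply/lmatchP; split=> h hB; rewrite /= ?ffunE ?vx_sigma;
  have [hB'|hB'] := boolP (vx h \in B'); rewrite ?gE ?hB' ?(negbTE hB') ?gE.
- have [ne mm mB] := a1 h hB'; rewrite mB; split=> //.
  exact: (subsetP sub).
- have hD : vx h \in B :\: B' by rewrite inE hB'.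
  have [ne mm] := b1 h hD; rewrite inE => /andP[mB mB0].
  by rewrite (negbTE mB).
- by move: hB; rewrite (subsetP sub _ hB').
- by rewrite b2 // inE (negbTE hB) andbF.
- by have [_ _ mB] := a1 h hB'; rewrite mB a3.
- have hD : vx h \in B :\: B' by rewrite inE hB'.
  by have [_ _] := b1 h hD; rewrite inE => /andP[/negbTE -> _]; rewrite b3.
- by move: hB; rewrite (subsetP sub _ hB').
- by rewrite b4 // inE (negbTE hB) andbF.
Qed.

(** The component B' of l is closed under m, and [sigma] preserves vertices, so the matching and the
    labelling both restrict to B' and to its complement; [glue] inverts the restriction. Only the
    part over B' has to be connected. *)
Lemma card_lmatch_split l B : l \in B ->
  #|lmatch B| =
  \sum_(B' : {set V} | (B' \subset B) && (l \in B')) #|lmatchc l B'| * #|lmatch (B :\: B')|.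
Proof.
move=> lB; rewrite -sum1_card.
rewrite (partition_big (fun mf => component l mf.1)
  (fun B' : {set V} => (B' \subset B) && (l \in B'))) /=; last first.
  case=> m f /lmatchP[m1 _ _ _]; rewrite inE connect0 andbT; apply: component_sub => // h hB.
  by have [] := m1 h hB.
apply: eq_bigr => B' /andP[sub lB']; rewrite -cardsX sum1dep_card.
rewrite -(@card_in_imset _ _ (glue B') (setX (lmatchc l B') (lmatch (B :\: B')))); last first.
  move=> [[m1 f1] [m2 f2]] [[m1' f1'] [m2' f2']].
  rewrite !in_setX !in_lmatchc => /andP[/andP[in1 _] in2] /andP[/andP[in1' _] in2'].
  have gE := glue_perm sub in1 in2; have gE' := glue_perm sub in1' in2'.
  case=> em ef; move/ffunP: ef => ef; move: in1 in2 in1' in2'.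
  move=> /lmatchP[a1 a2 a3 a4] /lmatchP[b1 b2 b3 b4].
  move=> /lmatchP[a1' a2' a3' a4'] /lmatchP[b1' b2' b3' b4'].
  have em1 : m1 = m1'.
    apply/permP => h; have [hB|hB] := boolP (vx h \in B'); last by rewrite a2 ?a2'.
    by have := gE h; rewrite em gE' hB.
  have ef1 : f1 = f1'.
    apply/ffunP => h; have [hB|hB] := boolP (vx h \in B'); last by rewrite a4 ?a4'.
    by have := ef h; rewrite !ffunE hB.
  rewrite -em1 -ef1; congr (_, (_, _)).
    apply/permP => h; have [hB|hB] := boolP (vx h \in B').
      by rewrite b2 ?b2' // inE hB.
    by have := gE h; rewrite em gE' (negbTE hB).
  apply/ffunP => h; have [hB|hB] := boolP (vx h \in B').
    by rewrite b4 ?b4' // inE hB.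
  by have := ef h; rewrite !ffunE (negbTE hB).
congr #|pred_of_set _|; apply/setP => -[m f]; rewrite inE.
apply/andP/imsetP => [[mf /= /eqP cB]|[[[m1 f1] [m2 f2]]]]; last first.
  rewrite in_setX in_lmatchc => /andP[/andP[in1 /= /eqP c1] in2] emf.
  split; first by rewrite emf; apply: glue_lmatch.
  have -> : m = (m1 * m2)%g by case: emf.
  have gE := glue_perm sub in1 in2; rewrite /= eqEsubset; apply/andP; split.
    apply: component_sub => // h hB; rewrite gE hB.
    by have /lmatchP[/(_ h hB)[]] := in1.
  apply/subsetP => u; rewrite -c1 !inE; apply: connect_sub => v w.
  case/existsP=> h /andP[/eqP <- /eqP <-].
  have [hB|hB] := boolP (vx h \in B').
    by apply: connect1; have := adjI (m1 * m2)%g h; rewrite gE hB.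
  by have /lmatchP[_ /(_ h hB) -> _ _] := in1; apply: connect0.
have /lmatchP[m1 m2 f1 f2] := mf.
have st h : (vx (m h) \in B') = (vx h \in B').
  have stB h' : vx h' \in B' -> vx (m h') \in B'.
    by rewrite -cB !inE => /connect_trans; apply; apply: connect1; apply: adjI.
  apply/idP/idP => [hB|]; last exact: stB.
  have [hB0|hB0] := boolP (vx h \in B); last by rewrite -(m2 h hB0).
  by have [_ e _] := m1 h hB0; rewrite -e; apply: stB.
pose r1 h := if vx h \in B' then m h else h.
pose r2 h := if vx h \in B' then h else m h.
have inj1 : injective r1.
  move=> h h'; rewrite /r1; case: ifPn => hB; case: ifPn => hB' // e.
  - exact: perm_inj e.
  - by move: hB'; rewrite -e st hB.
  - by move: hB; rewrite e st hB'.
have inj2 : injective r2.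
  move=> h h'; rewrite /r2; case: ifPn => hB; case: ifPn => hB' // e.
  - by move: hB'; rewrite -(st h') -e hB.
  - by move: hB; rewrite -(st h) e hB'.
  - exact: perm_inj e.
pose g1 := [ffun h => if vx h \in B' then f h else i0].
pose g2 := [ffun h => if vx h \in B' then i0 else f h].
have in1 : (perm inj1, g1) \in lmatch B'.
  apply/lmatchP; split=> h hB.
  - rewrite !permE /r1 hB /= st hB; split=> //;
      by have [] := m1 h (subsetP sub _ hB).
  - by rewrite permE /r1 (negbTE hB).
  - rewrite !ffunE permE /r1 hB vx_sigma hB st hB.
    exact: f1 (subsetP sub _ hB).
  - by rewrite ffunE (negbTE hB).
have in2 : (perm inj2, g2) \in lmatch (B :\: B').
  apply/lmatchP; split=> h; rewrite inE.
  - move=> /andP[/negbTE hB hB0]; rewrite !permE /r2 hB /= st hB inE st hB.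
    by have [] := m1 h hB0.
  - by rewrite negb_and negbK permE /r2; case: ifP => //= _ /m2.
  - move=> /andP[/negbTE hB hB0]; rewrite !ffunE permE /r2 hB vx_sigma hB st hB.
    exact: f1.
  - by rewrite negb_and negbK ffunE; case: ifP => //= _ /f2.
have e12 : (perm inj1 * perm inj2)%g = m.
  apply/permP => h; rewrite (glue_perm sub in1 in2) !permE /r1 /r2.
  by case: (vx h \in B').
exists ((perm inj1, g1), (perm inj2, g2)); last first.
  rewrite /glue /= e12; congr (_, _); apply/ffunP => h; rewrite !ffunE.
  by case: (vx h \in B').
rewrite in_setX in2 andbT in_lmatchc in1 /= eqEsubset; apply/andP; split.
  apply: component_sub => // h hB; rewrite permE /r1 hB st hB //.
apply/subsetP => u; rewrite -{1}cB !inE => /connectP[p pth ->].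
(* A path of m that starts at l never leaves B', hence it is also a path of the restriction. *)
elim/last_ind: p pth => [|p w IHp]; first by rewrite connect0.
rewrite rcons_path last_rcons => /andP[pth].
have lw : last l p \in B' by rewrite -cB inE; apply/connectP; exists p.
case/existsP=> h /andP[/eqP hl /eqP <-]; apply: connect_trans (IHp pth) _.
apply: connect1; apply/existsP; exists h; rewrite hl eqxx permE /r1.
by rewrite -hl in lw; rewrite lw eqxx.
Qed.

End Components.

(** * Connected two-legged graphs *)

Lemma wick_odd (I : finType) (w : seq (I * I)) : odd (size w) -> wick w = 0.
Proof.
have [n] := ubnP (size w); elim: n w => // n IHn [//|p w] ltn ow.
rewrite wick_cons big1 // => k _; have ltk : k < size w := ltn_ord k.
rewrite /= in ltn ow.
by rewrite IHn ?muln0 // size_rem_at //; lia.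
Qed.

Lemma size_paths (I : finType) n (i j : I) w : w \in paths n i j -> size w = n.
Proof.
elim: n i w => [|n IHn] i w /=; first by case: eqP => // _; rewrite inE => /eqP ->.
by case/allpairsPdep => k [w' [_ w'P ->]] /=; rewrite (IHn _ _ w'P).
Qed.

Lemma size_words (I : finType) s w : w \in words I s -> size w = sumn s.
Proof.
elim: s w => [|a s IHs] w; first by rewrite /words inE => /eqP ->.
case/allpairsPdep => w1 [w2 [/allpairsPdep[i [w' [_ w'P ->]]] w2P ->]].
by rewrite size_cat (size_paths w'P) (IHs _ w2P).
Qed.

Lemma wexp_odd (I : finType) s : odd (sumn s) -> wexp I s = 0.
Proof.
by move=> os; rewrite /wexp big_seq big1 // => w /size_words sw; rewrite wick_odd ?sw.
Qed.

Lemma cycle_enum_ord n : path.cycle (fun a b : 'I_n => ordS a == b) (enum 'I_n).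
Proof.
case: n => [|n]; first by case: (enum _) => // -[].
have -> : enum 'I_n.+1 = [seq inord k | k <- iota 0 n.+1].
  rewrite -val_enum_ord -map_comp -[LHS]map_id; apply: eq_map => k /=.
  by rewrite inord_val.
have -> : path.cycle (fun a b : 'I_n.+1 => ordS a == b) [seq inord k | k <- iota 0 n.+1] =
    path (fun a b : 'I_n.+1 => ordS a == b) (inord 0)
      (rcons [seq inord k | k <- iota 1 n] (inord 0)) by [].
apply/(pathP ord0) => k; rewrite size_rcons size_map size_iota => ltk.
apply/eqP/val_inj; rewrite -rcons_cons -[_ :: _]/[seq inord k | k <- iota 0 n.+1].
rewrite !nth_rcons !size_map !size_iota ltk.
rewrite (nth_map 0) ?size_iota // nth_iota // add0n /= inordK //.
case: ltnP => [ltkn|lenk].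
  by rewrite (nth_map 0) ?size_iota // nth_iota // inordK ?modn_small //; lia.
have -> : k = n by lia.
by rewrite eqxx inordK // modnn.
Qed.

Section Vertices.
Variables (nu j N' : nat).
Hypothesis nu_gt0 : 0 < nu.
Local Notation I := 'I_N'.+1.
Local Notation H := (half_edge nu j).
Local Notation V := (vertex j).
Let vx : H -> V := @vertex_of nu j.
Let sigma : {perm H} := rotation nu j.

Lemma rotationE h : rotation nu j h = rotate h.
Proof. by rewrite permE. Qed.

Lemma vertex_of_rotation h : vx (sigma h) = vx h.
Proof. by rewrite rotationE; case: h => [[v k]|l]. Qed.

Definition hlist (v : V) : seq H :=
  match v with
  | inl i => [seq inl (i, k) | k <- enum 'I_(2 * nu)]
  | inr l => [:: inr l]
  end.

Lemma mem_hlist v h : (h \in hlist v) = (vx h == v).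
Proof.
case: v => [i|l]; case: h => [[i' k]|l'] //=.
- apply/mapP/eqP => [[k' _ [-> _]]|[->]] //; by exists k; rewrite ?mem_enum.
- by apply/negP => /mapP[].
- by rewrite inE.
Qed.

Lemma uniq_hlist v : uniq (hlist v).
Proof.
by case: v => [i|l] //=; rewrite map_inj_uniq ?enum_uniq // => k k' [].
Qed.

Lemma fcycle_hlist v : fcycle sigma (hlist v).
Proof.
case: v => [i|l]; last by rewrite /= rotationE eqxx.
apply: homo_cycle (cycle_enum_ord (2 * nu)) => a b /eqP <-.
by rewrite /= rotationE.
Qed.

Definition degree (v : V) := if v is inl _ then 2 * nu else 1.

Lemma size_hlist v : size (hlist v) = degree v.
Proof. by case: v => //= i; rewrite size_map size_enum_ord. Qed.

Lemma mem_hlists (vs : seq V) h : (h \in flatten (map hlist vs)) = (vx h \in vs).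
Proof.
elim: vs => //= v vs IHvs; by rewrite mem_cat mem_hlist IHvs inE.
Qed.

Lemma uniq_hlists (vs : seq V) : uniq vs -> uniq (flatten (map hlist vs)).
Proof.
elim: vs => //= v vs IHvs /andP[nv uvs]; rewrite cat_uniq uniq_hlist IHvs // andbT.
by apply/hasPn => h; rewrite mem_hlists mem_hlist; apply: contraTneq => ->.
Qed.

Local Notation T B := #|lmatch vx sigma (ord0 : I) B|.
Local Notation C B := #|lmatchc vx sigma (ord0 : I) (inr ord0) B|.

Lemma card_lmatch_degrees (B : {set V}) (vs : seq V) : uniq vs -> vs =i B ->
  T B = wexp I (map degree vs).
Proof.
move=> uvs vsB; rewrite (@card_lmatch _ _ _ _ _ _ _ (flatten (map hlist vs))).
- rewrite (@sum_labels_wick _ _ _ sigma).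
  + by rewrite -map_comp; congr wexp; apply: eq_map => v /=; rewrite size_hlist.
  + by apply/allP => l /mapP[v _ ->]; apply: fcycle_hlist.
  + exact: uniq_hlists.
  + by apply/allP => a /mapP[l /mapP[v _ ->] ->]; rewrite size_hlist; case: v; rewrite /=; lia.
- exact: uniq_hlists.
- by move=> h; rewrite mem_hlists vsB.
Qed.

Definition inner (A : {set 'I_j}) : {set V} := [set v | if v is inl i then i \in A else false].
Definition legged (A : {set 'I_j}) : {set V} := [set v | if v is inl i then i \in A else true].

Lemma uniq_inl (A : {set 'I_j}) : uniq [seq (inl i : V) | i <- enum A].
Proof. by rewrite map_inj_uniq ?enum_uniq // => i i' []. Qed.

Lemma mem_inl (A : {set 'I_j}) (v : V) :
  (v \in [seq (inl i : V) | i <- enum A]) = (v \in inner A).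
Proof.
rewrite inE; case: v => [i|l]; last by apply/negP => /mapP[].
by rewrite mem_map ?mem_enum // => a b [].
Qed.

Lemma map_degree_inl (A : {set 'I_j}) :
  map degree [seq (inl i : V) | i <- enum A] = nseq #|A| (2 * nu).
Proof.
by rewrite -map_comp cardE; elim: (enum A) => //= i s ->.
Qed.

Lemma card_lmatch_inner A : T (inner A) = wexp I (nseq #|A| (2 * nu)).
Proof.
by rewrite (card_lmatch_degrees (uniq_inl A)) ?map_degree_inl // => v; apply: mem_inl.
Qed.

Lemma card_lmatch_legged A : T (legged A) = wexp I ([:: 1; 1] ++ nseq #|A| (2 * nu)).
Proof.
rewrite -map_degree_inl (@card_lmatch_degrees _
  ([:: inr ord0; inr ord_max] ++ [seq (inl i : V) | i <- enum A])) ?map_cat //.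
  rewrite cat_uniq uniq_inl !andbT; apply/andP; split=> //; apply/hasPn => v /mapP[i _ ->].
  by rewrite !inE.
move=> v; rewrite mem_cat mem_inl !inE; case: v => [i|l] //=.
by case: l => -[|[|]].
Qed.

Lemma card_lmatch_one_leg A l : T ((inr l : V) |: inner A) = 0.
Proof.
rewrite (@card_lmatch_degrees _ (inr l :: [seq (inl i : V) | i <- enum A])).
- by rewrite /= map_degree_inl wexp_odd //= sumn_nseq -mulnA mul2n odd_double.
- by rewrite /= uniq_inl andbT mem_inl inE.
- by move=> v; rewrite !inE mem_inl inE.
Qed.

(** If the component of the first leg misses the second leg, what remains contains exactly one leg,
    hence an odd number of half-edges, and admits no matching. *)
Lemma card_lmatch_legged_split A :
  T (legged A) = \sum_(A' : {set 'I_j} | A' \subset A) C (legged A') * T (inner (A :\: A')).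
Proof.
rewrite (@card_lmatch_split _ _ _ _ vertex_of_rotation _ _ (inr ord0)) ?inE //.
rewrite (bigID (fun B : {set V} => inr ord_max \in B)) /= addnC big1 ?add0n; last first.
  move=> B /andP[/andP[sub l0] l1].
  suff -> : legged A :\: B = (inr ord_max : V) |: inner (A :\: [set i | inl i \in B]).
    by rewrite card_lmatch_one_leg muln0.
  apply/setP => -[i|l]; rewrite !inE //= orbF andbT.
  case: l => -[|[|//]] ltl /=.
    by rewrite (_ : Ordinal ltl = ord0) ?l0 //; apply: val_inj.
  by rewrite (_ : Ordinal ltl = ord_max) ?l1 //; apply: val_inj.
rewrite (reindex_onto legged (fun B => [set i | inl i \in B])) /=; last first.
  move=> B /andP[/andP[sub l0] l1]; apply/setP => -[i|l]; rewrite !inE //.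
  case: l => -[|[|//]] ltl /=.
    by rewrite (_ : Ordinal ltl = ord0) ?l0 //; apply: val_inj.
  by rewrite (_ : Ordinal ltl = ord_max) ?l1 //; apply: val_inj.
apply: eq_big => [A'|A' _].
  rewrite !inE !andbT (_ : [set i | _] = A') ?eqxx ?andbT; last first.
    by apply/setP => i; rewrite !inE.
  apply/subsetP/subsetP => sub v; first by have := sub (inl v); rewrite !inE.
  by rewrite !inE; case: v => // i; apply: sub.
congr (_ * T _); apply/setP => -[i|l]; by rewrite !inE.
Qed.

Lemma sum_subsets (R : nmodType) (A : {set 'I_j}) (f : nat -> R) :
  (\sum_(A' : {set 'I_j} | A' \subset A) f #|A'| = \sum_(i < #|A|.+1) f i *+ 'C(#|A|, i))%R.
Proof.
rewrite (partition_big (fun A' : {set 'I_j} => inord #|A'| : 'I_#|A|.+1) xpredT) //=.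
apply: eq_bigr => i _; rewrite -cards_draws -sum1dep_card -sumrMnr.
have cardE' (A' : {set 'I_j}) : A' \subset A -> (inord #|A'| == i) = (#|A'| == i).
  move=> sub; have lt : #|A'| < #|A|.+1 by rewrite ltnS; apply: subset_leq_card.
  by rewrite -val_eqE /= inordK.
apply: eq_big => [A'|A' /andP[sub]]; last by rewrite cardE' // => /eqP ->.
by case: (boolP (A' \subset A)) => //= /cardE'.
Qed.

(** The binomial convolution below says that [cn] has as exponential series the quotient of the
    series with two legs by the one without legs. *)
Variable cn : nat -> rat.
Hypothesis cn_eq : forall k, k <= j ->
  ((wexp I ([:: 1; 1] ++ nseq k (2 * nu)))%:R =
   \sum_(i < k.+1) (cn i * (wexp I (nseq (k - i) (2 * nu)))%:R) *+ 'C(k, i))%R.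

(** In the splitting, the term A' = A has the cofactor 1 and the proper subsets are known by
    induction. The recursion for [cn] has the same shape, so the remaining terms agree. *)
Lemma card_lmatchc_legged A : (C (legged A))%:R%R = cn #|A|.
Proof.
have [n] := ubnP #|A|; elim: n A => // n IHn A ltn.
have leA : #|A| <= j by rewrite -[X in _ <= X]card_ord max_card.
have := card_lmatch_legged_split A; rewrite card_lmatch_legged.
move/(congr1 (fun q => q%:R : rat)%R); rewrite cn_eq // natr_sum.
rewrite -(sum_subsets A (fun i => cn i * (wexp I (nseq (#|A| - i) (2 * nu)))%:R)%R).
have T0 (A' : {set 'I_j}) : A' \subset A ->
    T (inner (A :\: A')) = wexp I (nseq (#|A| - #|A'|) (2 * nu)).
  by move=> sub; rewrite card_lmatch_inner cardsD (setIidPr sub).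
rewrite (bigD1 A) //= [in X in _ = X -> _](bigD1 A) //=.
rewrite [X in (_ + X)%R = _](eq_bigr (fun A' : {set 'I_j} =>
    (C (legged A') * T (inner (A :\: A')))%:R)%R).
  move/addIr; rewrite T0 // subnn natrM /wexp big_seq1 mulr1 => ->.
  by rewrite mulr1.
move=> A' /andP[sub ne]; rewrite natrM T0 // IHn //.
by apply: leq_trans (proper_card _) ltn; rewrite properEneq ne.
Qed.

Theorem sum_connected_faces :
  ((\sum_(m : {perm H} | is_matching m && is_connected m) N'.+1 ^ #|porbits (face_perm m)|)%:R
    = cn j)%R.
Proof.
transitivity (cn #|[set: 'I_j]|); last by rewrite cardsT card_ord.
rewrite -card_lmatchc_legged; congr (_%:R)%R.
have -> : legged setT = setT by apply/setP => -[i|l]; rewrite !inE.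
rewrite -sum1_card [RHS](partition_big (fun mf : {perm H} * {ffun H -> I} => mf.1)
  (fun m : {perm H} => is_matching m && is_connected m)) /=.
  apply: eq_bigr => m /andP[/forallP mm mc].
  rewrite -[X in X ^ _](card_ord N'.+1) -(card_invariant_labels _ (ord0 : I)).
  rewrite -sum1_card [RHS](reindex_onto (fun f => (m, f)) (fun mf => mf.2)) /=; last first.
    by case=> m' f /andP[_ /= /eqP ->].
  apply: eq_bigl => f; rewrite !eqxx !andbT in_lmatchc inE.
  have -> : component vx (inr ord0) m == setT.
    apply/eqP/setP => u; rewrite !inE.
    by have /forallP/(_ (inr ord0))/forallP/(_ u) := mc.
  (* Invariance of f along faces, taken at m h, is the condition f (sigma h) = f (m h) in
     [lmatch]. *)
  rewrite andbT; apply/forallP/lmatchP => [fP|[_ _ fP _] h].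
    split=> h; rewrite inE // => _.
      by have /andP[-> /eqP ->] := mm h; rewrite inE.
    have /andP[_ /eqP {1}<-] := mm h.
    by have := fP (m h); rewrite permM => /eqP.
  rewrite permM; have := fP (m h); rewrite inE => -> //.
  by have /andP[_ /eqP ->] := mm h.
case=> m f; rewrite in_lmatchc => /andP[/lmatchP[m1 _ _ _] /= /eqP mc].
apply/andP; split.
  by apply/forallP => h; have [] := m1 h; rewrite ?inE // => -> ->; rewrite eqxx.
have con u : connect (adj vx m) (inr ord0) u.
  by have : u \in component vx (inr ord0) m by [rewrite mc inE]; rewrite inE.
apply/forallP => u; apply/forallP => v.
have sym : connect_sym (adj vx m).
  apply: sym_connect_sym => a b; apply/existsP/existsP => -[h /andP[/eqP <- /eqP <-]];
  by exists (m h); have [] := m1 h; rewrite ?inE // => _ -> _; rewrite !eqxx.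
apply: connect_trans (con v); by rewrite sym.
Qed.

End Vertices.

(** * The recurrence coefficients as series *)

Section TruncatedSeries.
Local Open Scope ring_scope.
Variables (R : comNzRingType) (rho : {rmorphism rat -> R}) (t : R) (K : nat).
Hypothesis t_nilp : t ^+ K.+1 = 0.

Definition tseries (g : nat -> rat) : R := \sum_(a < K.+1) rho (g a) * t ^+ a.

Lemma expr_nilp k : (K < k)%N -> t ^+ k = 0.
Proof. by move=> ltk; rewrite -(subnK ltk) exprD t_nilp mulr0. Qed.

Lemma tseriesM g h : tseries g * tseries h = tseries (fun a => \sum_(b < a.+1) g (a - b)%N * h b).
Proof.
pose P (f : nat -> rat) : {poly R} := \poly_(a < K.+1) rho (f a).
have PE f : tseries f = (P f).[t].
  by rewrite (horner_coef_wide _ (size_poly _ _)); apply: eq_bigr => a _; rewrite coef_poly ltn_ord.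
rewrite !PE -hornerM [in LHS](horner_coef_wide _ (leq_addr K.+1 _)).
rewrite addnC big_split_ord /= [X in _ + X]big1 ?addr0 => [|a _]; last first.
  by rewrite expr_nilp ?mulr0 // addSn ltnS leq_addr.
rewrite -PE /tseries; apply: eq_bigr => c _; congr (_ * _).
rewrite coefMr rmorph_sum; apply: eq_bigr => b _.
have lc := ltn_ord c; have lb := ltn_ord b.
rewrite !coef_poly rmorphM !ifT //; lia.
Qed.

Lemma eq_tseries g h : (forall a, (a <= K)%N -> g a = h a) -> tseries g = tseries h.
Proof. by move=> eq_gh; apply: eq_bigr => a _; rewrite eq_gh // -ltnS. Qed.

Lemma tseriesD g h : tseries (fun a => g a + h a) = tseries g + tseries h.
Proof. by rewrite -big_split; apply: eq_bigr => a _; rewrite rmorphD mulrDl. Qed.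

Lemma tseries_const c : tseries (fun a => if a == 0%N then c else 0) = rho c.
Proof.
rewrite /tseries big_ord_recl mulr1 big1 ?addr0 // => a _.
by rewrite rmorph0 mul0r.
Qed.

End TruncatedSeries.

Section PathSums.
Local Open Scope ring_scope.

Definition shift (q : rat) (p : {poly rat}) : {poly rat} := p \Po ('X + q%:P).

Lemma horner_shift q p n : (shift q p).[n] = p.[n + q].
Proof. by rewrite horner_comp !hornerE. Qed.

(* For the series x_n(t) = \sum_a y_a(n) t^a, the polynomial in n + 1 giving the
   coefficient of t^a in the entry (n, n + u - d) of L^(u + d), as a sum over lattice
   paths with u steps weighted by x and d steps weighted by 1. *)
Fixpoint pathsum (y : nat -> {poly rat}) (u : nat) : nat -> nat -> {poly rat} :=
  match u with
  | 0 => fun _ a => (a == 0%N)%:R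
  | u'.+1 => fix aux d a :=
      \sum_(b < a.+1) pathsum y u' d (a - b) * shift (u'%:R - d%:R) (y b)
      + (if d is d'.+1 then aux d' a else 0)
  end.

Lemma pathsumS y u d a : pathsum y u.+1 d a =
  \sum_(b < a.+1) pathsum y u d (a - b) * shift (u%:R - d%:R) (y b)
  + (if d is d'.+1 then pathsum y u.+1 d' a else 0).
Proof. by case: d. Qed.

Lemma eq_pathsum y z u d a : (forall b, (b <= a)%N -> y b = z b) ->
  pathsum y u d a = pathsum z u d a.
Proof.
elim: u d a => [//|u IHu] d a; elim: d => [|d IHd] eq_yz; rewrite [LHS]pathsumS [RHS]pathsumS.
  congr (_ + _); apply: eq_bigr => b _; rewrite eq_yz -1?ltnS // IHu //.
  by move=> b' leb; apply: eq_yz; apply: leq_trans leb (leq_subr _ _).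
congr (_ + _); last exact: IHd.
apply: eq_bigr => b _; rewrite eq_yz -1?ltnS // IHu //.
by move=> b' leb; apply: eq_yz; apply: leq_trans leb (leq_subr _ _).
Qed.

Variable nu : nat.

Fixpoint freud_iter (k : nat) : nat -> {poly rat} :=
  if k is k'.+1 then fun a =>
    if a is a'.+1 then (2 * nu)%:R *: pathsum (freud_iter k') nu nu.-1 a' else 'X
  else fun=> 'X.

(* The coefficient of t^a in the solution x_n(t) of the Freud equation, as a polynomial
   in n. *)
Definition freud_poly a := freud_iter a a.

Lemma freud_iter_stable k a : (a <= k)%N -> freud_iter k a = freud_poly a.
Proof.
rewrite /freud_poly; elim/ltn_ind: a k => -[|a] IHa [//|k] //=; rewrite ltnS => leak.
congr (_ *: _); apply: eq_pathsum => b leb.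
by rewrite (IHa b leb k (leq_trans leb leak)) (IHa b leb a leb).
Qed.

Lemma freud_poly0 : freud_poly 0 = 'X. Proof. by []. Qed.

Lemma freud_polyS a : freud_poly a.+1 = (2 * nu)%:R *: pathsum freud_poly nu nu.-1 a.
Proof.
rewrite {1}/freud_poly /=; congr (_ *: _); apply: eq_pathsum => b leb.
exact: freud_iter_stable.
Qed.

(** The value at 0 belongs to paths that start at index -1 and end above it. They have to step from
    -1 to 0, and this step has the weight x_0 = 0. *)
Lemma pathsum_root0 u d a : (forall b, (b <= a)%N -> (freud_poly b).[0] = 0) ->
  (d < u)%N -> (pathsum freud_poly u d a).[0] = 0.
Proof.
move=> y0; elim: u d a y0 => [//|u IHu] d a y0 ltd.
have sum0 d' : (d' <= u)%N ->
    (\sum_(b < a.+1) pathsum freud_poly u d' (a - b) * shift (u%:R - d'%:R) (freud_poly b)).[0] = 0.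
  move=> led; rewrite horner_sum big1 // => b _; rewrite hornerM horner_shift add0r.
  move: led; rewrite leq_eqVlt => /predU1P[->|ltd'].
    by rewrite subrr y0 ?mulr0 // -ltnS.
  by rewrite IHu ?mul0r // => b' leb; apply: y0; apply: leq_trans leb (leq_subr _ _).
elim: d ltd => [|d IHd] ltd; rewrite pathsumS hornerD sum0 // add0r ?horner0 //.
by apply: IHd; apply: ltnW.
Qed.

Hypothesis nu_gt0 : (0 < nu)%N.

Lemma freud_poly_root0 a : (freud_poly a).[0] = 0.
Proof.
elim/ltn_ind: a => -[|a] IHa; first by rewrite freud_poly0 hornerX.
rewrite freud_polyS hornerZ pathsum_root0 ?mulr0 //; last by rewrite prednK.
Qed.

Variables (R : comNzRingType) (rho : {rmorphism rat -> R}) (t : R) (K : nat).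
Hypothesis t_nilp : t ^+ K.+1 = 0.

Local Notation tseries := (tseries rho t K).

Definition freud_x (n : nat) : R := tseries (fun a => (freud_poly a).[n%:R]).

Lemma freud_x0 : freud_x 0 = 0.
Proof. by rewrite /freud_x /tseries big1 // => a _; rewrite freud_poly_root0 rmorph0 mul0r. Qed.

(** [pathsum] also counts paths below index 0, which [jacobi_pow] excludes. To end at a non-negative
    index they must step from -1 to 0, with the weight x_0 = 0, so the two counts agree. *)
Lemma jacobi_pow_pathsum u d n : (d <= n + u)%N ->
  jacobi_pow freud_x (u + d) n (n + u - d) =
    tseries (fun a => (pathsum freud_poly u d a).[n.+1%:R]).
Proof.
elim: u d => [|u IHu].
  move=> d; rewrite addn0 add0n => led.
  have -> : tseries (fun a => (pathsum freud_poly 0 d a).[n.+1%:R]) = 1.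
    rewrite -(rmorph1 rho) -(tseries_const rho t K); apply: eq_tseries => a _ /=.
    by case: eqP => _; rewrite ?hornerE.
  elim: d led => [|d IHd] led; first by rewrite subn0 /= eqxx.
  rewrite jacobi_powSr -(IHd (ltnW led)) (_ : (n - d.+1).+1 = n - d)%N; last by lia.
  case e : (n - d.+1)%N => [|m]; first by rewrite add0r.
  by rewrite jacobi_pow_lo ?mul0r ?add0r //; lia.
have step d : (d <= n + u.+1)%N ->
  tseries (fun a => (\sum_(b < a.+1) pathsum freud_poly u d (a - b)
      * shift (u%:R - d%:R) (freud_poly b)).[n.+1%:R])
  = (if (n + u.+1 - d)%N is m.+1 then jacobi_pow freud_x (u + d) n m * freud_x m.+1 else 0).
  move=> led.
  have -> : tseries (fun a => (\sum_(b < a.+1) pathsum freud_poly u d (a - b)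
        * shift (u%:R - d%:R) (freud_poly b)).[n.+1%:R]) =
      tseries (fun a => (pathsum freud_poly u d a).[n.+1%:R]) * freud_x (n + u.+1 - d).
    rewrite (tseriesM rho t_nilp); apply: eq_tseries => a _; rewrite horner_sum; apply: eq_bigr => b _.
    rewrite hornerM horner_shift natrB // -addSnnS natrD.
    by rewrite addrA.
  case e : (n + u.+1 - d)%N => [|m]; first by rewrite freud_x0 mulr0.
  rewrite -IHu; last by lia.
  by congr (jacobi_pow _ _ _ _ * _); lia.
elim=> [|d IHd] led.
  rewrite addn0 subn0 addnS jacobi_powSr (@jacobi_pow_hi _ _ u n (n + u).+2) ?addr0; last by lia.
  have := step 0%N led; rewrite subn0 addn0 addnS => <-.
  by apply: eq_tseries => a _; rewrite [in RHS]pathsumS !addr0.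
transitivity (tseries (fun a =>
    (\sum_(b < a.+1) pathsum freud_poly u d.+1 (a - b)
      * shift (u%:R - d.+1%:R) (freud_poly b)).[n.+1%:R])
  + tseries (fun a => (pathsum freud_poly u.+1 d a).[n.+1%:R])); last first.
  by rewrite -tseriesD; apply: eq_tseries => a _; rewrite [in RHS]pathsumS hornerD.
rewrite (step _ led) -(IHd (ltnW led)) addSn jacobi_powSr.
congr (_ + _); first by case: (n + u.+1 - d.+1)%N.
by rewrite addSnnS; congr jacobi_pow; lia.
Qed.

(** A path of length 2 nu - 1 from n to n + 1 has nu steps up and nu - 1 steps down, so
    [freud_polyS] is the Freud equation coefficient by coefficient. The last coefficient of the path
    sum meets t^(K+1) = 0. *)
Lemma freud_x_freud n :
  freud_x n.+1 - ((2 * nu).-1.+1%:R * t) * jacobi_pow freud_x (2 * nu).-1 n n.+1 = n.+1%:R.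
Proof.
have e1 : (2 * nu).-1.+1 = (2 * nu)%N by lia.
have e2 : (2 * nu).-1 = (nu + nu.-1)%N by lia.
have e3 : n.+1 = (n + nu - nu.-1)%N by lia.
rewrite e1 e2 {2}e3 jacobi_pow_pathsum; last by lia.
rewrite /freud_x /tseries big_ord_recl mulr1 freud_poly0 hornerX /= rmorph_nat.
rewrite [X in _ * _ * X]big_ord_recr /= [X in _ - X]mulrDr.
set z := (X in _ - (_ + X)); have -> : z = 0.
  by rewrite /z -mulrA [t * _]mulrCA -exprS t_nilp !mulr0.
rewrite addr0 mulr_sumr -addrA -sumrB big1 ?addr0 // => a _.
by rewrite freud_polyS hornerZ rmorphM rmorph_nat exprS /=; ring.
Qed.

End PathSums.

(** * The ring Q[t]/(t^(K+1)) and comparison of coefficients *)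

Section TruncatedSeries.
Local Open Scope ring_scope.
Variable K : nat.
Let h : {poly rat} := 'X^(K.+1).
Let rho : {rmorphism rat -> {poly %/ h}} := in_qpoly h \o polyC.
Let t : {poly %/ h} := in_qpoly h 'X.

Lemma mk_monic_h : mk_monic h = h.
Proof. by rewrite /h mk_monic_Xn. Qed.

Lemma t_nilp : t ^+ K.+1 = 0.
Proof.
by rewrite /t -rmorphXn /=; apply: val_inj; rewrite /= mk_monic_h Pdiv.RingMonic.rmodpp ?monicXn.
Qed.

Lemma tseries_inj f g : tseries rho t K f = tseries rho t K g -> forall a, (a <= K)%N -> f a = g a.
Proof.
have tsE f' : tseries rho t K f' = in_qpoly h (\poly_(a < K.+1) f' a).
  rewrite poly_def rmorph_sum; apply: eq_bigr => a _.
  by rewrite -mul_polyC rmorphM rmorphXn.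
rewrite !tsE => /(congr1 (fun p => val p : {poly rat})) /=.
rewrite !Pdiv.CommonRing.rmodp_small ?mk_monic_h ?size_polyXn ?ltnS ?size_poly // => eq_fg a leaK.
by have := congr1 (fun p : {poly rat} => p`_a) eq_fg; rewrite !coef_poly ltnS leaK.
Qed.

(** This is the coefficient of t^k in [two_leg_ratio]. The factors K!/i! that avoid denominators in
    [wick_corr] become binomial coefficients after division by K!/k!. *)
Lemma freud_poly_wexp nu N' k : (0 < nu)%N -> (k <= K)%N ->
  (wexp 'I_N'.+1 ([:: 1; 1] ++ nseq k (2 * nu)))%:R =
  \sum_(i < k.+1) (i`!%:R * (freud_poly nu i).[N'.+1%:R] *
     (wexp 'I_N'.+1 (nseq (k - i) (2 * nu)))%:R) *+ 'C(k, i) :> rat.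
Proof.
move=> nu_gt0 lekK; have e1 : (2 * nu).-1.+1 = (2 * nu)%N by lia.
have odd_r : odd (2 * nu).-1.
  have : odd (2 * nu).-1.+1 = false by rewrite e1 mul2n odd_double.
  by rewrite /= => /negbFE.
have := two_leg_ratio rho t_nilp odd_r (freud_x_freud nu_gt0 rho t_nilp) N'.
have wcE s : wick_corr N'.+1 t K (2 * nu).-1 s =
    tseries rho t K (fun j => (tcoef K j)%:R * (wexp 'I_N'.+1 (s ++ nseq j (2 * nu)))%:R).
  by apply: eq_bigr => j _; rewrite e1 rmorphM !rmorph_nat; ring.
rewrite !wcE /freud_x (tseriesM rho t_nilp) => /tseries_inj/(_ _ lekK).
have tK i : (i <= K)%N -> (tcoef K i)%:R = K`!%:R / i`!%:R :> rat.
  move=> lei; rewrite -(@ffact_fact K (K - i)) ?leq_subr // subKn // natrM mulfK //.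
  by rewrite pnatr_eq0 -lt0n fact_gt0.
have nz i : i`!%:R != 0 :> rat by rewrite pnatr_eq0 -lt0n fact_gt0.
have nzk : K`!%:R / k`!%:R != 0 :> rat by rewrite mulf_neq0 ?invr_eq0 ?nz.
rewrite tK // => eq1; apply: (mulfI nzk).
rewrite eq1 (reindex_inj rev_ord_inj) mulr_sumr; apply: eq_bigr => i _ /=.
have lei : (i <= k)%N by rewrite -ltnS.
rewrite subSS subKn // tK; last by apply: leq_trans lekK; apply: leq_subr.
rewrite -[_ *+ 'C(k, i)]mulr_natr.
have -> : 'C(k, i)%:R = k`!%:R / (i`!%:R * (k - i)`!%:R) :> rat.
  by rewrite -(bin_fact lei) !natrM mulfK // mulf_neq0.
by field; rewrite !nz.
Qed.

End TruncatedSeries.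

Theorem sum_connected_freud_poly nu j N' : (0 < nu)%N ->
  ((\sum_(m : {perm half_edge nu j} | is_matching m && is_connected m)
      N'.+1 ^ #|porbits (face_perm m)|)%:R
   = j`!%:R * (freud_poly nu j).[N'.+1%:R] :> rat)%R.
Proof.
move=> nu_gt0.
apply: (sum_connected_faces nu_gt0 (cn := fun i => (i`!%:R * (freud_poly nu i).[N'.+1%:R])%R)).
by move=> k lekj; apply: freud_poly_wexp lekj.
Qed.

(** Both sides agree at every positive integer N, so their difference has too many roots. *)
Lemma sum_connected_freud_polyX nu j : (0 < nu)%N ->
  (\sum_(m : {perm half_edge nu j} | is_matching m && is_connected m)
      'X^(#|porbits (face_perm m)|) = j`!%:R *: freud_poly nu j :> {poly rat})%R.
Proof.
move=> nu_gt0; apply/eqP; rewrite -subr_eq0; apply/eqP.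
set p := (_ - _)%R; have rootp (N' : nat) : (p.[N'.+1%:R] = 0)%R.
  rewrite /p hornerD hornerN hornerZ -sum_connected_freud_poly // horner_sum natr_sum.
  by apply/eqP; rewrite subr_eq0; apply/eqP/eq_bigr => m _; rewrite hornerXn natrX.
apply/eqP; apply: contraT => pn0.
have := @max_poly_roots _ p [seq (k.+1%:R)%R | k <- iota 0 (size p)] pn0.
rewrite size_map size_iota ltnn; apply; first by apply/allP => z /mapP[k _ ->]; apply/eqP.
by rewrite map_inj_uniq ?iota_uniq // => a b /eqP; rewrite eqr_nat => /eqP[].
Qed.

(** * Top coefficients *)

Section ReversedPolynomials.
Local Open Scope ring_scope.
Implicit Types p q : {poly rat}.

(** Reversal with respect to a degree bound is multiplicative ([rev_polyM]), so that leading
    coefficients of products convolve like coefficients of power series. *)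
Definition rev_poly n p : {poly rat} := \sum_(j < n.+1) p`_j *: 'X^(n - j).

(* The coefficient of 'X^(n - k); n is a bound on the degree of p. *)
Definition top n p k : rat := (rev_poly n p)`_k.

Lemma topE n p k : top n p k = if (k <= n)%N then p`_(n - k) else 0.
Proof.
rewrite /top /rev_poly coef_sum; case: leqP => [lekn|ltnk]; last first.
  rewrite big1 // => j _; rewrite coefZ coefXn gtn_eqF ?mulr0 //.
  exact: leq_ltn_trans (leq_subr _ _) ltnk.
have lt : (n - k < n.+1)%N by rewrite ltnS leq_subr.
rewrite (bigD1 (Ordinal lt)) //= coefZ coefXn subKn // eqxx mulr1 big1 ?addr0 // => j ne.
rewrite coefZ coefXn (negbTE (_ : k != (n - j)%N)) ?mulr0 //.
by apply: contraNneq ne => e; rewrite -val_eqE /= e subKn // -ltnS.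
Qed.

Lemma rev_poly_is_linear n : linear (rev_poly n).
Proof.
move=> a p q; rewrite /rev_poly scaler_sumr -big_split; apply: eq_bigr => j _ /=.
by rewrite coefD coefZ scalerDl scalerA.
Qed.
HB.instance Definition _ n :=
  GRing.isLinear.Build rat {poly rat} {poly rat} _ _ (rev_poly_is_linear n).

Lemma rev_polyXn n i : (i <= n)%N -> rev_poly n 'X^i = 'X^(n - i).
Proof.
move=> lein; have lt : (i < n.+1)%N by rewrite ltnS.
rewrite /rev_poly (bigD1 (Ordinal lt)) //= coefXn eqxx scale1r big1 ?addr0 // => j ne.
by rewrite coefXn (negbTE (_ : (j : nat) != i)) ?scale0r.
Qed.

Lemma poly_wide n p : (size p <= n)%N -> p = \sum_(j < n) p`_j *: 'X^j.
Proof.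
move=> le; rewrite -poly_def; apply/polyP => i; rewrite coef_poly.
by case: ltnP => // lei; rewrite nth_default // (leq_trans le).
Qed.

Lemma rev_polyM n m p q : (size p <= n.+1)%N -> (size q <= m.+1)%N ->
  rev_poly (n + m) (p * q) = rev_poly n p * rev_poly m q.
Proof.
move=> sp sq; rewrite {1}(poly_wide sp) {1}(poly_wide sq) /rev_poly -/(rev_poly _ _).
rewrite mulr_suml linear_sum mulr_suml; apply: eq_bigr => i _ /=.
rewrite mulr_sumr linear_sum mulr_sumr; apply: eq_bigr => j _ /=.
rewrite -scalerAl -scalerAr !linearZ /= -exprD rev_polyXn; last first.
  by have := ltn_ord i; have := ltn_ord j; lia.
rewrite -scalerAl -scalerAr -exprD; congr (_ *: (_ *: 'X^_)).
by have := ltn_ord i; have := ltn_ord j; lia.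
Qed.

Lemma topM n m p q k : (size p <= n.+1)%N -> (size q <= m.+1)%N ->
  top (n + m) (p * q) k = \sum_(i < k.+1) top n p (k - i) * top m q i.
Proof. by move=> sp sq; rewrite /top rev_polyM // coefMr. Qed.

Lemma top_sum n (I : Type) (s : seq I) (P : pred I) F k :
  top n (\sum_(i <- s | P i) F i) k = \sum_(i <- s | P i) top n (F i) k.
Proof. by rewrite /top linear_sum coef_sum. Qed.

Lemma topD n p q k : top n (p + q) k = top n p k + top n q k.
Proof. by rewrite /top linearD coefD. Qed.

Lemma topZ n a p k : top n (a *: p) k = a * top n p k.
Proof. by rewrite /top linearZ /= coefZ. Qed.

Lemma size_shift c p : size (shift c p) = size p.
Proof. by rewrite size_comp_poly2 // size_XaddC. Qed.

Lemma coef_XaddC_exp c j i :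
  (('X + c%:P) ^+ j : {poly rat})`_i = 'C(j, i)%:R * c ^+ (j - i).
Proof.
elim: j i => [|j IHj] i.
  by rewrite coef1; case: i => [|i]; rewrite ?bin0 ?bin0n ?mulr1 ?mul0r.
rewrite exprSr mulrDr coefD coefMX coefMC !IHj; case: i => [|i] /=.
  by rewrite add0r !bin0 !subn0 exprSr; ring.
rewrite binS subSS natrD; have [leij|ltji] := leqP i.+1 j.
  by rewrite -(subnSK leij) exprSr; ring.
by rewrite (bin_small ltji); ring.
Qed.

Lemma top_shift n c p k : (size p <= n.+1)%N ->
  top n (shift c p) k =
  \sum_(l < k.+1) top n p l * 'C(n - l, k - l)%:R * c ^+ (k - l).
Proof.
move=> sp; pose F l : rat := if (l <= n)%N && (l <= k)%N then
  p`_(n - l) * 'C(n - l, k - l)%:R * c ^+ (k - l) else 0.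
have -> : \sum_(l < k.+1) top n p l * 'C(n - l, k - l)%:R * c ^+ (k - l) =
    \sum_(l < (n + k).+1) F l.
  rewrite (big_ord_widen (n + k).+1 (fun l => top n p l * 'C(n - l, k - l)%:R * c ^+ (k - l)));
    last by rewrite ltnS leq_addl.
  rewrite big_mkcond; apply: eq_bigr => l _; rewrite /F ltnS topE andbC.
  by case: (l <= k)%N => //=; case: ifP => //; rewrite !mul0r.
have -> : \sum_(l < (n + k).+1) F l = \sum_(l < n.+1) F l.
  rewrite [RHS](big_ord_widen (n + k).+1 F) ?ltnS ?leq_addr // [RHS]big_mkcond.
  by apply: eq_bigr => l _; rewrite /F ltnS; case: (l <= n)%N.
rewrite {1}(poly_wide sp) /shift raddf_sum top_sum.
rewrite (reindex_inj rev_ord_inj); apply: eq_bigr => l _ /=.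
have lel : (l <= n)%N by rewrite -ltnS.
rewrite subSS /F lel comp_polyZ topZ comp_Xn_poly topE coef_XaddC_exp /=.
have [lekn|ltnk] := leqP k n; last first.
  by rewrite mulr0; case: leqP => // _; rewrite bin_small ?mulr0 ?mul0r //; lia.
have [lelk|ltkl] := leqP l k; last by rewrite bin_small ?mul0r ?mulr0 //; lia.
rewrite -mulrA; congr (_ * (_%:R * _ ^+ _)); last by lia.
by rewrite -bin_sub; [congr 'C(_, _); lia | lia].
Qed.

End ReversedPolynomials.

(** * Leading coefficients of the path sums *)

Section TopCoefficients.
Local Open Scope ring_scope.
Variable nu : nat.

(** This degree bound is also the number of faces of a planar connected graph with a vertices. *)
Definition ydeg a := (a * nu.-1).+1.
Definition pdeg u a := (u + a * nu.-1)%N.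

Definition ztop a k := top (ydeg a) (freud_poly nu a) k.
Definition gtop a k u d := top (pdeg u a) (pathsum (freud_poly nu) u d a) k.
(** By [top_shift], the k-th leading coefficient of the term y_a read at height h. *)
Definition xtop a k (h : rat) :=
  \sum_(l < k.+1) ztop a l * 'C(ydeg a - l, k - l)%:R * h ^+ (k - l).

Lemma gtop0 a k d : gtop a k 0 d = ((a == 0%N) && (k == 0%N))%:R.
Proof.
rewrite /gtop /= topE /pdeg add0n; case: eqP => [->|_] /=.
  by rewrite mul0n coef1; case: k.
by rewrite coef0 if_same.
Qed.

Lemma pdegS u a b : (b <= a)%N -> (pdeg u (a - b) + ydeg b)%N = pdeg u.+1 a.
Proof. by move=> leba; rewrite /pdeg /ydeg -[in RHS](subnK leba) mulnDl; lia. Qed.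

Lemma size_pathsum_aux a : (forall b, (b <= a)%N -> (size (freud_poly nu b) <= (ydeg b).+1)%N) ->
  forall u d, (size (pathsum (freud_poly nu) u d a) <= (pdeg u a).+1)%N.
Proof.
move=> szY u d; elim: u d a szY => [|u IHu] d a szY.
  by rewrite /=; case: (a == 0%N); rewrite ?size_poly1 ?size_poly0.
have sum_le d' : (size (\sum_(b < a.+1)
    pathsum (freud_poly nu) u d' (a - b) * shift (u%:R - d'%:R) (freud_poly nu b))%R
    <= (pdeg u.+1 a).+1)%N.
  apply: (leq_trans (size_sum _ _ _)); apply/bigmax_leqP => b _.
  have leba : (b <= a)%N by rewrite -ltnS.
  rewrite (leq_trans (size_polyMleq _ _)) // size_shift.
  have le1 := IHu d' (a - b)%N (fun b' leb' => szY b' (leq_trans leb' (leq_subr _ _))).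
  by have := pdegS u leba; have := szY b leba; lia.
elim: d => [|d IHd]; rewrite pathsumS.
  by rewrite addrC add0r; apply: sum_le.
by rewrite (leq_trans (size_polyD _ _)) // geq_max sum_le.
Qed.

Lemma size_freud_poly a : (0 < nu)%N -> (size (freud_poly nu a) <= (ydeg a).+1)%N.
Proof.
move=> nu_gt0; elim/ltn_ind: a => -[|a] IHa; first by rewrite freud_poly0 size_polyX.
rewrite freud_polyS (leq_trans (size_scale_leq _ _)) //.
apply: leq_trans (size_pathsum_aux _ _ _) _ => [b leb|]; first exact: IHa.
by rewrite /pdeg /ydeg; lia.
Qed.

Hypothesis nu_gt0 : (0 < nu)%N.

Lemma size_pathsum u d a : (size (pathsum (freud_poly nu) u d a) <= (pdeg u a).+1)%N.
Proof. by apply: size_pathsum_aux => b _; apply: size_freud_poly. Qed.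

Lemma gtopS a k u d : gtop a k u.+1 d =
  \sum_(b < a.+1) \sum_(i < k.+1) gtop (a - b) (k - i) u d * xtop b i (u%:R - d%:R)
  + (if d is d'.+1 then gtop a k u.+1 d' else 0).
Proof.
rewrite /gtop pathsumS topD top_sum; congr (_ + _); last first.
  by case: d => // ; rewrite topE coef0 if_same.
apply: eq_bigr => b _; have leba : (b <= a)%N by rewrite -ltnS.
rewrite -(pdegS u leba) topM ?size_pathsum ?size_shift ?size_freud_poly //.
by apply: eq_bigr => i _; rewrite top_shift ?size_freud_poly.
Qed.

Lemma ztop0 k : ztop 0 k = (k == 0%N)%:R.
Proof. by rewrite /ztop freud_poly0 topE /ydeg mul0n coefX; case: k => [|[|k]]. Qed.

Lemma ztopS a k : ztop a.+1 k = (2 * nu)%:R * gtop a k nu nu.-1.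
Proof.
rewrite /ztop freud_polyS topZ; congr (_ * top _ _ _).
by rewrite /ydeg /pdeg mulSn; lia.
Qed.

Lemma ztop_small a k : (ydeg a < k)%N -> ztop a k = 0.
Proof. by move=> lt; rewrite /ztop topE leqNgt lt. Qed.

End TopCoefficients.

(** * Degrees in the Newton basis *)

Section NewtonSpan.
Local Open Scope ring_scope.

Definition ffall (q : rat) i : rat := \prod_(k < i) (q - k%:R).

Lemma ffallS q i : ffall q i.+1 = ffall q i * (q - i%:R).
Proof. by rewrite /ffall big_ord_recr. Qed.

Lemma ffall_shift q i : q * ffall (q - 1) i = ffall q i.+1.
Proof.
rewrite /ffall big_ord_recl subr0; congr (_ * _); apply: eq_bigr => k _.
by rewrite -addrA -opprD nat1r.
Qed.

(* Polynomials of total degree at most n, expanded in the Newton basis in u and d. *)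
Inductive nspan : nat -> (rat -> rat -> rat -> rat) -> Prop :=
| nspan_mon n e i l c : (e + i + l <= n)%N ->
    nspan n (fun v u d => c * v ^+ e * ffall u i * ffall d l)
| nspan_add n f g : nspan n f -> nspan n g -> nspan n (fun v u d => f v u d + g v u d)
| nspan_ext n f g : nspan n f -> (forall v u d, g v u d = f v u d) -> nspan n g.

Lemma nspan_leq n m f : (n <= m)%N -> nspan n f -> nspan m f.
Proof.
move=> + sf; elim: sf => {n f} [n e i l c le|n f g _ IHf _ IHg|n f g _ IHf eqg] lenm.
- exact: nspan_mon (leq_trans le lenm).
- exact: nspan_add (IHf lenm) (IHg lenm).
- exact: nspan_ext (IHf lenm) eqg.
Qed.

Lemma nspan_const n c : nspan n (fun _ _ _ => c).
Proof.
apply: (nspan_ext (nspan_mon c (leq0n n : (0 + 0 + 0 <= n)%N))) => v u d.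
by rewrite /ffall !big_ord0 !mulr1.
Qed.

Lemma nspan_scale n a f : nspan n f -> nspan n (fun v u d => a * f v u d).
Proof.
elim=> {n f} [n e i l c le|n f g _ IHf _ IHg|n f g _ IHf eqg].
- by apply: (nspan_ext (nspan_mon (a * c) le)) => v u d; ring.
- by apply: (nspan_ext (nspan_add IHf IHg)) => v u d; ring.
- by apply: (nspan_ext IHf) => v u d; rewrite eqg.
Qed.

Lemma nspan_mulv n f : nspan n f -> nspan n.+1 (fun v u d => v * f v u d).
Proof.
elim=> {n f} [n e i l c le|n f g _ IHf _ IHg|n f g _ IHf eqg].
- have le' : (e.+1 + i + l <= n.+1)%N by [].
  by apply: (nspan_ext (nspan_mon c le')) => v u d; rewrite exprS; ring.
- by apply: (nspan_ext (nspan_add IHf IHg)) => v u d; ring.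
- by apply: (nspan_ext IHf) => v u d; rewrite eqg.
Qed.

Lemma nspan_mulu n f : nspan n f -> nspan n.+1 (fun v u d => u * f v u d).
Proof.
elim=> {n f} [n e i l c le|n f g _ IHf _ IHg|n f g _ IHf eqg].
- have le1 : (e + i.+1 + l <= n.+1)%N by rewrite addnS.
  apply: (nspan_ext (nspan_add (nspan_mon c le1)
    (nspan_mon (i%:R * c) (leqW le)))) => v u d.
  by rewrite ffallS; ring.
- by apply: (nspan_ext (nspan_add IHf IHg)) => v u d; ring.
- by apply: (nspan_ext IHf) => v u d; rewrite eqg.
Qed.

Lemma nspan_muld n f : nspan n f -> nspan n.+1 (fun v u d => d * f v u d).
Proof.
elim=> {n f} [n e i l c le|n f g _ IHf _ IHg|n f g _ IHf eqg].
- have le1 : (e + i + l.+1 <= n.+1)%N by rewrite addnS.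
  apply: (nspan_ext (nspan_add (nspan_mon c le1)
    (nspan_mon (l%:R * c) (leqW le)))) => v u d.
  by rewrite ffallS; ring.
- by apply: (nspan_ext (nspan_add IHf IHg)) => v u d; ring.
- by apply: (nspan_ext IHf) => v u d; rewrite eqg.
Qed.

Lemma nspan_mul n m f g : nspan n f -> nspan m g ->
  nspan (n + m) (fun v u d => f v u d * g v u d).
Proof.
move=> sf sg; elim: sf => {n f} [n e i l c le|n f h _ IHf _ IHh|n f h _ IHf eqh].
- apply: (nspan_leq (leq_add le (leqnn m))) => {n le}.
  elim: l => [|l IHl]; last first.
    rewrite addnS addSn; apply: (nspan_ext (nspan_add (nspan_muld IHl) (nspan_leq (leqnSn _)
      (nspan_scale (- l%:R) IHl)))) => v u d.
    by rewrite ffallS; ring.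
  rewrite addn0; elim: i => [|i IHi]; last first.
    rewrite addnS addSn; apply: (nspan_ext (nspan_add (nspan_mulu IHi) (nspan_leq (leqnSn _)
      (nspan_scale (- i%:R) IHi)))) => v u d.
    by rewrite ffallS; ring.
  rewrite addn0; elim: e => [|e IHe]; last first.
    by apply: (nspan_ext (nspan_mulv IHe)) => v u d; rewrite exprS; ring.
  apply: (nspan_ext (nspan_scale c sg)) => v u d.
  by rewrite /ffall !big_ord0 !mulr1.
- by apply: (nspan_ext (nspan_add IHf IHh)) => v u d; ring.
- by apply: (nspan_ext IHf) => v u d; rewrite eqh.
Qed.

Lemma nspan_sum n (I : Type) (s : seq I) F : (forall i, nspan n (F i)) ->
  nspan n (fun v u d => \sum_(i <- s) F i v u d).
Proof.
move=> sF; elim: s => [|i s IHs].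
  by apply: (nspan_ext (nspan_const n 0)) => v u d; rewrite big_nil.
by apply: (nspan_ext (nspan_add (sF i) IHs)) => v u d; rewrite big_cons.
Qed.

(* On the Newton basis the operator below is diagonal, with eigenvalue [i + l]. *)
Lemma nspan_solve n f c : nspan n f -> exists2 q, nspan n.+1 q &
  (forall v, q v 0 0 = c) /\
  forall v u d, u * (q v u d - q v (u - 1) d) + d * (q v u d - q v u (d - 1))
    = u * f v (u - 1) d.
Proof.
move=> sf; suff [q sq [q0 qE]] : exists2 q, nspan n.+1 q &
  (forall v, q v 0 0 = 0) /\
  forall v u d, u * (q v u d - q v (u - 1) d) + d * (q v u d - q v u (d - 1))
    = u * f v (u - 1) d.
  exists (fun v u d => q v u d + c); first exact: nspan_add sq (nspan_const _ _).
  by split=> [v|v u d]; [rewrite q0 add0r | rewrite -qE; ring].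
elim: sf => {n f} [n e i l a le|n f g _ [q1 s1 [z1 E1]] _ [q2 s2 [z2 E2]]
  |n f g _ [q s1 [z1 E1]] eqg].
- have le' : (e + i.+1 + l <= n.+1)%N by rewrite addnS.
  (* By [ffall_shift] the right side is the basis element with i + 1 in place of i; it is divided by
     its eigenvalue i + 1 + l. *)
  exists (fun v u d => a / (i + l).+1%:R * v ^+ e * ffall u i.+1 * ffall d l).
    exact: nspan_mon.
  split=> [v|v u d]; first by rewrite -(ffall_shift 0) mul0r mulr0 mul0r.
  have du k w : w * (ffall w k - ffall (w - 1) k) = k%:R * ffall w k.
    by rewrite mulrBr ffall_shift ffallS; ring.
  transitivity (a / (i + l).+1%:R * v ^+ e *
     (u * (ffall u i.+1 - ffall (u - 1) i.+1) * ffall d l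
      + ffall u i.+1 * (d * (ffall d l - ffall (d - 1) l)))); first by ring.
  rewrite !du; transitivity (a * v ^+ e * (u * ffall (u - 1) i) * ffall d l); last by ring.
  rewrite ffall_shift; transitivity
    (a / (i + l).+1%:R * v ^+ e * ffall u i.+1 * ffall d l * (i.+1%:R + l%:R)); first by ring.
  have nz : (i + l).+1%:R != 0 :> rat by rewrite pnatr_eq0.
  by rewrite -natrD addSn; move: (_.+1%:R) nz => w nz; field.
- exists (fun v u d => q1 v u d + q2 v u d); first exact: nspan_add.
  split=> [v|v u d]; first by rewrite z1 z2 addr0.
  by rewrite [RHS]mulrDr -E1 -E2; ring.
- by exists q => //; split=> // v u d; rewrite eqg -E1.
Qed.

Definition polyfun n (f : nat -> rat) := exists2 p : {poly rat},
  (size p <= n)%N & forall nu, (0 < nu)%N -> f nu = p.[nu%:R].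

Lemma size_polyM_leS (p q : {poly rat}) a b :
  (size p <= a.+1)%N -> (size q <= b.+1)%N -> (size (p * q)%R <= (a + b).+1)%N.
Proof.
move=> sp sq; apply: leq_trans (size_polyMleq _ _) _.
by move: (size p) (size q) sp sq => x y; lia.
Qed.

(** The specialization u = nu, d = nu - 1 is that of [freud_polyS]; being affine in nu, it does not
    raise the degree. *)
Lemma polyfun_eval n f : nspan n f ->
  polyfun n.+1 (fun nu => f nu%:R nu%:R (nu%:R - 1)).
Proof.
pose P (f : rat -> rat) n := exists2 p : {poly rat}, (size p <= n)%N & forall q, f q = p.[q].
suff H : nspan n f -> P (fun q => f q q (q - 1)) n.+1.
  by case/H => p sp pE; exists p => // nu _.
elim=> {n f} [n e i l c le|n f g _ [p sp pE] _ [q sq qE]|n f g _ [p sp pE] eqg].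
- have Pffall (w : {poly rat}) k : size w = 2 ->
     exists2 p : {poly rat}, (size p <= k.+1)%N & forall q, ffall w.[q] k = p.[q].
    move=> sw; elim: k => [|k [p sp pE]].
      by exists 1; rewrite ?size_poly1 // => q; rewrite /ffall big_ord0 hornerE.
    exists (p * (w - k%:R%:P)); last by move=> q; rewrite ffallS pE !hornerE.
    rewrite (leq_trans (size_polyMleq _ _)) //.
    have : (size (w - k%:R%:P)%R <= 2)%N.
      by rewrite (leq_trans (size_polyD _ _)) // size_polyN sw geq_max size_polyC (leqW (leq_b1 _)).
    by move: sp; lia.
  have [p1 s1 E1] := Pffall 'X i (size_polyX _).
  have [p2 s2 E2] := Pffall ('X - 1%:P) l (size_XsubC _).
  exists (c *: 'X^e * p1 * p2).
    have s0 : (size (c *: 'X^e : {poly rat})%R <= e.+1)%N.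
      by rewrite (leq_trans (size_scale_leq _ _)) // size_polyXn.
    apply: leq_trans (size_polyM_leS (size_polyM_leS s0 s1) s2) _.
    exact: le.
  by move=> q; rewrite !hornerE -E1 -E2 !hornerE.
- exists (p + q); last by move=> x; rewrite pE qE hornerD.
  by rewrite (leq_trans (size_polyD _ _)) // geq_max sp.
- by exists p => // x; rewrite eqg pE.
Qed.

End NewtonSpan.

(** * Polynomiality in nu *)

Section Polynomiality.
Local Open Scope ring_scope.

Lemma ffall_nat n m : ffall n%:R m = (n ^_ m)%:R.
Proof.
elim: m => [|m IHm]; first by rewrite /ffall big_ord0.
rewrite ffallS IHm ffactnSr natrM; have [lemn|ltnm] := leqP m n.
  by rewrite natrB.
by rewrite ffact_small // !mul0r.
Qed.

Lemma bin_ffall n m : 'C(n, m)%:R = ffall n%:R m / m`!%:R.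
Proof.
by rewrite ffall_nat -bin_ffact natrM mulfK // pnatr_eq0 -lt0n fact_gt0.
Qed.

Lemma nspan_poly n (p : {poly rat}) : (size p <= n.+1)%N -> nspan n (fun v _ _ => p.[v]).
Proof.
move=> sp; have sF (i : 'I_n.+1) : nspan n (fun v _ _ => p`_i * v ^+ i).
  have le : (i + 0 + 0 <= n)%N by rewrite !addn0 -ltnS.
  apply: (nspan_ext (nspan_mon p`_i le)) => v u d.
  by rewrite /ffall !big_ord0 !mulr1.
apply: (nspan_ext (nspan_sum (index_enum 'I_n.+1) sF)) => v u d.
by rewrite (horner_coef_wide _ sp).
Qed.

Lemma nspan_exp n f k : nspan n f -> nspan (n * k) (fun v u d => f v u d ^+ k).
Proof.
move=> sf; elim: k => [|k IHk].
  rewrite muln0; exact: nspan_ext (nspan_const 0 1) _.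
by rewrite mulnS; apply: (nspan_ext (nspan_mul sf IHk)) => v u d; rewrite exprS.
Qed.

Lemma nspan_ffall f m : nspan 1 f -> nspan m (fun v u d => ffall (f v u d) m).
Proof.
move=> sf; elim: m => [|m IHm].
  by apply: (nspan_ext (nspan_const 0 1)) => v u d; rewrite /ffall big_ord0.
rewrite -addn1; apply: (nspan_ext (nspan_mul IHm (nspan_add sf (nspan_const 1 (- m%:R))))).
by move=> v u d; rewrite addn1 ffallS.
Qed.

Lemma nspan_v : nspan 1 (fun v _ _ => v).
Proof. by apply: (nspan_ext (nspan_mulv (nspan_const 0 1))) => v u d; rewrite mulr1. Qed.

Lemma nspan_height : nspan 1 (fun _ u d => u - d).
Proof.
have su := nspan_mulu (nspan_const 0 1); have sd := nspan_muld (nspan_const 0 1).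
by apply: (nspan_ext (nspan_add su (nspan_scale (-1) sd))) => v u d; ring.
Qed.

(** The binomial coefficient is the number of paths, and each power of t accounts for one factor
    [c nu]; q is the remaining factor, whose degree is to be bounded. *)
Definition gclass n a (F : nat -> nat -> nat -> rat) := exists2 q, nspan n q &
  forall nu u d, (0 < nu)%N ->
    F nu u d = (c nu)%:R ^+ a * 'C(u + d, u)%:R * q nu%:R u%:R d%:R.

Definition xclass n a (X : nat -> nat -> nat -> rat) := exists2 q, nspan n q &
  forall nu u d, (0 < nu)%N -> X nu u d = (c nu)%:R ^+ a * q nu%:R u%:R d%:R.

Lemma gclass_sum n a (I : Type) (s : seq I) (P : pred I) F :
  (forall i, P i -> gclass n a (F i)) ->
  gclass n a (fun nu u d => \sum_(i <- s | P i) F i nu u d).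
Proof.
move=> sF; elim: s => [|i s [q sq qE]].
  exists (fun _ _ _ => 0); first exact: nspan_const.
  by move=> nu u d _; rewrite big_nil mulr0.
have [Pi|nPi] := boolP (P i); last first.
  by exists q => // nu u d nu0; rewrite big_cons (negbTE nPi) qE.
have [q' sq' qE'] := sF i Pi; exists (fun v u d => q' v u d + q v u d).
  exact: nspan_add.
by move=> nu u d nu0; rewrite big_cons Pi qE // qE' // mulrDr.
Qed.

Lemma gclassM n a m b F X : gclass n a F -> xclass m b X ->
  gclass (n + m) (a + b) (fun nu u d => F nu u d * X nu u d).
Proof.
move=> [q sq qE] [x sx xE]; exists (fun v u d => q v u d * x v u d).
  exact: nspan_mul.
by move=> nu u d nu0; rewrite qE // xE // exprD; ring.
Qed.

Lemma xclass_sum n a (I : Type) (s : seq I) F : (forall i, xclass n a (F i)) ->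
  xclass n a (fun nu u d => \sum_(i <- s) F i nu u d).
Proof.
move=> sF; elim: s => [|i s [q sq qE]].
  exists (fun _ _ _ => 0); first exact: nspan_const.
  by move=> nu u d _; rewrite big_nil mulr0.
have [q' sq' qE'] := sF i; exists (fun v u d => q' v u d + q v u d).
  exact: nspan_add.
by move=> nu u d nu0; rewrite big_cons qE // qE' // mulrDr.
Qed.

Definition zpoly a k := exists2 p : {poly rat}, (size p <= 2 * k + a)%N &
  forall nu, (0 < nu)%N -> ztop nu a k = (c nu)%:R ^+ a * p.[nu%:R].

(** The degree is at most 2 l + a - 1 for the coefficient of y_a, k - l for the binomial
    coefficient, as a polynomial in nu, and k - l for the power of the height. *)
Lemma xclass_term a k l : (0 < a)%N -> (l <= k)%N -> zpoly a l ->
  xclass (2 * k + a.-1) a (fun nu u d =>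
    ztop nu a l * 'C(ydeg nu a - l, k - l)%:R * (u%:R - d%:R) ^+ (k - l)).
Proof.
move=> a_gt0 lelk [p sp pE].
have sz : (size p <= (2 * l + a.-1).+1)%N by apply: leq_trans sp _; lia.
have sb : nspan (k - l) (fun v _ _ =>
    ffall (a%:R * (v - 1) + (1 - l%:R)) (k - l) / (k - l)`!%:R).
  have s1 : nspan 1 (fun v _ _ => a%:R * (v - 1) + (1 - l%:R)).
    have sv := nspan_scale a%:R (nspan_add nspan_v (nspan_const 1 (-1))).
    exact: nspan_add sv (nspan_const 1 (1 - l%:R)).
  apply: (nspan_ext (nspan_scale ((k - l)`!%:R^-1) (nspan_ffall (k - l) s1))) => v u d.
  by rewrite mulrC.
have sh := nspan_exp (k - l) nspan_height.
exists (fun v u d => p.[v] * (ffall (a%:R * (v - 1) + (1 - l%:R)) (k - l) / (k - l)`!%:R)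
    * (u - d) ^+ (k - l)).
  apply: nspan_leq (nspan_mul (nspan_mul (nspan_poly sz) sb) sh).
  by lia.
(* For l above the degree bound the subtraction in the binomial coefficient is truncated and not
   polynomial in nu, but then both sides vanish with the leading coefficient. *)
move=> nu u d nu0; have [ltl|lel] := ltnP (ydeg nu a) l.
  have := pE nu nu0; rewrite ztop_small // => e; rewrite !mul0r.
  by transitivity (((c nu)%:R ^+ a * p.[nu%:R]) *
   ((ffall (a%:R * (nu%:R - 1) + (1 - l%:R)) (k - l) / (k - l)`!%:R)
    * (u%:R - d%:R) ^+ (k - l))); [rewrite -e mul0r | ring].
rewrite pE // bin_ffall.
have -> : (ydeg nu a - l)%N%:R = a%:R * (nu%:R - 1) + (1 - l%:R) :> rat.
  rewrite natrB // /ydeg -natr1 natrM -subn1 natrB //; ring.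
ring.
Qed.

(** For a = 0 the term is y_0(n) = n, so only k <= 1 occurs, and k = 1 gives the height, of degree 1
    = 2 k - 1. *)
Lemma xtop_class a k : (0 < 2 * k + a)%N ->
  (forall l, (0 < a)%N -> (l <= k)%N -> zpoly a l) ->
  xclass (2 * k + a).-1 a (fun nu u d => xtop nu a k (u%:R - d%:R)).
Proof.
case: a => [|a] ka_gt0 zP.
  exists (fun _ u d => 'C(1, k)%:R * (u - d) ^+ k).
    case: k ka_gt0 {zP} => [//|[|k]] _.
      by apply: (nspan_ext nspan_height) => v u d; rewrite mul1r.
    by apply: (nspan_ext (nspan_const _ 0)) => v u d; rewrite bin_small // mul0r.
  move=> nu u d nu0; rewrite /xtop big_ord_recl big1 ?addr0 => [|l _].
    by rewrite ztop0 /ydeg mul0n !subn0 expr0 /=; ring.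
  by rewrite ztop0 !mul0r.
rewrite addnS -[(_ + a)%N]/(_ + a.+1.-1)%N.
have term (l : 'I_k.+1) := xclass_term (ltn0Sn a) (ltn_ord l : (l <= k)%N)
  (zP l (ltn0Sn a) (ltn_ord l : (l <= k)%N)).
exact: (xclass_sum (index_enum 'I_k.+1) term).
Qed.

(** Once G is written as C0 times a binomial coefficient times q, multiplying the recursion by the
    sum of the two indices and dividing by the binomial coefficient leaves the difference equation
    for q. *)
Lemma pascal_solution (G : nat -> nat -> rat) (q f : rat -> rat -> rat) C0 :
  (forall d, G 0%N d = C0 * q 0 d%:R) ->
  (forall u d, G u.+1 d = G u d + C0 * 'C(u + d, u)%:R * f u%:R d%:R
     + (if d is d'.+1 then G u.+1 d' else 0)) ->
  (forall u d, u * (q u d - q (u - 1) d) + d * (q u d - q u (d - 1)) = u * f (u - 1) d) ->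
  forall u d, G u d = C0 * 'C(u + d, u)%:R * q u%:R d%:R.
Proof.
move=> G0 GS qE; elim=> [|u IHu] d; first by rewrite G0 bin0 mulr1.
have step d' (X : rat) :
    d'%:R * 'C(u.+1 + d', u.+1)%:R * (C0 * q u.+1%:R (d'%:R - 1)) = (u.+1 + d')%:R * X ->
    C0 * 'C(u + d', u)%:R * q u%:R d'%:R + C0 * 'C(u + d', u)%:R * f u%:R d'%:R + X =
    C0 * 'C(u.+1 + d', u.+1)%:R * q u.+1%:R d'%:R.
  move=> XE; have nz : (u.+1 + d')%:R != 0 :> rat by rewrite pnatr_eq0.
  apply: (mulfI nz); rewrite !mulrDr -XE.
  have bE : (u.+1 + d')%:R * 'C(u + d', u)%:R = u.+1%:R * 'C(u.+1 + d', u.+1)%:R :> rat.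
    by rewrite -!natrM -mul_bin_diag addSn.
  have := qE u.+1%:R d'%:R; rewrite -[in X in X - 1]natr1 addrK => e.
  transitivity (C0 * ((u.+1 + d')%:R * 'C(u + d', u)%:R) * q u%:R d'%:R +
    C0 * ((u.+1 + d')%:R * 'C(u + d', u)%:R) * f u%:R d'%:R +
    d'%:R * 'C(u.+1 + d', u.+1)%:R * (C0 * q u.+1%:R (d'%:R - 1))); first by ring.
  rewrite bE natrD.
  transitivity (C0 * 'C(u.+1 + d', u.+1)%:R * (u.+1%:R * q u%:R d'%:R +
    u.+1%:R * f u%:R d'%:R + d'%:R * q u.+1%:R (d'%:R - 1))); first by ring.
  by rewrite -e; ring.
elim: d => [|d IHd]; rewrite GS IHu.
  by apply: step; rewrite !mul0r mulr0.
apply: step; rewrite IHd -[in X in X - 1]natr1 addrK.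
have bE : d.+1%:R * 'C(u.+1 + d.+1, u.+1)%:R = (u.+1 + d.+1)%:R * 'C(u.+1 + d, u.+1)%:R :> rat.
  rewrite -!natrM -(@bin_sub _ u.+1) ?leq_addr // addKn -mul_bin_diag addnS.
  by rewrite -bin_sub ?leq_addl // addnK.
by rewrite mulrA [d.+1%:R * _]bE; ring.
Qed.

(** Lexicographic induction on the order in t and the index k. In [gtopS] the pair (0, 0) gives the
    previous path sum; each other pair involves smaller indices and has degree at most 2 k + b - 1,
    to which [nspan_solve] adds 1. *)
Lemma gtop_class a k :
  (forall b l, (0 < b <= a)%N -> zpoly b l) ->
  gclass (2 * k + a) a (fun nu u d => gtop nu a k u d).
Proof.
move=> zP.
suff H b : (b <= a)%N -> forall k, gclass (2 * k + b) b (fun nu u d => gtop nu b k u d).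
  exact: H.
elim/ltn_ind: b => b IHb leba {}k; elim/ltn_ind: k => k IHk.
pose good (x : 'I_b.+1 * 'I_k.+1) := (0 < 2 * x.2 + x.1)%N.
pose S nu u d := \sum_(x : 'I_b.+1 * 'I_k.+1 | good x)
  gtop nu (b - x.1) (k - x.2) u d * xtop nu x.1 x.2 (u%:R - d%:R).
have SE nu u d : (0 < nu)%N -> gtop nu b k u.+1 d = gtop nu b k u d + S nu u d
    + (if d is d'.+1 then gtop nu b k u.+1 d' else 0).
  move=> nu0; rewrite gtopS //; congr (_ + _); rewrite pair_big /=.
  rewrite (bigD1 (ord0, ord0)) //= !subn0; congr (_ + _).
    by rewrite /xtop big_ord1 ztop0 bin0 !mulr1.
  apply: eq_bigl => -[x y]; rewrite /good /=.
  by rewrite -[(x, y) == _]/((x == ord0) && (y == ord0)) -!val_eqE /=; lia.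
have S_class : gclass (2 * k + b).-1 b S.
  apply: gclass_sum => -[x y]; rewrite /good /= => gx.
  have lex : (x <= b)%N by rewrite -ltnS.
  have ley : (y <= k)%N by rewrite -ltnS.
  have xc : xclass (2 * y + x).-1 x (fun nu u d => xtop nu x y (u%:R - d%:R)).
    by apply: xtop_class => // l x_gt0 _; apply: zP; rewrite x_gt0 (leq_trans lex).
  have gc : gclass (2 * (k - y) + (b - x)) (b - x) (fun nu u d => gtop nu (b - x) (k - y) u d).
    have [x0|x_gt0] := posnP x; first by rewrite x0 subn0; apply: IHk; lia.
    by apply: IHb; [lia | apply: leq_trans leba; apply: leq_subr].
  have := gclassM gc xc; rewrite subnK //.
  by rewrite (_ : (2 * (k - y) + (b - x) + (2 * y + x).-1 = (2 * k + b).-1)%N) //; lia.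
have G0E nu d : gtop nu b k 0 d = ((b == 0%N) && (k == 0%N))%:R by rewrite gtop0.
have [f sf fE] := S_class.
have [q sq [q0 qE]] := nspan_solve ((b == 0%N) && (k == 0%N))%:R sf.
have q0d v d : q v 0 d%:R = ((b == 0%N) && (k == 0%N))%:R.
  elim: d => [|d IHd]; first exact: q0.
  have := qE v 0 d.+1%:R; rewrite !mul0r add0r -[in X in X - 1]natr1 addrK => /eqP.
  by rewrite mulf_eq0 pnatr_eq0 /= subr_eq0 => /eqP ->.
have c0 nu : (c nu)%:R ^+ b * ((b == 0%N) && (k == 0%N))%:R =
    ((b == 0%N) && (k == 0%N))%:R :> rat.
  by case: b {IHb leba IHk S S_class SE G0E f sf fE q sq q0 qE q0d good} => [|b];
    rewrite ?mul1r ?mulr0.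
have sol nu u d : (0 < nu)%N ->
    gtop nu b k u d = (c nu)%:R ^+ b * 'C(u + d, u)%:R * q nu%:R u%:R d%:R.
  move=> nu0; apply: (pascal_solution (q := q nu%:R) (f := f nu%:R)) => [d'|u' d'|u' d'].
  - by rewrite G0E q0d c0.
  - by rewrite SE // fE.
  - exact: qE.
(* For k = b = 0 the predecessor is truncated and [nspan_solve] only gives degree 1; there the path
   sum is the bare binomial coefficient. *)
have [e0|pos] := posnP (2 * k + b)%N; last first.
  by rewrite -[(2 * k + b)%N]prednK //; exists q.
exists (fun _ _ _ => 1); first exact: nspan_const.
have S0 nu u d : S nu u d = 0.
  rewrite /S big1 // => -[x y]; rewrite /good /= => gx.
  by have := ltn_ord x; have := ltn_ord y; lia.
have [eb ek] : b = 0%N /\ k = 0%N by lia.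
move=> nu u d nu0; rewrite mulr1; subst b k; rewrite mul1r.
elim: u d => [|u IHu] d; first by rewrite G0E bin0.
elim: d => [|d IHd]; rewrite SE // S0 addr0 IHu ?addr0.
  by rewrite !addn0 !binn.
by rewrite IHd addSnnS [(u.+1 + _)%N]addSn binS natrD addrC.
Qed.

Lemma c_gt0 nu : (0 < nu)%N -> (0 < c nu)%N.
Proof. by move=> nu0; rewrite /c !muln_gt0 nu0 bin_gt0; lia. Qed.

Lemma bin_c nu : (0 < nu)%N -> (2 * nu * 'C(nu + nu.-1, nu) = c nu)%N.
Proof.
move=> nu0; rewrite /c; congr (_ * _)%N.
rewrite -[in RHS]bin_sub; last by lia.
by congr 'C(_, _); lia.
Qed.

(** By induction on a: in [ztopS] the factor 2 nu and the number C(2 nu - 1, nu) of paths combine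
    into one more factor [c nu]. *)
Lemma zpoly_all a k : (0 < a)%N -> zpoly a k.
Proof.
elim/ltn_ind: a k => -[//|a] IHa k _.
have [|q sq /= qE] := @gtop_class a k.
  by move=> b l /andP[b0 leb]; apply: IHa.
have [p sp pE] := polyfun_eval sq; exists p; first by rewrite addnS.
move=> nu nu0; rewrite ztopS // qE // -pE //.
have -> : nu.-1%:R = nu%:R - 1 :> rat by rewrite -subn1 natrB.
transitivity (((2 * nu)%:R * 'C(nu + nu.-1, nu)%:R) * (c nu)%:R ^+ a *
  q nu%:R nu%:R (nu%:R - 1)); first by ring.
by rewrite -natrM bin_c // exprS.
Qed.

End Polynomiality.

(** * Integer tables *)

Section PascalTable.
Variables (A : Type) (st : nat -> nat -> A -> A) (add : A -> A -> A) (zero one : A).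

Fixpoint pascal_array (u : nat) : nat -> A :=
  if u is u'.+1 then
    fix aux d := add (st u' d (pascal_array u' d)) (if d is d'.+1 then aux d' else zero)
  else fun=> one.

Lemma pascal_arrayS u d : pascal_array u.+1 d =
  add (st u d (pascal_array u d)) (if d is d'.+1 then pascal_array u.+1 d' else zero).
Proof. by case: d. Qed.

(** Whole rows are computed, each cell once, whereas the recursion of [pascal_array] follows every
    lattice path. *)
Fixpoint nextrow (u d : nat) (prev : A) (row : seq A) : seq A :=
  if row is c :: rest then
    let new := add (st u d c) prev in new :: nextrow u d.+1 new rest
  else [::].

(** Row u + 1 is read at u: this is the cell (nu, nu - 1) for nu = u + 1. *)
Fixpoint diagonal (u n : nat) (row : seq A) : seq A :=
  if n is n'.+1 then
    let row' := nextrow u 0 zero row in nth zero row' u :: diagonal u.+1 n' row'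
  else [::].

Lemma nextrowE u n d : nextrow u d (if d is d'.+1 then pascal_array u.+1 d' else zero)
    [seq pascal_array u k | k <- iota d n] = [seq pascal_array u.+1 k | k <- iota d n].
Proof.
elim: n d => [//|n IHn] d; rewrite [iota d n.+1]/= !map_cons.
by rewrite [LHS]/= -pascal_arrayS (IHn d.+1).
Qed.

Lemma diagonalE u n N : u + n <= N ->
  diagonal u n [seq pascal_array u k | k <- iota 0 N] = [seq pascal_array k.+1 k | k <- iota u n].
Proof.
elim: n u => [//|n IHn] u le /=; rewrite (nextrowE u N 0).
by rewrite (nth_map 0) ?size_iota ?nth_iota // ?IHn //; lia.
Qed.

End PascalTable.

(** * Integer arithmetic and truncated tables *)

Section Zarith.
Local Open Scope ring_scope.

Lemma ratZE z : ratZ z = (int_of_Z z)%:~R. Proof. by rewrite unlock. Qed.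

Lemma ratZD x y : ratZ (Z.add x y) = ratZ x + ratZ y.
Proof. by rewrite !ratZE -rmorphD; congr _%:~R; apply: (rmorphD int_of_Z). Qed.

Lemma ratZM x y : ratZ (Z.mul x y) = ratZ x * ratZ y.
Proof. by rewrite !ratZE -rmorphM; congr _%:~R; apply: (rmorphM int_of_Z). Qed.

Lemma ratZN x : ratZ (Z.opp x) = - ratZ x.
Proof. by rewrite !ratZE -rmorphN; congr _%:~R; apply: (rmorphN int_of_Z). Qed.

Lemma ratZB x y : ratZ (Z.sub x y) = ratZ x - ratZ y.
Proof. by rewrite -ratZN -ratZD. Qed.

Lemma ratZ0 : ratZ 0 = 0. Proof. by rewrite ratZE. Qed.
Lemma ratZ1 : ratZ 1 = 1. Proof. by rewrite ratZE. Qed.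

Lemma ratZ_nat n : ratZ (Z.of_nat n) = n%:R.
Proof.
elim: n => [|n IHn]; first exact: ratZ0.
by rewrite Nat2Z.inj_succ -Z.add_1_r ratZD IHn ratZ1 natr1.
Qed.

Lemma ratZ_eq0 z : (ratZ z == 0) = (z == Z0).
Proof.
rewrite ratZE intr_eq0 -(inj_eq (can_inj int_of_ZK)).
by rewrite (_ : int_of_Z Z0 = 0).
Qed.

Fixpoint sumZ (f : nat -> Z) (n : nat) : Z :=
  if n is n'.+1 then Z.add (sumZ f n') (f n') else Z0.

Lemma ratZ_sum f n : ratZ (sumZ f n) = \sum_(i < n) ratZ (f i).
Proof.
elim: n => [|n IHn]; first by rewrite big_ord0 ratZ0.
by rewrite big_ord_recr /= ratZD IHn.
Qed.

Fixpoint addl (p q : seq Z) : seq Z :=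
  match p, q with a :: p', b :: q' => Z.add a b :: addl p' q' | _, _ => [::] end.

(** For c = 0 this is multiplication by 1 + h X, the reversal of n + h; c is the carry from the
    preceding coefficient. *)
Fixpoint mulX (h c : Z) (p : seq Z) : seq Z :=
  if p is a :: p' then Z.add a c :: mulX h (Z.mul h a) p' else [::].

Definition drop_last (T : Type) (p : seq T) := take (size p).-1 p.

Definition at1 (p : seq Z) k : rat := ratZ (nth Z0 p k).

Lemma size_addl p q : size p = size q -> size (addl p q) = size p.
Proof. by elim: p q => [|a p IHp] [|b q] //= [/IHp ->]. Qed.

Lemma at1_addl p q k : size p = size q -> at1 (addl p q) k = at1 p k + at1 q k.
Proof.
elim: p q k => [|a p IHp] [|b q] // k; first by rewrite /at1 !nth_nil ratZ0 addr0.
by case=> /IHp {}IHp; case: k => [|k]; [rewrite /at1 /= ratZD | apply: IHp].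
Qed.

Lemma size_mulX h c p : size (mulX h c p) = size p.
Proof. by elim: p c => //= a p IHp c; rewrite IHp. Qed.

Lemma at1_mulX h c p k : (k < size p)%N -> at1 (mulX h c p) k =
  at1 p k + (if k is k'.+1 then ratZ h * at1 p k' else ratZ c).
Proof.
elim: p c k => [//|a p IHp] c [|k] ltk; first by rewrite /at1 /= ratZD.
have := IHp (Z.mul h a) k ltk; rewrite /at1 /= => ->.
by case: k {ltk} => [|k] //=; rewrite ratZM.
Qed.

Definition at2 (f : seq (seq Z)) m k := at1 (nth [::] f m) k.
Definition at3 (s : seq (seq (seq Z))) m1 m2 k := at2 (nth [::] s m1) m2 k.

(* [tri] and [tri3] describe tables truncated to the indices of sum less than n. *)
Definition tri n (f : seq (seq Z)) :=
  size f = n /\ forall m, (m < n)%N -> size (nth [::] f m) = (n - m)%N.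
Definition tri3 n (s : seq (seq (seq Z))) :=
  size s = n /\ forall m, (m < n)%N -> tri (n - m) (nth [::] s m).

Fixpoint add2 (p q : seq (seq Z)) : seq (seq Z) :=
  match p, q with a :: p', b :: q' => addl a b :: add2 p' q' | _, _ => [::] end.
Fixpoint add3 (p q : seq (seq (seq Z))) : seq (seq (seq Z)) :=
  match p, q with a :: p', b :: q' => add2 a b :: add3 p' q' | _, _ => [::] end.

Lemma nth_add2 p q m : size p = size q ->
  size (add2 p q) = size p /\ nth [::] (add2 p q) m = addl (nth [::] p m) (nth [::] q m).
Proof.
elim: p q m => [|a p IHp] [|b q] // m; first by rewrite /= nth_nil.
case=> /IHp {}IHp; case: m => [|m] /=; first by have [-> _] := IHp 0%N.
by have [-> e] := IHp m.
Qed.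

Lemma nth_add3 p q m : size p = size q ->
  size (add3 p q) = size p /\ nth [::] (add3 p q) m = add2 (nth [::] p m) (nth [::] q m).
Proof.
elim: p q m => [|a p IHp] [|b q] // m; first by rewrite /= nth_nil.
case=> /IHp {}IHp; case: m => [|m] /=; first by have [-> _] := IHp 0%N.
by have [-> e] := IHp m.
Qed.

Lemma tri_add n p q : tri n p -> tri n q -> tri n (add2 p q) /\
  forall m k, (m < n)%N -> at2 (add2 p q) m k = at2 p m k + at2 q m k.
Proof.
move=> [sp pP] [sq qP]; have e : size p = size q by rewrite sp sq.
split=> [|m k ltm]; last by rewrite /at2 (nth_add2 m e).2 at1_addl // pP ?qP.
split; first by rewrite (nth_add2 0 e).1.
by move=> m ltm; rewrite (nth_add2 m e).2 size_addl pP ?qP.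
Qed.

Lemma tri3_add n p q : tri3 n p -> tri3 n q -> tri3 n (add3 p q) /\
  forall m1 m2 k, (m1 + m2 < n)%N -> at3 (add3 p q) m1 m2 k = at3 p m1 m2 k + at3 q m1 m2 k.
Proof.
move=> [sp pP] [sq qP]; have e : size p = size q by rewrite sp sq.
split=> [|m1 m2 k ltm].
  split; first by rewrite (nth_add3 0 e).1.
  by move=> m ltm; rewrite (nth_add3 m e).2; have [] := tri_add (pP m ltm) (qP m ltm).
have lt1 : (m1 < n)%N by lia.
by rewrite /at3 (nth_add3 m1 e).2 (tri_add (pP _ lt1) (qP _ lt1)).2 //; lia.
Qed.

Definition mulX2 h := map (mulX h Z0).
Definition mulX3 h := map (mulX2 h).

Lemma tri_mulX n h f : tri n f -> tri n (mulX2 h f) /\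
  forall m k, (m + k < n)%N -> at2 (mulX2 h f) m k =
    at2 f m k + (if k is k'.+1 then ratZ h * at2 f m k' else 0).
Proof.
move=> [sf fP]; split=> [|m k ltmk].
  split; first by rewrite size_map.
  by move=> m ltm; rewrite (nth_map [::]) ?sf // size_mulX fP.
have ltm : (m < n)%N by lia.
by rewrite /at2 (nth_map [::]) ?sf // at1_mulX ?fP ?ratZ0 //; lia.
Qed.

Lemma tri3_mulX n h s : tri3 n s -> tri3 n (mulX3 h s) /\
  forall m1 m2 k, (m1 + m2 + k < n)%N -> at3 (mulX3 h s) m1 m2 k =
    at3 s m1 m2 k + (if k is k'.+1 then ratZ h * at3 s m1 m2 k' else 0).
Proof.
move=> [ss sP]; split=> [|m1 m2 k ltmk].
  split; first by rewrite size_map.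
  by move=> m ltm; rewrite (nth_map [::]) ?ss //; have [] := tri_mulX h (sP m ltm).
have ltm : (m1 < n)%N by lia.
by rewrite /at3 (nth_map [::]) ?ss // (tri_mulX h (sP _ ltm)).2 //; lia.
Qed.

Definition scaleZ h := map (Z.mul h).

Fixpoint pows1 n (h : Z) (p : seq Z) : seq (seq Z) :=
  if n is n'.+1 then p :: pows1 n' h (scaleZ h (drop_last p)) else [::].

Fixpoint pows2 n (h : Z) (f : seq (seq Z)) : seq (seq (seq Z)) :=
  if n is n'.+1 then f :: pows2 n' h (map (fun p => scaleZ h (drop_last p)) (drop_last f)) else [::].

Lemma size_drop_last (T : Type) (p : seq T) : size (drop_last p) = (size p).-1.
Proof. by rewrite size_take; case: (size p) => //= n; rewrite ltnSn. Qed.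

Lemma at1_scale_drop_last h p k : (k.+1 < size p)%N ->
  at1 (scaleZ h (drop_last p)) k = ratZ h * at1 p k.
Proof.
move=> lt; rewrite /at1 (nth_map Z0) ?size_drop_last ?ratZM ?nth_take //; lia.
Qed.

Lemma tri_pows n h p : size p = n -> tri n (pows1 n h p) /\
  forall m k, (m + k < n)%N -> at2 (pows1 n h p) m k = ratZ h ^+ m * at1 p k.
Proof.
elim: n p => [|n IHn] p sp; first by split=> //; split.
have sc : size (scaleZ h (drop_last p)) = n by rewrite size_map size_drop_last sp.
have [[s1 t1] a1] := IHn _ sc; split=> [|[|m] k lt].
- by split=> [|[|m] ltm] /=; rewrite ?s1 ?sp ?t1.
- by rewrite mul1r.
rewrite /at2 /= -/(at2 _ _ _) a1; last by lia.
by rewrite at1_scale_drop_last ?sp ?exprSr ?mulrA //; lia.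
Qed.

Lemma tri3_pows n h f : tri n f -> tri3 n (pows2 n h f) /\
  forall m1 m2 k, (m1 + m2 + k < n)%N ->
    at3 (pows2 n h f) m1 m2 k = ratZ h ^+ m1 * at2 f m2 k.
Proof.
elim: n f => [|n IHn] f tf; first by split=> //; split.
have [sf fP] := tf.
have nthc m : (m < n)%N -> nth [::] (map (fun p => scaleZ h (drop_last p)) (drop_last f)) m =
    scaleZ h (drop_last (nth [::] f m)).
  by move=> ltm; rewrite (nth_map [::]) ?size_drop_last ?sf // nth_take // sf.
have tc : tri n (map (fun p => scaleZ h (drop_last p)) (drop_last f)).
  split; first by rewrite size_map size_drop_last sf.
  by move=> m ltm; rewrite nthc // size_map size_drop_last fP //; lia.
have [[s1 t1] a1] := IHn _ tc; split=> [|[|m] m2 k lt].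
- by split=> [|[|m] ltm] /=; rewrite ?s1 ?subn0 //; apply: t1.
- by rewrite mul1r.
rewrite /at3 /= -/(at3 _ _ _ _) a1; last by lia.
rewrite /at2 nthc ?at1_scale_drop_last ?exprSr ?mulrA //; last by lia.
by rewrite fP; lia.
Qed.

(* A cell (u, d) holds the top coefficients of the path sums in which no (g), one (f) or
   two (s) of the weights x are replaced by a later term y_b, b > 0, of their series.
   Such a replacement at height h contributes only h^m, for all m; the top coefficients
   of y_b, which depend on nu, are inserted by [contr].  One table thus serves for all
   nu. *)
Definition cell := (seq Z * seq (seq Z) * seq (seq (seq Z)))%type.

(* Genus at most 5 requires the top coefficients of index up to 10. *)
Definition trunc_order := 11%N.

(** The weight at height h is either y_0, i.e. a factor 1 + h X, or a later term, which moves g to f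
    and f to s and is recorded by the powers of h. *)
Definition cell_step (u d : nat) (c : cell) : cell :=
  let: (g, f, s) := c in
  let h := Z.sub (Z.of_nat u) (Z.of_nat d) in
  (mulX h Z0 g, add2 (mulX2 h f) (pows1 trunc_order h g),
    add3 (mulX3 h s) (pows2 trunc_order h f)).

Definition cell_add (c c' : cell) : cell :=
  let: (g, f, s) := c in let: (g', f', s') := c' in (addl g g', add2 f f', add3 s s').

Definition zeros n : seq Z := nseq n Z0.
Definition zeros2 n := [seq zeros (n - m) | m <- iota 0 n].
Definition zeros3 n := [seq zeros2 (n - m) | m <- iota 0 n].

Definition cell_zero : cell := (zeros trunc_order, zeros2 trunc_order, zeros3 trunc_order).
Definition cell_one : cell :=
  (Zpos xH :: zeros trunc_order.-1, zeros2 trunc_order, zeros3 trunc_order).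

Definition shaped (c : cell) :=
  [/\ size c.1.1 = trunc_order, tri trunc_order c.1.2 & tri3 trunc_order c.2].

Lemma tri_zeros n : tri n (zeros2 n).
Proof.
split=> [|m ltm]; first by rewrite size_map size_iota.
by rewrite (nth_map 0%N) ?size_iota // nth_iota // size_nseq.
Qed.

Lemma tri3_zeros n : tri3 n (zeros3 n).
Proof.
split=> [|m ltm]; first by rewrite size_map size_iota.
by rewrite (nth_map 0%N) ?size_iota // nth_iota //; apply: tri_zeros.
Qed.

Lemma at2_zeros n m k : at2 (zeros2 n) m k = 0.
Proof.
rewrite /at2 /at1; have [ltm|lem] := ltnP m n.
  by rewrite (nth_map 0%N) ?size_iota // nth_iota // nth_nseq if_same ratZ0.
by rewrite (nth_default [::]) ?size_map ?size_iota // nth_nil ratZ0.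
Qed.

Lemma at3_zeros n m1 m2 k : at3 (zeros3 n) m1 m2 k = 0.
Proof.
rewrite /at3; have [ltm|lem] := ltnP m1 n.
  by rewrite (nth_map 0%N) ?size_iota // nth_iota // at2_zeros.
by rewrite (nth_default [::]) ?size_map ?size_iota // /at2 /at1 !nth_nil ratZ0.
Qed.

Definition cells := pascal_array cell_step cell_add cell_zero cell_one.

Definition cG u d k := at1 (cells u d).1.1 k.
Definition cF u d m k := at2 (cells u d).1.2 m k.
Definition cS u d m1 m2 k := at3 (cells u d).2 m1 m2 k.

Lemma shaped_step u d c : shaped c -> shaped (cell_step u d c).
Proof.
case: c => -[g f] s [sg tf ts]; split; first by rewrite /= size_mulX.
  exact: (tri_add (tri_mulX _ tf).1 (tri_pows _ sg).1).1.
exact: (tri3_add (tri3_mulX _ ts).1 (tri3_pows _ tf).1).1.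
Qed.

Lemma shaped_add c c' : shaped c -> shaped c' -> shaped (cell_add c c').
Proof.
case: c => -[g f] s [sg tf ts]; case: c' => -[g' f'] s' [sg' tf' ts']; split=> /=.
- by rewrite size_addl ?sg ?sg'.
- exact: (tri_add tf tf').1.
- exact: (tri3_add ts ts').1.
Qed.

Lemma shaped_zero : shaped cell_zero.
Proof. by split; [rewrite size_nseq | apply: tri_zeros | apply: tri3_zeros]. Qed.

Lemma shaped_cells u d : shaped (cells u d).
Proof.
elim: u d => [|u IHu] d; first by split; [|apply: tri_zeros|apply: tri3_zeros].
elim: d => [|d IHd]; rewrite /cells pascal_arrayS; apply: shaped_add; try exact: shaped_step.
  exact: shaped_zero.
exact: IHd.
Qed.

Lemma shaped_prev u d : shaped (if d is d'.+1 then cells u.+1 d' else cell_zero).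
Proof. by case: d => [|d]; [apply: shaped_zero | apply: shaped_cells]. Qed.

Lemma cell_step_at u d c : shaped c -> let h : rat := u%:R - d%:R in
  [/\ forall k, (k < trunc_order)%N -> at1 (cell_step u d c).1.1 k =
        at1 c.1.1 k + (if k is k'.+1 then h * at1 c.1.1 k' else 0),
      forall m k, (m + k < trunc_order)%N -> at2 (cell_step u d c).1.2 m k =
        at2 c.1.2 m k + (if k is k'.+1 then h * at2 c.1.2 m k' else 0) + h ^+ m * at1 c.1.1 k
    & forall m1 m2 k, (m1 + m2 + k < trunc_order)%N -> at3 (cell_step u d c).2 m1 m2 k =
        at3 c.2 m1 m2 k + (if k is k'.+1 then h * at3 c.2 m1 m2 k' else 0)
        + h ^+ m1 * at2 c.1.2 m2 k].
Proof.
case: c => -[g f] s [sg tf ts] h.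
have hE : ratZ (Z.sub (Z.of_nat u) (Z.of_nat d)) = h by rewrite ratZB !ratZ_nat.
split=> [k ltk|m k lt|m1 m2 k lt]; rewrite /cell_step /=.
- by rewrite at1_mulX ?sg // hE ratZ0.
- have [tm am] := tri_mulX (Z.sub (Z.of_nat u) (Z.of_nat d)) tf.
  have [tp ap] := tri_pows (Z.sub (Z.of_nat u) (Z.of_nat d)) sg.
  by rewrite (tri_add tm tp).2 ?am ?ap ?hE //; lia.
have [tm am] := tri3_mulX (Z.sub (Z.of_nat u) (Z.of_nat d)) ts.
have [tp ap] := tri3_pows (Z.sub (Z.of_nat u) (Z.of_nat d)) tf.
by rewrite (tri3_add tm tp).2 ?am ?ap ?hE //; lia.
Qed.

Lemma cell_add_at c c' : shaped c -> shaped c' ->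
  [/\ forall k, at1 (cell_add c c').1.1 k = at1 c.1.1 k + at1 c'.1.1 k,
      forall m k, (m < trunc_order)%N -> at2 (cell_add c c').1.2 m k = at2 c.1.2 m k + at2 c'.1.2 m k
    & forall m1 m2 k, (m1 + m2 < trunc_order)%N ->
        at3 (cell_add c c').2 m1 m2 k = at3 c.2 m1 m2 k + at3 c'.2 m1 m2 k].
Proof.
case: c => -[g f] s [sg tf ts]; case: c' => -[g' f'] s' [sg' tf' ts'].
split=> [k|m k lt|m1 m2 k lt] /=.
- by rewrite at1_addl // sg sg'.
- exact: (tri_add tf tf').2.
- exact: (tri3_add ts ts').2.
Qed.

Lemma cGS u d k : (k < trunc_order)%N -> cG u.+1 d k =
  cG u d k + (if k is k'.+1 then (u%:R - d%:R) * cG u d k' else 0)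
  + (if d is d'.+1 then cG u.+1 d' k else 0).
Proof.
move=> ltk; rewrite /cG /cells pascal_arrayS -/cells.
have [a1 _ _] := cell_add_at (shaped_step u d (shaped_cells u d)) (shaped_prev u d).
have [s1 _ _] := cell_step_at u d (shaped_cells u d).
rewrite a1 s1 //; congr (_ + _); case: d {a1 s1} => // ; rewrite /at1 nth_nseq if_same ratZ0 //.
Qed.

Lemma cFS u d m k : (m + k < trunc_order)%N -> cF u.+1 d m k =
  cF u d m k + (if k is k'.+1 then (u%:R - d%:R) * cF u d m k' else 0)
  + (u%:R - d%:R) ^+ m * cG u d k + (if d is d'.+1 then cF u.+1 d' m k else 0).
Proof.
move=> lt; rewrite /cF /cells pascal_arrayS -/cells.
have [_ a2 _] := cell_add_at (shaped_step u d (shaped_cells u d)) (shaped_prev u d).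
have [_ s2 _] := cell_step_at u d (shaped_cells u d).
rewrite a2 ?s2 //; last by lia.
by congr (_ + _); case: d {a2 s2} => //; rewrite at2_zeros.
Qed.

Lemma cSS u d m1 m2 k : (m1 + m2 + k < trunc_order)%N -> cS u.+1 d m1 m2 k =
  cS u d m1 m2 k + (if k is k'.+1 then (u%:R - d%:R) * cS u d m1 m2 k' else 0)
  + (u%:R - d%:R) ^+ m1 * cF u d m2 k + (if d is d'.+1 then cS u.+1 d' m1 m2 k else 0).
Proof.
move=> lt; rewrite /cS /cells pascal_arrayS -/cells.
have [_ _ a3] := cell_add_at (shaped_step u d (shaped_cells u d)) (shaped_prev u d).
have [_ _ s3] := cell_step_at u d (shaped_cells u d).
rewrite a3 ?s3 //; last by lia.
by congr (_ + _); case: d {a3 s3} => //; rewrite at3_zeros.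
Qed.

End Zarith.

Section Contraction.
Local Open Scope ring_scope.
Variable nu : nat.
Hypothesis nu_gt0 : (0 < nu)%N.

(** Inserts y_b at a marked step: [A m r] holds the part of index r weighted by h^m, and by
    [contr_pow] the coefficients are those of [xtop]. *)
Definition contr b (A : nat -> nat -> rat) k : rat :=
  \sum_(i < k.+1) \sum_(l < i.+1)
    ztop nu b l * 'C(ydeg nu b - l, i - l)%:R * A (i - l)%N (k - i)%N.

Lemma eq_contr b A B k : (forall m r, (m + r <= k)%N -> A m r = B m r) ->
  contr b A k = contr b B k.
Proof.
move=> eqAB; apply: eq_bigr => i _; apply: eq_bigr => l _; rewrite eqAB //.
by have := ltn_ord i; have := ltn_ord l; lia.
Qed.

Lemma contrD b A B k : contr b (fun m r => A m r + B m r) k = contr b A k + contr b B k.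
Proof.
rewrite -big_split; apply: eq_bigr => i _; rewrite -big_split; apply: eq_bigr => l _ /=.
by rewrite mulrDr.
Qed.

Lemma contr0 b k : contr b (fun _ _ => 0) k = 0.
Proof. by rewrite /contr big1 // => i _; rewrite big1 // => l _; rewrite mulr0. Qed.

Lemma contr_shift b A h k :
  contr b (fun m r => if r is r'.+1 then h * A m r' else 0) k =
  if k is k'.+1 then h * contr b A k' else 0.
Proof.
rewrite /contr big_ord_recr /= subnn [X in _ + X]big1 ?addr0 => [|l _]; last by rewrite mulr0.
case: k => [|k]; first by rewrite big_ord0.
rewrite mulr_sumr; apply: eq_bigr => i _; rewrite mulr_sumr; apply: eq_bigr => l _.
have lei : (i <= k)%N by rewrite -ltnS.
by rewrite subSn //; ring.
Qed.

Lemma contr_scale b A a k : contr b (fun m r => a * A m r) k = a * contr b A k.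
Proof.
rewrite mulr_sumr; apply: eq_bigr => i _; rewrite mulr_sumr; apply: eq_bigr => l _.
by ring.
Qed.

Lemma contr_pow b B h k : contr b (fun m r => h ^+ m * B r) k =
  \sum_(i < k.+1) B (k - i)%N * xtop nu b i h.
Proof.
apply: eq_bigr => i _; rewrite /xtop mulr_sumr; apply: eq_bigr => l _; ring.
Qed.

Lemma sum_xtop0 (B : nat -> rat) h k : \sum_(i < k.+1) B (k - i)%N * xtop nu 0 i h =
  B k + (if k is k'.+1 then h * B k' else 0).
Proof.
have x0 i : xtop nu 0 i h = 'C(1, i)%:R * h ^+ i.
  rewrite /xtop big_ord_recl big1 ?addr0 => [|l _]; last by rewrite ztop0 !mul0r.
  by rewrite ztop0 /ydeg mul0n !subn0 mul1r.
rewrite big_ord_recl subn0 x0 bin0 !mulr1; congr (_ + _).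
case: k => [|k]; first by rewrite big_ord0.
rewrite big_ord_recl big1 ?addr0 => [|i _]; last by rewrite x0 bin_small // mul0r mulr0.
by rewrite x0 binn mul1r mulrC subn1.
Qed.

Lemma cG0 d k : cG 0 d k = (k == 0%N)%:R.
Proof.
rewrite /cG /at1; case: k => [|k]; first exact: ratZ1.
by rewrite -[nth _ _ _]/(nth Z0 (nseq trunc_order.-1 Z0) k) nth_nseq if_same ratZ0.
Qed.

Lemma gtop_cG k u d : (k < trunc_order)%N -> gtop nu 0 k u d = cG u d k.
Proof.
elim: u d k => [|u IHu] d k ltk; first by rewrite gtop0 cG0.
have main d' : \sum_(b < 1) \sum_(i < k.+1) gtop nu (0 - b) (k - i) u d' *
    xtop nu b i (u%:R - d'%:R) =
    cG u d' k + (if k is k'.+1 then (u%:R - d'%:R) * cG u d' k' else 0).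
  rewrite big_ord1 subnn (sum_xtop0 (fun i => gtop nu 0 i u d')) IHu //.
  by case: k ltk => [|k] // ltk; rewrite IHu // ltnW.
by elim: d => [|d IHd]; rewrite gtopS // cGS // main // IHd.
Qed.

Lemma gtop_cF k u d : (k < trunc_order)%N -> gtop nu 1 k u d = contr 1 (cF u d) k.
Proof.
have step w d' : (forall k, (k < trunc_order)%N -> gtop nu 1 k w d' = contr 1 (cF w d') k) ->
    forall k, (k < trunc_order)%N -> \sum_(b < 2) \sum_(i < k.+1)
      gtop nu (1 - b) (k - i) w d' * xtop nu b i (w%:R - d'%:R) =
    contr 1 (fun m r => cF w d' m r + (if r is r'.+1 then (w%:R - d'%:R) * cF w d' m r' else 0)
      + (w%:R - d'%:R) ^+ m * cG w d' r) k.
  move=> IH {}k ltk; rewrite !contrD contr_shift contr_pow big_ord_recr big_ord1 /=.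
  rewrite (sum_xtop0 (fun i => gtop nu 1 i w d')); congr (_ + _ + _); first exact: IH.
    by case: k ltk => [|k] // ltk; rewrite IH // ltnW.
  apply: eq_bigr => i _; rewrite gtop_cG //; exact: leq_ltn_trans (leq_subr _ _) ltk.
elim: u d k => [|u IHu] d k ltk.
  rewrite gtop0 /= mulr0n -(contr0 1 k); apply: eq_contr => m r _.
  by rewrite /cF at2_zeros.
elim: d => [|d IHd]; rewrite gtopS // (step _ _ (IHu _)) //.
  rewrite addr0; apply: eq_contr => m r le.
  by rewrite cFS ?addr0 //; apply: leq_ltn_trans le ltk.
rewrite IHd -contrD; apply: eq_contr => m r le.
by rewrite [in RHS]cFS //; apply: leq_ltn_trans le ltk.
Qed.

(** Order 2 in t comes from one term y_2 or from two terms y_1; the outer contraction inserts the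
    later of these two. *)
Lemma gtop_cS k u d : (k < trunc_order)%N -> gtop nu 2 k u d =
  contr 2 (cF u d) k + contr 1 (fun m r => contr 1 (cS u d m) r) k.
Proof.
have stepF w d' B b : forall k, (k < trunc_order)%N ->
    contr b (fun m r => cF w d' m r + (if r is r'.+1 then (w%:R - d'%:R) * cF w d' m r' else 0)
      + (w%:R - d'%:R) ^+ m * cG w d' r + B m r) k =
    contr b (cF w d') k + (if k is k'.+1 then (w%:R - d'%:R) * contr b (cF w d') k' else 0)
    + \sum_(i < k.+1) gtop nu 0 (k - i) w d' * xtop nu b i (w%:R - d'%:R) + contr b B k.
  move=> {}k ltk; rewrite !contrD contr_shift contr_pow; congr (_ + _ + _).
  apply: eq_bigr => i _; rewrite gtop_cG //; exact: leq_ltn_trans (leq_subr _ _) ltk.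
have stepS w d' B : forall k, (k < trunc_order)%N ->
    contr 1 (fun m r => contr 1 (fun m2 r2 => cS w d' m m2 r2
       + (if r2 is r'.+1 then (w%:R - d'%:R) * cS w d' m m2 r' else 0)
       + (w%:R - d'%:R) ^+ m * cF w d' m2 r2 + B m m2 r2) r) k =
    contr 1 (fun m r => contr 1 (cS w d' m) r) k
    + (if k is k'.+1 then (w%:R - d'%:R) * contr 1 (fun m r => contr 1 (cS w d' m) r) k' else 0)
    + \sum_(i < k.+1) gtop nu 1 (k - i) w d' * xtop nu 1 i (w%:R - d'%:R)
    + contr 1 (fun m r => contr 1 (B m) r) k.
  move=> {}k ltk.
  transitivity (contr 1 (fun m r => contr 1 (cS w d' m) r
      + (if r is r'.+1 then (w%:R - d'%:R) * contr 1 (cS w d' m) r' else 0)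
      + (w%:R - d'%:R) ^+ m * gtop nu 1 r w d' + contr 1 (B m) r) k).
    apply: eq_contr => m r le; rewrite !contrD contr_shift contr_scale gtop_cF //.
    by apply: leq_ltn_trans ltk; apply: leq_trans le; apply: leq_addl.
  by rewrite !contrD (contr_shift _ (fun m r => contr 1 (cS w d' m) r))
    (contr_pow 1 (fun r => gtop nu 1 r w d')).
elim: u d k => [|u IHu] d k ltk.
  rewrite gtop0 /= mulr0n (@eq_contr 2 _ (fun _ _ => 0)); last
    by move=> m r _; rewrite /cF at2_zeros.
  rewrite contr0 add0r -(contr0 1 k); apply: eq_contr => m r _.
  by rewrite -(contr0 1 r); apply: eq_contr => m2 r2 _; rewrite /cS at3_zeros.
have shape d' B2 B1 : \sum_(b < 3) \sum_(i < k.+1)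
      gtop nu (2 - b) (k - i) u d' * xtop nu b i (u%:R - d'%:R)
      + (contr 2 B2 k + contr 1 (fun m r => contr 1 (B1 m) r) k) =
    contr 2 (fun m r => cF u d' m r + (if r is r'.+1 then (u%:R - d'%:R) * cF u d' m r' else 0)
      + (u%:R - d'%:R) ^+ m * cG u d' r + B2 m r) k
    + contr 1 (fun m r => contr 1 (fun m2 r2 => cS u d' m m2 r2
       + (if r2 is r'.+1 then (u%:R - d'%:R) * cS u d' m m2 r' else 0)
       + (u%:R - d'%:R) ^+ m * cF u d' m2 r2 + B1 m m2 r2) r) k.
  rewrite stepF // stepS // [\sum_(b < 3) _]big_ord_recr [\sum_(b < 2) _]big_ord_recr big_ord1 /=.
  rewrite (sum_xtop0 (fun i => gtop nu 2 i u d')) IHu //.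
  case: k ltk => [|k] ltk; last rewrite IHu; try (by rewrite ltnW); ring.
elim: d => [|d IHd]; rewrite gtopS //.
  have := shape 0%N (fun _ _ => 0) (fun _ _ _ => 0).
  rewrite contr0 (@eq_contr 1 (fun m r => contr 1 (fun _ _ => 0) r) (fun _ _ => 0)); last first.
    by move=> m r _; rewrite contr0.
  rewrite contr0 !addr0 => ->; congr (_ + _); apply: eq_contr => m r le.
    by rewrite cFS ?addr0 //; apply: leq_ltn_trans le ltk.
  by apply: eq_contr => m2 r2 le2; rewrite cSS ?addr0 //; move: ltk; rewrite /trunc_order; lia.
rewrite IHd shape; congr (_ + _); apply: eq_contr => m r le.
  by rewrite [in RHS]cFS //; apply: leq_ltn_trans le ltk.
by apply: eq_contr => m2 r2 le2; rewrite [in RHS]cSS //; move: ltk; rewrite /trunc_order; lia.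
Qed.

Lemma ztop1 k : (k < trunc_order)%N -> ztop nu 1 k = (2 * nu)%:R * cG nu nu.-1 k.
Proof. by move=> ltk; rewrite ztopS // gtop_cG. Qed.

Lemma ztop2 k : (k < trunc_order)%N -> ztop nu 2 k = (2 * nu)%:R * contr 1 (cF nu nu.-1) k.
Proof. by move=> ltk; rewrite ztopS // gtop_cF. Qed.

Lemma ztop3 k : (k < trunc_order)%N -> ztop nu 3 k = (2 * nu)%:R *
  (contr 2 (cF nu nu.-1) k + contr 1 (fun m r => contr 1 (cS nu nu.-1 m) r) k).
Proof. by move=> ltk; rewrite ztopS // gtop_cS. Qed.

Definition brow n : seq Z := iter n (mulX (Zpos xH) Z0) (Zpos xH :: zeros trunc_order.-1).

Lemma size_brow n : size (brow n) = trunc_order.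
Proof. by elim: n => //= n IHn; rewrite size_mulX. Qed.

Lemma at1_brow n m : (m < trunc_order)%N -> at1 (brow n) m = 'C(n, m)%:R.
Proof.
elim: n m => [|n IHn] m ltm.
  by rewrite bin0n; apply: (cG0 0 m).
rewrite /brow iterS -/(brow n) at1_mulX ?size_brow // IHn //.
case: m ltm => [|m] ltm; first by rewrite ratZ0 addr0 !bin0.
by rewrite IHn 1?ltnW // ratZ1 mul1r binS natrD.
Qed.

Definition wtab (z : seq Z) (d : nat) : seq (seq Z) :=
  [seq let zl := nth Z0 z l in [seq Z.mul zl y | y <- take (trunc_order - l) (brow (d - l))]
  | l <- iota 0 trunc_order].

Lemma at2_wtab z d l m : (l + m < trunc_order)%N ->
  at2 (wtab z d) l m = at1 z l * 'C(d - l, m)%:R.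
Proof.
move=> lt; have ltl : (l < trunc_order)%N by lia.
rewrite /at2 (nth_map 0%N) ?size_iota // nth_iota // add0n /at1.
have ltm : (m < trunc_order - l)%N by lia.
rewrite (nth_map Z0) ?size_takel ?size_brow ?leq_subr //.
by rewrite ratZM nth_take // -[ratZ (nth _ (brow _) _)]/(at1 _ _) at1_brow //; lia.
Qed.

Definition contrZ (w A : seq (seq Z)) (k : nat) : Z :=
  sumZ (fun i => sumZ (fun l =>
    Z.mul (nth Z0 (nth [::] w l) (i - l)) (nth Z0 (nth [::] A (i - l)) (k - i))) i.+1) k.+1.

Lemma contrZE b z A k : (k < trunc_order)%N ->
  (forall l, (l < trunc_order)%N -> at1 z l = ztop nu b l) ->
  ratZ (contrZ (wtab z (ydeg nu b)) A k) = contr b (at2 A) k.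
Proof.
move=> ltk zE; rewrite ratZ_sum; apply: eq_bigr => i _; rewrite ratZ_sum.
apply: eq_bigr => l _; have := ltn_ord i; have := ltn_ord l => ltl lti.
rewrite ratZM -/(at1 _ _) -/(at2 _ _ _) at2_wtab; last by move: ltk; rewrite /trunc_order; lia.
by rewrite zE //; move: ltk; rewrite /trunc_order; lia.
Qed.

Definition evens : seq nat := [seq (2 * g)%N | g <- iota 0 6].

(** The contractions run over all indices of [z1] and [z2], but only the even ones, twice a genus,
    are returned. *)
Definition contract (c : cell) : seq (seq Z) :=
  let: (g, f, s) := c in
  let v := Z.of_nat (2 * nu) in
  let z1 := [seq Z.mul v y | y <- g] in
  let w1 := wtab z1 (ydeg nu 1) in
  let z2 := [seq Z.mul v (contrZ w1 f k) | k <- iota 0 trunc_order] in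
  let w2 := wtab z2 (ydeg nu 2) in
  let T := [seq [seq contrZ w1 (nth [::] s m) r | r <- iota 0 (trunc_order - m)]
    | m <- iota 0 trunc_order] in
  let z3 := [seq Z.mul v (Z.add (contrZ w2 f k) (contrZ w1 T k)) | k <- evens] in
  [:: [seq nth Z0 z1 k | k <- evens]; [seq nth Z0 z2 k | k <- evens]; z3].

Lemma contractE j g : (j < 3)%N -> (g < 6)%N ->
  ratZ (nth Z0 (nth [::] (contract (cells nu nu.-1)) j) g) = ztop nu j.+1 (2 * g).
Proof.
move=> ltj ltg; have := shaped_cells nu nu.-1.
have F1 := ztop1; have F2 := ztop2; have F3 := ztop3.
rewrite /cG /cF /cS in F1 F2 F3; case: (cells nu nu.-1) F1 F2 F3 => -[G F] S F1 F2 F3 [sG tF tS].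
rewrite /= in F1 F2 F3 sG tF tS; lazy beta iota zeta delta [contract].
have lto : (2 * g < trunc_order)%N by rewrite /trunc_order; lia.
have ev (T : Type) (x0 : T) (f : nat -> T) : nth x0 [seq f k | k <- evens] g = f (2 * g)%N.
  by rewrite /evens -map_comp (nth_map 0%N) ?size_iota // nth_iota.
set z1 := map _ G; have z1E l : (l < trunc_order)%N -> at1 z1 l = ztop nu 1 l.
  by move=> ltl; rewrite F1 // /at1 (nth_map Z0) ?sG // ratZM ratZ_nat.
set z2 := map _ (iota 0 trunc_order); have z2E l : (l < trunc_order)%N -> at1 z2 l = ztop nu 2 l.
  move=> ltl; rewrite F2 // /at1 (nth_map 0%N) ?size_iota // nth_iota // ratZM ratZ_nat.
  by rewrite (contrZE _ _ z1E).
set T := map _ (iota 0 trunc_order).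
case: j ltj => [|[|[|//]]] _.
- rewrite -[LHS]/(ratZ (nth Z0 [seq nth Z0 z1 k | k <- evens] g)) ev; exact: z1E.
- rewrite -[LHS]/(ratZ (nth Z0 [seq nth Z0 z2 k | k <- evens] g)) ev; exact: z2E.
rewrite -[LHS]/(ratZ (nth Z0 [seq Z.mul (Z.of_nat (2 * nu))
  (Z.add (contrZ (wtab z2 (ydeg nu 2)) F k) (contrZ (wtab z1 (ydeg nu 1)) T k)) | k <- evens] g)).
rewrite ev ratZM ratZ_nat ratZD (contrZE _ _ z1E) // (contrZE _ _ z2E) // F3 //.
congr (_ * (_ + _)); apply: eq_contr => m r le.
have ltm : (m < trunc_order)%N by move: lto; rewrite /trunc_order; lia.
have ltr : (r < trunc_order - m)%N by move: lto; rewrite /trunc_order; lia.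
rewrite /at2 /at1 (nth_map 0%N) ?size_iota // nth_iota // (nth_map 0%N) ?size_iota // nth_iota //.
rewrite !add0n (contrZE _ _ z1E) //; move: lto; rewrite /trunc_order; lia.
Qed.

End Contraction.

Definition ztable N : seq (seq (seq Z)) :=
  [seq contract p.1.+1 p.2 | p <- zip (iota 0 N)
    (diagonal cell_step cell_add cell_zero 0 N (nseq N cell_one))].

Lemma ztableE N nu j g : 0 < nu <= N -> j < 3 -> g < 6 ->
  ratZ (nth Z0 (nth [::] (nth [::] (ztable N) nu.-1) j) g) = ztop nu j.+1 (2 * g).
Proof.
case: nu => [//|nu] /andP[_ leN] ltj ltg; rewrite /ztable.
have -> : nseq N cell_one = [seq cells 0 k | k <- iota 0 N].
  by rewrite -[N in nseq N _](size_iota 0 N); elim: (iota 0 N) => //= a s ->.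
rewrite diagonalE // (nth_map (0, cell_zero)) ?size_zip ?size_map ?size_iota ?minnn; last by lia.
rewrite nth_zip ?size_map ?size_iota //= (nth_map 0) ?size_iota ?nth_iota; try lia.
by rewrite !add0n; apply: contractE.
Qed.

(** Evaluated once, so that all eighteen checks share the table. *)
Definition ztab := Eval vm_compute in ztable 23.
Lemma ztabE : ztable 23 = ztab.
Proof. vm_cast_no_check (erefl ztab). Qed.

(** * Interpolation *)

(** Every orbit is a pair, and there are 2 j nu + 2 half-edges. *)
Lemma card_porbits_matching nu j (m : {perm half_edge nu j}) :
  is_matching m -> #|porbits m| = (j * nu).+1.
Proof.
move=> /forallP mm; have porb h : porbit m h = [set h; m h].
  apply/setP => z; rewrite !inE; apply/porbitP/orP => [[i ->]|[/eqP ->|/eqP ->]].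
  - elim: i => [|i [/eqP e|/eqP e]]; first by left; rewrite perm1.
      by right; rewrite expgSr permM e.
    by left; rewrite expgSr permM e; have /andP[] := mm h.
  - by exists 0; rewrite perm1.
  - by exists 1; rewrite expg1.
have : #|[set: half_edge nu j]| = #|porbits m| * 2.
  have pP : partition (porbits m) [set: half_edge nu j].
    apply/and3P; split.
    - by apply/eqP/setP => h; rewrite inE; apply/bigcupP; exists (porbit m h);
        [apply: imset_f | apply: porbit_id].
    - apply/trivIsetP => _ _ /imsetP[h _ ->] /imsetP[h' _ ->] ne.
      rewrite -setI_eq0; apply: contraR ne => /set0Pn[z]; rewrite inE => /andP[zh zh'].
      by rewrite -!eq_porbit_mem in zh zh'; rewrite -(eqP zh) (eqP zh').
    - by apply/imsetP => -[h _ e]; have := porbit_id m h; rewrite -e inE.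
  apply: card_uniform_partition pP => _ /imsetP[h _ ->].
  by rewrite porb cards2; have /andP[/negbTE ne _] := mm h; rewrite eq_sym ne.
rewrite cardsT /half_edge card_sum card_prod !card_ord; lia.
Qed.

(** With j + 2 vertices and j nu + 1 edges, Euler's formula makes the number of faces j (nu - 1) + 1
    - 2 g, so genus g is the leading coefficient of index 2 g. *)
Lemma num_graphs_ztop g nu j : 0 < nu ->
  ((num_graphs g nu j)%:R = j`!%:R * ztop nu j (2 * g) :> rat)%R.
Proof.
move=> nu0; have degE : ydeg nu j + j = (j * nu).+1
  by rewrite /ydeg -[in RHS](prednK nu0) mulnS; lia.
have -> : num_graphs g nu j = #|[set m : {perm half_edge nu j} |
   (is_matching m && is_connected m) && (#|porbits (face_perm m)| + 2 * g == ydeg nu j)]|.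
  apply: eq_card => m; rewrite !inE; case mm : (is_matching m) => //=.
  case: (is_connected m) => //=; rewrite /has_genus (card_porbits_matching mm).
  rewrite /vertex card_sum !card_ord -degE.
  by apply/eqP/eqP; move: (ydeg nu j) #|porbits (face_perm m)| => a b; lia.
have := congr1 (fun p => top (ydeg nu j) p (2 * g)) (sum_connected_freud_polyX j nu0).
rewrite topZ -/(ztop _ _ _) => <-; rewrite top_sum -sum1_card natr_sum.
rewrite (eq_bigl (fun m => (is_matching m && is_connected m) &&
   (#|porbits (face_perm m)| + 2 * g == ydeg nu j))); last by move=> m; rewrite inE.
rewrite big_mkcondr /=; apply: eq_bigr => m _; rewrite topE coefXn.
case: leqP => [le|lt]; last by rewrite ifF //; apply/negP => /eqP; lia.
have -> : (ydeg nu j - 2 * g == #|porbits (face_perm m)|) =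
  (#|porbits (face_perm m)| + 2 * g == ydeg nu j) by lia.
by case: ifP.
Qed.

Local Open Scope ring_scope.

(** The function on Z is what gets evaluated; the polynomial only serves to bound its degree. *)
Definition zpoly_fun n (F : Z -> Z) := exists2 p : {poly rat},
  (size p <= n.+1)%N & forall z, ratZ (F z) = p.[ratZ z].

Lemma zpoly_fun_const a : zpoly_fun 0 (fun=> a).
Proof.
by exists (ratZ a)%:P; [rewrite size_polyC leq_b1 | move=> z; rewrite hornerC].
Qed.

Lemma zpoly_fun_id : zpoly_fun 1 id.
Proof. by exists 'X; [rewrite size_polyX | move=> z; rewrite hornerX]. Qed.

Lemma zpoly_funD n m F G : zpoly_fun n F -> zpoly_fun m G ->
  zpoly_fun (maxn n m) (fun z => Z.add (F z) (G z)).
Proof.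
move=> [p sp pE] [q sq qE]; exists (p + q); last by move=> z; rewrite ratZD pE qE hornerD.
rewrite (leq_trans (size_polyD _ _)) // -maxnSS geq_max.
by rewrite (leq_trans sp) ?leq_maxl // (leq_trans sq) ?leq_maxr.
Qed.

Lemma zpoly_funN n F : zpoly_fun n F -> zpoly_fun n (fun z => Z.opp (F z)).
Proof.
move=> [p sp pE]; exists (- p); first by rewrite size_polyN.
by move=> z; rewrite ratZN pE hornerN.
Qed.

Lemma zpoly_funB n m F G : zpoly_fun n F -> zpoly_fun m G ->
  zpoly_fun (maxn n m) (fun z => Z.sub (F z) (G z)).
Proof. by move=> zF /zpoly_funN; apply: zpoly_funD. Qed.

Lemma zpoly_funM n m F G : zpoly_fun n F -> zpoly_fun m G ->
  zpoly_fun (n + m) (fun z => Z.mul (F z) (G z)).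
Proof.
move=> [p sp pE] [q sq qE]; exists (p * q); first exact: size_polyM_leS.
by move=> z; rewrite ratZM pE qE hornerM.
Qed.

Lemma zpoly_funX n F k : zpoly_fun n F ->
  zpoly_fun (n * Pos.to_nat k) (fun z => Z.pow (F z) (Zpos k)).
Proof.
move=> zF; suff [p sp pE] : zpoly_fun (n * Pos.to_nat k)
    (fun z => Z.pow (F z) (Z.of_nat (Pos.to_nat k))).
  by exists p => // z; rewrite -pE positive_nat_Z.
elim: (Pos.to_nat k) => [|i [p sp pE]]; first by rewrite muln0; apply: (zpoly_fun_const 1).
rewrite mulnS; have [q sq qE] := zpoly_funM zF (ex_intro2 _ _ p sp pE).
by exists q => // z; rewrite -qE Nat2Z.inj_succ Z.pow_succ_r //; apply: Nat2Z.is_nonneg.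
Qed.

Lemma zpoly_fun_leq n m F : (n <= m)%N -> zpoly_fun n F -> zpoly_fun m F.
Proof. by move=> le [p sp pE]; exists p => //; apply: leq_trans sp _. Qed.

Fixpoint fallZ (k : nat) (z : Z) : Z :=
  if k is k'.+1 then Z.mul (fallZ k' z) (Z.sub z (Z.of_nat k)) else z.

Lemma falling_fallZ nu k : falling nu k = ratZ (fallZ k (Z.of_nat nu)).
Proof.
elim: k => [|k IHk]; rewrite /falling; first by rewrite big_nat1 subr0 ratZ_nat.
by rewrite big_nat_recr // -/(falling nu k) IHk ratZM ratZB !ratZ_nat.
Qed.

Lemma zpoly_fun_fallZ k : zpoly_fun k.+1 (fallZ k).
Proof.
elim: k => [|k IHk]; first exact: zpoly_fun_id.
by rewrite -[k.+2]addn1; apply: (zpoly_funM IHk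
  (zpoly_funB zpoly_fun_id (zpoly_fun_const (Z.of_nat k.+1)))).
Qed.

Lemma cG_bin u d : cG u d 0 = 'C(u + d, u)%:R.
Proof.
elim: u d => [|u IHu] d; first by rewrite cG0 bin0.
elim: d => [|d IHd]; rewrite cGS // addr0 IHu; first by rewrite !addn0 !binn addr0.
by rewrite IHd addSnnS [(u.+1 + _)%N]addSn binS natrD addrC.
Qed.

(** Thus the table itself supplies [c nu] to the checks, and no binomial coefficient is computed in
    unary arithmetic. *)
Lemma ztop_c nu : (0 < nu)%N -> ztop nu 1 0 = (c nu)%:R.
Proof. by move=> nu0; rewrite ztop1 // cG_bin -natrM bin_c. Qed.

Definition zval nu j g : Z := nth Z0 (nth [::] (nth [::] ztab nu.-1) j.-1) g.

Lemma zvalE nu j g : (0 < nu <= 23)%N -> (0 < j <= 3)%N -> (g < 6)%N ->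
  ratZ (zval nu j g) = ztop nu j (2 * g).
Proof.
move=> hnu /andP[j0 lej] ltg; rewrite /zval -ztabE ztableE ?prednK //.
Qed.

(* The difference of the two sides of the interpolated identity has degree at most 22. *)
Lemma num_graphs_of_check g j num den : (0 < j <= 3)%N -> (g < 6)%N -> den != Z0 ->
  zpoly_fun 22 num ->
  (forall nu, Q_poly g j nu = ratZ (num (Z.of_nat nu)) / ratZ den) ->
  all (fun nu => Z.eqb (Z.mul (Z.mul (Z.of_nat j`!) den) (zval nu j g))
    (Z.mul (iter j (Z.mul (zval nu 1 0)) (Zpos xH)) (num (Z.of_nat nu)))) (iota 1 23) ->
  forall nu, (0 < nu)%N -> (num_graphs g nu j)%:R = (c nu)%:R ^+ j * Q_poly g j nu.
Proof.
move=> hj ltg den0 [p sp pE] QE chk nu nu0; have [j0 lej] := andP hj.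
have [q sq qE] := zpoly_all (2 * g) j0.
have rden0 : ratZ den != 0 by rewrite ratZ_eq0.
(* Both polynomials have size at most 23, so agreement at the 23 points 1, ..., 23 suffices. *)
suff pq : j`!%:R *: q = (ratZ den)^-1 *: p.
  rewrite num_graphs_ztop // qE // QE pE ratZ_nat.
  have := congr1 (fun f : {poly rat} => f.[nu%:R]) pq; rewrite !hornerZ => e.
  by rewrite mulrCA e; congr (_ * _); apply: mulrC.
apply/eqP; rewrite -subr_eq0; apply: contraT => nz.
have := @max_poly_roots _ _ [seq (k%:R : rat) | k <- iota 1 23] nz.
rewrite size_map size_iota => mr.
have {}mr : (23 < size (j`!%:R *: q - (ratZ den)^-1 *: p)%R)%N.
  apply: mr; last by rewrite map_inj_uniq ?iota_uniq // => a b /eqP; rewrite eqr_nat => /eqP.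
  apply/allP => _ /mapP[k kin ->]; rewrite /root !hornerE subr_eq0; apply/eqP.
  have := allP chk k kin; rewrite mem_iota in kin.
  have kin' : (0 < k <= 23)%N by lia.
  have [k0 lek] := andP kin'.
  move=> /Z.eqb_eq/(congr1 ratZ); rewrite !ratZM ratZ_nat zvalE //.
  have -> : ratZ (iter j (Z.mul (zval k 1 0)) (Zpos xH)) = (c k)%:R ^+ j.
    elim: (j) => [|i IHi]; first by rewrite ratZ1.
    by rewrite iterS ratZM IHi zvalE // ztop_c // exprS.
  rewrite pE ratZ_nat qE // => e.
  have c0 : (c k)%:R ^+ j != 0 :> rat by rewrite expf_neq0 // pnatr_eq0 -lt0n c_gt0.
  apply: (mulfI (mulf_neq0 rden0 c0)).
  transitivity (j`!%:R * ratZ den * ((c k)%:R ^+ j * q.[k%:R])); first by ring.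
  by rewrite e mulrACA mulrC -mulrA [_ * ((c k)%:R ^+ j)]mulrC mulrA mulfV // mul1r mulrC.
move: mr; rewrite ltnNge => /negP[]; apply: leq_trans (size_polyD _ _) _.
rewrite size_polyN geq_max; apply/andP; split; apply: leq_trans (size_scale_leq _ _) _ => //.
(* The bound is 2 (2 g) + j, at most 4 * 5 + 3 = 23. *)
by apply: leq_trans sq _; lia.
Qed.

(** * The shapes of the entries of [Q_poly] and their verification *)

Section QForms.
Variables (N D a : Z) (nu k : nat).
Let v := Z.of_nat nu.

Lemma Q_form_frac : ratZ N / ratZ D * ratZ a * falling nu k =
  ratZ (Z.mul (Z.mul N a) (fallZ k v)) / ratZ D.
Proof. by rewrite falling_fallZ !ratZM; ring. Qed.

Lemma Q_form_inv : 1 / ratZ D * ratZ a * falling nu k = ratZ (Z.mul a (fallZ k v)) / ratZ D.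
Proof. by rewrite falling_fallZ ratZM; ring. Qed.

Lemma Q_form_falling : 1 / ratZ D * falling nu k = ratZ (fallZ k v) / ratZ D.
Proof. by rewrite falling_fallZ; ring. Qed.

Lemma Q_form_int : ratZ a = ratZ a / ratZ 1.
Proof. by rewrite ratZ1 divr1. Qed.

End QForms.

Ltac zpoly_fun_tac :=
  repeat first [ exact: zpoly_fun_const | exact: zpoly_fun_id | exact: zpoly_fun_fallZ
    | apply: zpoly_funB | apply: zpoly_funD | apply: zpoly_funM | apply: zpoly_funX ].

Ltac check_with num den form :=
  let F := eval cbv beta in num in
  refine (@num_graphs_of_check _ _ F den _ _ _ _ _ _ _ _);
  [ by [] | by [] | by []
  | eapply zpoly_fun_leq; [| solve [zpoly_fun_tac]]; by vm_compute
  | move=> ?; exact: form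
  | by vm_compute
  | assumption ].

(** Abstracting [Z.of_nat nu] from an entry of [Q_poly] yields one function on Z, which serves for
    both the degree bound and the 23 evaluations. *)
Ltac check_values :=
  lazymatch goal with |- context [Q_poly ?g ?j ?nu] =>
    let q := eval cbv beta iota zeta delta [Q_poly] in (Q_poly g j nu) in
    lazymatch q with
    | ratZ ?N / ratZ ?D * ratZ ?e * falling _ ?k =>
      let P := eval pattern (Z.of_nat nu) in e in
      lazymatch P with ?P _ =>
        check_with (fun z => Z.mul (Z.mul N (P z)) (fallZ k z)) D Q_form_frac end
    | 1 / ratZ ?D * ratZ ?e * falling _ ?k =>
      let P := eval pattern (Z.of_nat nu) in e in
      lazymatch P with ?P _ => check_with (fun z => Z.mul (P z) (fallZ k z)) D Q_form_inv end
    | 1 / ratZ ?D * falling _ ?k => check_with (fallZ k) D Q_form_falling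
    | ratZ ?e =>
      let P := eval pattern (Z.of_nat nu) in e in
      lazymatch P with ?P _ => check_with P (Zpos xH) Q_form_int end
    end
  end.

Theorem theorem2p3 (nu g j : nat) (hnu : (1 <= nu)%N) (hg : (g <= 5)%N)
    (hj : (1 <= j <= 3)%N) :
  ((num_graphs g nu j)%:R = (c nu)%:R ^+ j * Q_poly g j nu :> rat)%R.
Proof.
case: j hj => [//|[|[|[|//]]]] _; case: g hg => [|[|[|[|[|[|//]]]]]] _.
all: check_values.
Qed.
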